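(* Let $V,W$ be finite dimensional complex Hilbert spaces and let $u\in\mathcal L(V)\otimes\mathcal L(W)$ be a twisted biunitary. If $(H,v,\pi)$ is the minimal model for $u$ (over the field $\mathbb C$) then there exists an involution on the Hopf algebra $H$ such that: (i) $v$ is a unitary corepresentation and $\pi$ is a $*$-representation; (ii) $H$ has a (biggest) $C^*$-norm; (iii) $(\bar H,v)$ satisfies Woronowicz' axioms, where $\bar H$ is the completion of $H$ with respect to its biggest $C^*$-norm. Moreover, this involution of $H$ is the unique one such that $v$ is unitary.
   Context: Here $k=\mathbb C$. $\mathcal L(V)$ is the algebra of linear operators on $V$, $t:\mathcal L(V)\to\mathcal L(V^* )$ is the transposition $t(T)(f)=f\circ T$, and $Q^t=t(Q)$. Leg-numbering notation $v_{12},v_{13}$ is used. Algebras and morphisms are unital. Twisted biunitary: a unitary $u\in\mathcal L(V)\otimes\mathcal L(W)$, with $V,W$ finite dimensional Hilbert spaces, such that for some positive (invertible) operator $Q\in\mathcal L(V)$, $$((Q^t)^{-2}\otimes id)\,((t\otimes id)u^{-1})\,((Q^t)^2\otimes id)=((t\otimes id)u)^{-1}.$$ Models. A representation of a Hopf $\mathbb C$-algebra $H$ is an algebra morphism $\pi:H\to\mathcal L(W)$. A corepresentation is an element $v\in\mathcal L(V)\otimes H$ with $(id\otimes\Delta)v=v_{12}v_{13}$ and $(id\otimes\varepsilon)v=1$; its coefficients are the elements of $\mathcal C_v=\{(f\otimes id)v\mid f\in\mathcal L(V)^*\}\subset H$. A model for $u$ is a triple $(H,v,\pi)$ with $H$ a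 Hopf $\mathbb C$-algebra, $v\in\mathcal L(V)\otimes H$ a corepresentation and $\pi:H\to\mathcal L(W)$ a representation such that $(id\otimes\pi)v=u$. It is left-faithful if $H$ is generated as a unital algebra by $\bigcup_{n\ge0}S^n(\mathcal C_v)$. A morphism of left-faithful models $(H_1,v_1,\pi_1)\to(H_2,v_2,\pi_2)$ of $u$ is a Hopf algebra morphism $f:H_1\to H_2$ with $(id\otimes f)v_1=v_2$ and $\pi_1=\pi_2f$. The minimal model is the universally attracting (terminal) object of the category of left-faithful models for $u$; it exists for every twisted biunitary. Involutions and norms. An involution of a $\mathbb C$-algebra is a unital antilinear antimultiplicative map $*$ with $*^2=id$. An involution of a Hopf $\mathbb C$-algebra $H$ is an involution of the underlying algebra such that $\Delta(a^* )=\Delta(a)^*$, $\varepsilon(a^* )=\overline{\varepsilon(a)}$, $S(S(a^* )^* )=a$ for all $a\in H$. A $C^*$-norm on a $*$-algebra is an algebra norm with $\|a^*a\|=\|a\|^2$ for all $a$. A corepresentation $v\in\mathcal L(V)\otimes H$ is unitary if it is a unitary element of the $*$-algebra $\mathcal L(V)\otimes H$. Woronowicz' axioms for a pair $(A,v)$, where $A$ is a unital $C^*$-algebra and $v\in\mathcal L(V)\otimes A$ is a unitary with $V$ a finite dimensional Hilbert space: (1) the $*$-subalgebra $A_s$ of $A$ generated by the coefficients of $v$ is dense in $A$; (2) there is a $C^*$-morphism $\delta:A\to A\otimes_{min}A$ with $(id\otimes\delta)v=v_{12}v_{13}$; (3) there is a linear antimultiplicative map $\kappa:A_s\to A_s$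 with $(id\otimes\kappa)v=v^{-1}$ and $\kappa(\kappa(a^* )^* )=a$ for all $a\in A_s$. *)

(* Defs.v *)
From HB Require Import structures.
From mathcomp Require Import all_boot all_order all_algebra.
From mathcomp Require Import generic_quotient sesquilinear spectral complex.
From mathcomp Require Import boolp classical_sets reals.

Set Implicit Arguments.
Unset Strict Implicit.
Unset Printing Implicit Defensive.

Import Order.TTheory GRing.Theory Num.Theory.
Local Open Scope ring_scope.
Local Open Scope classical_set_scope.
Local Open Scope quotient_scope.
Local Open Scope sesquilinear_scope.

(* [tensor U V] is the quotient of the formal sums [seq (U * V)] (the sequence
   [:: (u1, v1); ..; (uk, vk)] stands for the sum of the [ui (x) vi]) that
   identifies two sums exactly when every bilinear map takes the same value on
   both. *)

Section Tensor.
Variables (K : fieldType) (U V : lmodType K).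

Definition formal_sum (T : zmodType) (f : U -> V -> T) (s : seq (U * V)) : T :=
  \sum_(p <- s) f p.1 p.2.

Definition tensor_rel (s t : seq (U * V)) : bool :=
  `[< forall (T : lmodType K) (f : U -> V -> T), bilinear_for *:%R *:%R f ->
        formal_sum f s = formal_sum f t >].

Lemma tensor_rel_refl : reflexive tensor_rel.
Proof. by move=> s; apply/asboolP. Qed.

Lemma tensor_rel_sym : symmetric tensor_rel.
Proof.
by move=> s t; apply/asboolP/asboolP => h T f fb; rewrite (h T f fb).
Qed.

Lemma tensor_rel_trans : transitive tensor_rel.
Proof.
move=> s r t /asboolP h1 /asboolP h2; apply/asboolP => T f fb.
by rewrite (h1 T f fb) (h2 T f fb).
Qed.

Canonical tensor_equiv :=
  EquivRel tensor_rel tensor_rel_refl tensor_rel_sym tensor_rel_trans.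

Definition tensor := {eq_quot tensor_equiv}.
HB.instance Definition _ := Choice.on tensor.

Definition tens (u : U) (v : V) : tensor := \pi_({eq_quot tensor_equiv}) [:: (u, v)].

(* The map induced on [tensor U V] by [f].  It is only meaningful when the
   value of [formal_sum f] does not depend on the representative; besides
   bilinear maps [f], this is the case for the maps that are antilinear in both
   arguments. *)
Definition tlift (T : zmodType) (f : U -> V -> T) (x : tensor) : T :=
  formal_sum f (repr (x : {eq_quot tensor_equiv})).

Definition tpi (s : seq (U * V)) : tensor := \pi_({eq_quot tensor_equiv}) s.

Lemma tlift_pi (T : lmodType K) (f : U -> V -> T) s :
  bilinear_for *:%R *:%R f -> tlift f (tpi s) = formal_sum f s.
Proof.
move=> fb; rewrite /tlift /tpi.
have /eqmodP/asboolP h : repr (\pi_({eq_quot tensor_equiv}) s) = s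
  %[mod {eq_quot tensor_equiv}] by rewrite reprK.
exact: h.
Qed.

Lemma tensor_ext (x y : tensor) :
  (forall (T : lmodType K) (f : U -> V -> T), bilinear_for *:%R *:%R f ->
     tlift f x = tlift f y) -> x = y.
Proof.
move=> h; rewrite -[x]reprK -[y]reprK; apply/eqmodP/asboolP => T f fb.
exact: h.
Qed.

Definition tensor_zero : tensor := tpi [::].
Definition tensor_add (x y : tensor) : tensor := tpi (repr x ++ repr y).
Definition tensor_scale (a : K) (x : tensor) : tensor :=
  tpi [seq (a *: p.1, p.2) | p <- repr x].
Definition tensor_opp (x : tensor) : tensor := tensor_scale (-1) x.

Lemma tlift_zero (T : lmodType K) (f : U -> V -> T) :
  bilinear_for *:%R *:%R f -> tlift f tensor_zero = 0.
Proof. by move=> fb; rewrite tlift_pi // /formal_sum big_nil. Qed.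

Lemma tlift_add (T : lmodType K) (f : U -> V -> T) x y :
  bilinear_for *:%R *:%R f -> tlift f (tensor_add x y) = tlift f x + tlift f y.
Proof. by move=> fb; rewrite tlift_pi // /formal_sum big_cat. Qed.

Lemma tlift_scale (T : lmodType K) (f : U -> V -> T) a x :
  bilinear_for *:%R *:%R f -> tlift f (tensor_scale a x) = a *: tlift f x.
Proof.
move=> fb; rewrite tlift_pi // /formal_sum big_map /tlift /formal_sum.
rewrite scaler_sumr; apply: eq_bigr => p _ /=.
have f0 : f 0 p.2 = 0.
  by have := fb.1 p.2 (-1) 0 0; rewrite /= scaler0 addr0 scaleN1r addNr.
by have := fb.1 p.2 a p.1 0; rewrite /= f0 !addr0.
Qed.

Lemma tlift_opp (T : lmodType K) (f : U -> V -> T) x :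
  bilinear_for *:%R *:%R f -> tlift f (tensor_opp x) = - tlift f x.
Proof. by move=> fb; rewrite tlift_scale // scaleN1r. Qed.

Lemma tensor_addA : associative tensor_add.
Proof. by move=> x y z; apply: tensor_ext => T f fb; rewrite !tlift_add // addrA. Qed.

Lemma tensor_addC : commutative tensor_add.
Proof. by move=> x y; apply: tensor_ext => T f fb; rewrite !tlift_add // addrC. Qed.

Lemma tensor_add0 : left_id tensor_zero tensor_add.
Proof.
by move=> x; apply: tensor_ext => T f fb; rewrite tlift_add // tlift_zero // add0r.
Qed.

Lemma tensor_addN : left_inverse tensor_zero tensor_opp tensor_add.
Proof.
move=> x; apply: tensor_ext => T f fb.
by rewrite tlift_add // tlift_opp // tlift_zero // addNr.
Qed.

HB.instance Definition _ :=
  GRing.isZmodule.Build tensor tensor_addA tensor_addC tensor_add0 tensor_addN.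

Lemma tensor_scaleA a b x :
  tensor_scale a (tensor_scale b x) = tensor_scale (a * b) x.
Proof. by apply: tensor_ext => T f fb; rewrite !tlift_scale // scalerA. Qed.

Lemma tensor_scale1 : left_id 1 tensor_scale.
Proof. by move=> x; apply: tensor_ext => T f fb; rewrite tlift_scale // scale1r. Qed.

Lemma tensor_scaleDr : right_distributive tensor_scale +%R.
Proof.
move=> a x y; apply: tensor_ext => T f fb.
by rewrite tlift_scale // !tlift_add // !tlift_scale // scalerDr.
Qed.

Lemma tensor_scaleDl x : {morph tensor_scale^~ x : a b / a + b}.
Proof.
move=> a b; apply: tensor_ext => T f fb.
by rewrite tlift_add // !tlift_scale // scalerDl.
Qed.

HB.instance Definition _ := GRing.Zmodule_isLmodule.Build K tensor
  tensor_scaleA tensor_scale1 tensor_scaleDr tensor_scaleDl.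

End Tensor.

Notation "u \ox v" := (tens u v) (at level 40, left associativity) : ring_scope.

Section TensorMaps.
Variable K : fieldType.

Definition tmap (U V U' V' : lmodType K) (f : U -> U') (g : V -> V') :
    tensor U V -> tensor U' V' :=
  tlift (fun u v => f u \ox g v).

Definition tassoc (U V W : lmodType K) :
    tensor (tensor U V) W -> tensor U (tensor V W) :=
  tlift (fun x w => tlift (fun u v => u \ox (v \ox w)) x).

End TensorMaps.

Section TensorRing.
Variables (K : fieldType) (A B : algType K).
Implicit Types x y z : tensor A B.

Definition tensor_one : tensor A B := 1 \ox 1.
Definition tensor_mul x y : tensor A B :=
  tpi [seq (p.1 * q.1, p.2 * q.2) | p <- repr x, q <- repr y].

Let mulf (T : lmodType K) (f : A -> B -> T) y a b :=
  tlift (fun c d => f (a * c) (b * d)) y.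

Let mulfl (T : lmodType K) (f : A -> B -> T) a b :
  bilinear_for *:%R *:%R f ->
  bilinear_for *:%R *:%R (fun c d => f (a * c) (b * d)).
Proof.
move=> fb; split=> [d|c] k u v /=; rewrite mulrDr -scalerAr.
- exact: fb.1.
- exact: fb.2.
Qed.

Let mulf_bil (T : lmodType K) (f : A -> B -> T) y :
  bilinear_for *:%R *:%R f -> bilinear_for *:%R *:%R (mulf f y).
Proof.
move=> fb; split=> [d|c] k u v /=;
  rewrite /mulf /tlift /formal_sum scaler_sumr -big_split;
  apply: eq_bigr => p _ /=; rewrite mulrDl -scalerAl.
- exact: fb.1.
- exact: fb.2.
Qed.

Let tlift_mul (T : lmodType K) (f : A -> B -> T) x y :
  bilinear_for *:%R *:%R f -> tlift f (tensor_mul x y) = tlift (mulf f y) x.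
Proof.
move=> fb; rewrite tlift_pi // /formal_sum big_allpairs_dep.
by rewrite /tlift /formal_sum.
Qed.

Let tlift_one (T : lmodType K) (f : A -> B -> T) :
  bilinear_for *:%R *:%R f -> tlift f tensor_one = f 1 1.
Proof. by move=> fb; rewrite (tlift_pi _ fb) /formal_sum big_seq1. Qed.

Lemma tensor_mulA : associative tensor_mul.
Proof.
move=> x y z; apply: tensor_ext => T f fb.
rewrite !tlift_mul //; last exact: mulf_bil.
rewrite /tlift /formal_sum; apply: eq_bigr => p _ /=; rewrite /mulf.
rewrite tlift_mul; last exact: mulfl.
rewrite /tlift /formal_sum; apply: eq_bigr => q _ /=; rewrite /mulf /tlift.
by apply: eq_bigr => r _ /=; rewrite !mulrA.
Qed.

Lemma tensor_mul1l : left_id tensor_one tensor_mul.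
Proof.
move=> x; apply: tensor_ext => T f fb.
rewrite tlift_mul // tlift_one; last exact: mulf_bil.
by rewrite /mulf /tlift; apply: eq_bigr => p _; rewrite !mul1r.
Qed.

Lemma tensor_mul1r : right_id tensor_one tensor_mul.
Proof.
move=> x; apply: tensor_ext => T f fb; rewrite tlift_mul //.
rewrite [LHS]/tlift [RHS]/tlift; apply: eq_bigr => p _ /=.
by rewrite /mulf tlift_one ?mulr1 //; exact: mulfl.
Qed.

Lemma tensor_mulDl : left_distributive tensor_mul +%R.
Proof.
move=> x y z; apply: tensor_ext => T f fb.
by rewrite tlift_mul // !tlift_add ?tlift_mul //; exact: mulf_bil.
Qed.

Lemma tensor_mulDr : right_distributive tensor_mul +%R.
Proof.
move=> x y z; apply: tensor_ext => T f fb.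
rewrite tlift_mul // tlift_add // !tlift_mul //.
rewrite /tlift /formal_sum -big_split; apply: eq_bigr => p _ /=.
by rewrite /mulf tlift_add //; exact: mulfl.
Qed.

HB.instance Definition _ := GRing.Zmodule_isPzRing.Build (tensor A B)
  tensor_mulA tensor_mul1l tensor_mul1r tensor_mulDl tensor_mulDr.

End TensorRing.

HB.mixin Record isHopfAlgebra (K : fieldType) H of GRing.Algebra K H := {
  comul : {lrmorphism H -> tensor H H};
  counit : {lrmorphism H -> K^o};
  antipode : {linear H -> H};
  comulA : forall a : H,
    tassoc (tmap comul idfun (comul a)) = tmap idfun comul (comul a);
  counitl : forall a : H, tlift (fun b c => counit b *: c) (comul a) = a;
  counitr : forall a : H, tlift (fun b c => counit c *: b) (comul a) = a;
  antipodel : forall a : H,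
    tlift (fun b c => antipode b * c) (comul a) = (counit a)%:A;
  antipoder : forall a : H,
    tlift (fun b c => b * antipode c) (comul a) = (counit a)%:A
}.

#[short(type="hopfAlgType")]
HB.structure Definition HopfAlgebra (K : fieldType) :=
  {H of GRing.Algebra K H & isHopfAlgebra K H}.

(* [L(V) (x) A], for [V] of dimension [n] with a fixed orthonormal basis, is
   ['M[A]_n], the matrix [v] standing for the sum of the [e_ij (x) v i j].  Then
   [id (x) f] is [map_mx f] and [t (x) id] is [trmx]. *)

Definition mxinv (A : pzRingType) n (v w : 'M[A]_n) : Prop :=
  v *m w = 1%:M /\ w *m v = 1%:M.

Section Coefficients.
Variables (K : fieldType) (n : nat).

Definition coefficients (A : algType K) (v : 'M[A]_n) : set A :=
  [set a | exists f : {linear 'M[K]_n -> K^o},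
     a = \sum_i \sum_j f (delta_mx i j) *: v i j].

Definition corepresentation (H : hopfAlgType K) (v : 'M[H]_n) : Prop :=
  map_mx comul v
    = map_mx (fun a => a \ox 1) v *m map_mx (fun a => 1 \ox a) v
  /\ map_mx counit v = 1%:M.

End Coefficients.

Section Subalgebra.
Variables (K : fieldType) (A : algType K).

Definition subalgebra (P : set A) : Prop :=
  [/\ P 1, forall a b, P a -> P b -> P (a + b),
      forall a b, P a -> P b -> P (a * b)
    & forall (k : K) a, P a -> P (k *: a)].

End Subalgebra.

Definition hopf_morphism (K : fieldType) (H1 H2 : hopfAlgType K)
    (f : {lrmorphism H1 -> H2}) : Prop :=
  [/\ forall a, comul (f a) = tmap f f (comul a),
      forall a, counit (f a) = counit a
    & forall a, antipode (f a) = f (antipode a)].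

Section Models.
Variables (K : fieldType) (n m : nat) (u : 'M['M[K]_m]_n).

Record model := Model {
  model_alg : hopfAlgType K;
  model_corep : 'M[model_alg]_n;
  model_rep : {lrmorphism model_alg -> 'M[K]_m};
  model_corepP : corepresentation model_corep;
  model_eq : map_mx model_rep model_corep = u
}.

Definition left_faithful (M : model) : Prop :=
  smallest (@subalgebra K (model_alg M))
    (\bigcup_k (iter k (@antipode K (model_alg M)) @`
                  coefficients (model_corep M))) = setT.

Definition model_morphism (M1 M2 : model)
    (f : {lrmorphism model_alg M1 -> model_alg M2}) : Prop :=
  [/\ hopf_morphism f, map_mx f (model_corep M1) = model_corep M2
    & forall a, model_rep M1 a = model_rep M2 (f a)].

Definition minimal_model (M : model) : Prop :=
  left_faithful M /\
  forall M', left_faithful M' ->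
    exists2 f : {lrmorphism model_alg M' -> model_alg M}, model_morphism f
      & forall g : {lrmorphism model_alg M' -> model_alg M},
          model_morphism g -> g =1 f.

End Models.

Section Star.
Variable R : realType.
Local Notation C := R[i].

Section Involutions.
Variables (A : algType C) (st : A -> A).

Definition involution : Prop :=
  [/\ forall a b, st (a + b) = st a + st b,
      forall (k : C) a, st (k *: a) = Num.conj k *: st a,
      forall a b, st (a * b) = st b * st a, st 1 = 1
    & forall a, st (st a) = a].

Definition star_subalgebra (P : set A) : Prop :=
  subalgebra P /\ forall a, P a -> P (st a).

Definition complete_norm (X : zmodType) (N : X -> R) : Prop :=
  forall x : nat -> X,
    (forall e, 0 < e -> exists k, forall i j, (k <= i)%N -> (k <= j)%N ->
       N (x i - x j) < e) ->
    exists l, forall e, 0 < e -> exists k, forall i, (k <= i)%N ->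
       N (x i - l) < e.

Definition cstar_norm (N : A -> R) : Prop :=
  [/\ (forall a, 0 <= N a) /\ (forall a, N a = 0 -> a = 0),
      forall a b, N (a + b) <= N a + N b,
      forall (k : C) a, N (k *: a) = complex.Re `|k| * N a,
      forall a b, N (a * b) <= N a * N b
    & forall a, N (st a * a) = N a ^+ 2].

Definition biggest_cstar_norm (N : A -> R) : Prop :=
  cstar_norm N /\ forall N', cstar_norm N' -> forall a, N' a <= N a.

Definition cstar_algebra (N : A -> R) : Prop :=
  [/\ involution, cstar_norm N & complete_norm N].

End Involutions.

Definition mxstar (A : pzRingType) (st : A -> A) n (v : 'M[A]_n) : 'M[A]_n :=
  map_mx st v^T.

Definition mxunitary (A : pzRingType) (st : A -> A) n (v : 'M[A]_n) : Prop :=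
  mxinv v (mxstar st v).

(* [tmap st st] is the involution (a (x) b)^* = a^* (x) b^* of [H (x) H]; it is
   well defined because [st] is antilinear (see [tlift]). *)
Definition hopf_involution (H : hopfAlgType C) (st : H -> H) : Prop :=
  [/\ involution st, forall a, comul (st a) = tmap st st (comul a),
      forall a, counit (st a) = Num.conj (counit a : C)
    & forall a, antipode (st (antipode (st a))) = a].

Definition dense_isometry (X Y : zmodType) (NX : X -> R) (NY : Y -> R)
    (j : X -> Y) : Prop :=
  (forall x, NY (j x) = NX x) /\
  (forall y e, 0 < e -> exists x, NY (y - j x) < e).

Definition cstar_completion (H : algType C) (stH : H -> H) (NH : H -> R)
    (A : algType C) (stA : A -> A) (NA : A -> R) (j : {lrmorphism H -> A}) :
    Prop :=
  [/\ cstar_algebra stA NA, forall a, j (stH a) = stA (j a)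
    & dense_isometry NH NA j].

Record hilbert := Hilbert {
  hilbert_car :> lmodType C;
  hilbert_dot : {dot hilbert_car for Num.conj};
  hilbert_complete :
    complete_norm (fun x => Num.sqrt (complex.Re (hilbert_dot x x)))
}.

Definition hnorm (K : hilbert) (x : K) : R :=
  Num.sqrt (complex.Re (hilbert_dot K x x)).

Definition star_representation (A : algType C) (st : A -> A) (K : hilbert)
    (rho : A -> K -> K) : Prop :=
  [/\ (forall a, linear (rho a)) /\
      (forall a, exists c, forall x, hnorm (rho a x) <= c * hnorm x),
      forall x, linear (rho^~ x),
      forall x, rho 1 x = x,
      forall a b x, rho (a * b) x = rho a (rho b x)
    & forall a x y,
        hilbert_dot K (rho a x) y = hilbert_dot K x (rho (st a) y)].

(* <x1 (x) x2, y1 (x) y2> = <x1, y1> <x2, y2>. *)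
Definition tensor_dot (K1 K2 : hilbert) (s t : tensor K1 K2) : C :=
  tlift (fun x1 x2 =>
    tlift (fun y1 y2 => hilbert_dot K1 x1 y1 * hilbert_dot K2 x2 y2) t) s.

Definition tensor_hnorm (K1 K2 : hilbert) (s : tensor K1 K2) : R :=
  Num.sqrt (complex.Re (tensor_dot s s)).

(* The supremum of the operator norms of (rho1 (x) rho2)(x); each of them is
   computed on the algebraic tensor product of the two Hilbert spaces, a dense
   subspace of their Hilbert space tensor product. *)
Definition min_norm (A B : algType C) (stA : A -> A) (stB : B -> B)
    (x : tensor A B) : R :=
  sup [set r | exists (K1 K2 : hilbert) (rho1 : A -> K1 -> K1)
                 (rho2 : B -> K2 -> K2) (t : tensor K1 K2),
     [/\ star_representation stA rho1, star_representation stB rho2,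
         tensor_hnorm t <= 1
       & r = tensor_hnorm (tlift (fun a b => tmap (rho1 a) (rho2 b) t) x)]].

(* [T] is the C*-algebra [A (x)_min B], with [i] the map of the algebraic tensor
   product into its completion. *)
Definition is_min_tensor (A B : algType C) (stA : A -> A) (stB : B -> B)
    (T : algType C) (stT : T -> T) (NT : T -> R) (i : tensor A B -> T) : Prop :=
  [/\ cstar_algebra stT NT, linear i, monoid_morphism i,
      forall x, i (tmap stA stB x) = stT (i x)
    & dense_isometry (min_norm stA stB) NT i].

Definition generated_star_subalgebra (A : algType C) (st : A -> A) n
    (v : 'M[A]_n) : set A :=
  smallest (star_subalgebra st) (coefficients v).

Definition woronowicz_axioms (A : algType C) (st : A -> A) (N : A -> R) n
    (v : 'M[A]_n) : Prop :=
  let As := generated_star_subalgebra st v in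
  [/\ cstar_algebra st N /\ mxunitary st v,
      forall a e, 0 < e -> exists2 b, As b & N (a - b) < e,
      exists (T : algType C) (stT : T -> T) (NT : T -> R) (i : tensor A A -> T)
          (delta : {lrmorphism A -> T}),
        [/\ is_min_tensor st st stT NT i, forall a, delta (st a) = stT (delta a)
          & map_mx delta v = map_mx (fun a => i (a \ox 1)) v
                               *m map_mx (fun a => i (1 \ox a)) v]
    & exists kappa : A -> A,
        [/\ forall a, As a -> As (kappa a),
            forall (k : C) a b, As a -> As b ->
              kappa (k *: a + b) = k *: kappa a + kappa b,
            forall a b, As a -> As b -> kappa (a * b) = kappa b * kappa a,
            mxinv v (map_mx kappa v)
          & forall a, As a -> kappa (st (kappa (st a))) = a]].

Definition adjmx m (x : 'M[C]_m) : 'M[C]_m := x ^t*.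

Definition positive_operator n (Q : 'M[C]_n) : Prop :=
  Q ^t* = Q /\ forall x : 'cV[C]_n, 0 <= (x ^t* *m Q *m x) 0 0.

Definition tens_id n m (T : 'M[C]_n) : 'M['M[C]_m]_n :=
  map_mx (fun a => a%:M) T.

(* [X = w^-1] is written [mxinv w X], the matrix algebra over ['M[C]_m] having no
   inversion operation when [m] or [n] is 0. *)
Definition twisted_biunitary n m (u : 'M['M[C]_m]_n) : Prop :=
  mxunitary (@adjmx m) u /\
  exists Q : 'M[C]_n, [/\ positive_operator Q, Q \in unitmx
    & exists2 uinv, mxinv u uinv
      & mxinv u^T (tens_id m (invmx (Q^T *m Q^T)) *m uinv^T
                     *m tens_id m (Q^T *m Q^T))].

End Star.

(* Main.v *)
Require Import Defs.
From HB Require Import structures.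
From mathcomp Require Import all_boot all_order all_algebra.
From mathcomp Require Import complex mxtens ring lra sesquilinear spectral.
From mathcomp Require Import boolp classical_sets functions reals.
From mathcomp Require Import interval_inference topology normedtype sequences.

Set Implicit Arguments.
Unset Strict Implicit.
Unset Printing Implicit Defensive.

Import Order.TTheory GRing.Theory Num.Theory.
Local Open Scope ring_scope.

(** The involution is forced: for [v] to be unitary, [S (v i j)] has to be the
adjoint of [v j i], and the [v i j] and [S (v i j)] generate [H].  To construct it, the
adjoint of matrices is transported to [H] along sufficiently many
representations.

Put [P = Q * Q].  Call a finite dimensional representation [rho] of [H]
compatible ([unirep]) if [rho (S (v i j))] is the adjoint of [rho (v j i)] and if
[rho] sends the matrix [S^2 v] to [P^-1 (rho v) P].  As [u] is a biunitary
twisted by [Q], the representation [pi] is compatible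
([twisted_biunitary_twist]).  The counit is compatible too, and so is the
convolution product of two compatible representations, hence the common kernel
[J] of the compatible representations satisfies the bi-ideal conditions.  It is
also stable under [S]: on a finite dimensional subcoalgebra, [rho \o S] is the
convolution inverse of [rho], thus by Cayley-Hamilton a linear combination of
convolution powers of [rho], and these vanish on [J] ([antipode_convpow]).  Now
[pi] factors through the Hopf algebra [H / J], which is therefore a left-faithful
model; as [H] is terminal, the composite of [H -> H / J] with the morphism
[H / J -> H] is the identity, and [J = 0] ([minimal_model_hopf_ideal]).

So compatible representations separate the points of [H].  In particular
[S^2 v = P^-1 v P] holds in [H], the [v i j] and [S (v i j)] generate [H], and
every [a] has a unique adjoint [hopf_star a], characterised by
[rho (hopf_star a) = adjmx (rho a)] for all compatible [rho]: it exists on the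
generators, and the elements for which it exists form a subalgebra.  All the
identities of a Hopf involution can be checked under compatible representations.

For the norm, recall that [x^* x] is positive in a C*-algebra
([star_square_positive]), so that the [x k] have norm at most 1 if the sum of
the [(x k)^* (x k)] is 1 ([column_norm]).  The entries of a column of [v] are
such elements in the completion of [H] for any C*-seminorm, hence the supremum
of all C*-seminorms is finite.  It vanishes at 0 only, because the operator
norms of the compatible representations are C*-seminorms and these
representations separate points ([hopf_norm_biggest]).

Let finally [A] be the completion.  The minimal norm of [A (x) A] is a
C*-seminorm, because representations of C*-algebras are contractive
([star_rep_contraction]), and it is not zero, because the counit extends to a
character of [A] ([min_norm1]).  Pulled back to [H] by the comultiplication it is
one of the seminorms of which the norm of [H] is the supremum, so the
comultiplication extends to [A] by continuity.  The antipode of [A] is the one of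
[H], carried over to the image of [H], which is the star-subalgebra generated by
the coefficients ([completion_woronowicz]). *)


(** * Tensor products *)

Notation bilinear f := (bilinear_for *:%R *:%R f).

Section LinearFunctions.
Variables (K : fieldType) (U V : lmodType K) (f : U -> V).
Hypothesis fl : linear f.

Lemma lin0 : f 0 = 0.
Proof. by have := fl (-1) 0 0; rewrite scaler0 addr0 scaleN1r addNr. Qed.

Lemma linD x y : f (x + y) = f x + f y.
Proof. by have := fl 1 x y; rewrite !scale1r. Qed.

Lemma linZ k x : f (k *: x) = k *: f x.
Proof. by have := fl k x 0; rewrite lin0 !addr0. Qed.

Lemma linB x y : f (x - y) = f x - f y.
Proof. by rewrite linD -scaleN1r linZ scaleN1r. Qed.

Lemma lin_sum (I : Type) (r : seq I) (P : pred I) (F : I -> U) :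
  f (\sum_(i <- r | P i) F i) = \sum_(i <- r | P i) f (F i).
Proof. exact: (big_morph f linD lin0). Qed.

End LinearFunctions.

Section TensorTheory.
Variables (K : fieldType) (U V : lmodType K).
Implicit Types (x y : tensor U V).

Section Bilinear.
Variables (T : lmodType K) (f : U -> V -> T).

Lemma bilinearI :
  (forall k a b v, f (k *: a + b) v = k *: f a v + f b v) ->
  (forall k u a b, f u (k *: a + b) = k *: f u a + f u b) -> bilinear f.
Proof. by move=> h1 h2; split=> [v|u] k a b /=; rewrite ?h1 ?h2. Qed.

Hypothesis fb : bilinear f.

Lemma bilinearl k a b v : f (k *: a + b) v = k *: f a v + f b v.
Proof. exact: fb.1. Qed.

Lemma bilinearr k u a b : f u (k *: a + b) = k *: f u a + f u b.
Proof. exact: fb.2. Qed.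

Lemma bilinearDl a b v : f (a + b) v = f a v + f b v.
Proof. by rewrite -[a]scale1r bilinearl !scale1r. Qed.

Lemma bilinear0l v : f 0 v = 0.
Proof. by apply: (addrI (f 0 v)); rewrite -bilinearDl !addr0. Qed.

Lemma bilinearZl k a v : f (k *: a) v = k *: f a v.
Proof. by rewrite -[k *: a]addr0 bilinearl bilinear0l addr0. Qed.

Lemma bilinearDr u a b : f u (a + b) = f u a + f u b.
Proof. by rewrite -[a]scale1r bilinearr !scale1r. Qed.

Lemma bilinear0r u : f u 0 = 0.
Proof. by apply: (addrI (f u 0)); rewrite -bilinearDr !addr0. Qed.

Lemma bilinearZr k u a : f u (k *: a) = k *: f u a.
Proof. by rewrite -[k *: a]addr0 bilinearr bilinear0r addr0. Qed.

Lemma bilinearBl a b v : f (a - b) v = f a v - f b v.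
Proof. by rewrite -scaleN1r bilinearDl bilinearZl scaleN1r. Qed.

Lemma bilinearBr u a b : f u (a - b) = f u a - f u b.
Proof. by rewrite -scaleN1r bilinearDr bilinearZr scaleN1r. Qed.

Lemma tlift_tens u v : tlift f (u \ox v) = f u v.
Proof. by rewrite [LHS](tlift_pi _ fb) /formal_sum big_seq1. Qed.

Lemma tlift0 : tlift f 0 = 0.
Proof. exact: tlift_zero. Qed.

Lemma tliftD x y : tlift f (x + y) = tlift f x + tlift f y.
Proof. exact: tlift_add. Qed.

Lemma tliftZ k x : tlift f (k *: x) = k *: tlift f x.
Proof. exact: tlift_scale. Qed.

Lemma tlift_is_linear : linear (tlift f : tensor U V -> T).
Proof. by move=> k x y; rewrite tliftD tliftZ. Qed.

Lemma tlift_sum (I : Type) (r : seq I) (P : pred I) (F : I -> tensor U V) :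
  tlift f (\sum_(i <- r | P i) F i) = \sum_(i <- r | P i) tlift f (F i).
Proof. exact: (big_morph _ tliftD tlift0). Qed.

End Bilinear.

Lemma tens_bilinear : bilinear (@tens K U V).
Proof.
by apply: bilinearI => k *; apply: tensor_ext => T f fb;
  rewrite tliftD // tliftZ // !tlift_tens // ?bilinearl ?bilinearr.
Qed.

Lemma tpi_sum s : tpi s = \sum_(p <- s) p.1 \ox p.2 :> tensor U V.
Proof.
apply: tensor_ext => T f fb; rewrite tlift_pi // tlift_sum //.
by apply: eq_bigr => p _; rewrite tlift_tens.
Qed.

Lemma tensor_sum x : x = \sum_(p <- repr x) p.1 \ox p.2.
Proof. by rewrite -tpi_sum /tpi reprK. Qed.

(** Every tensor is a finite sum of pure tensors, so properties stable under
sums need only be checked on those. *)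
Lemma tensor_ind (P : tensor U V -> Prop) :
  P 0 -> (forall u v, P (u \ox v)) ->
  (forall x y, P x -> P y -> P (x + y)) -> forall x, P x.
Proof.
move=> P0 Pt PD x; rewrite [x]tensor_sum; elim: (repr x) => [|p s IH].
  by rewrite big_nil.
by rewrite big_cons; apply: PD.
Qed.

Lemma tensor_linear_ext (T : lmodType K) (f g : tensor U V -> T) :
  linear f -> linear g -> (forall u v, f (u \ox v) = g (u \ox v)) -> f =1 g.
Proof.
move=> fl gl fg; apply: tensor_ind => [|//|x y hx hy].
  by rewrite (lin0 fl) (lin0 gl).
by rewrite (linD fl) (linD gl) hx hy.
Qed.

(** The functionals [phi] on [U] and [psi] on [V] separate the points of the
quotients by their common kernels, through which [f] factors, and the products
[phi (x) psi] separate the tensors of these quotients.  The proof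
shortens a formal sum: if [phi x0 <> 0], its first term can be absorbed in the
others up to a term [x0 (x) y'] with [y'] killed by all the [psi]. *)
Lemma tensor_separation (Phi : (U -> K) -> Prop) (Psi : (V -> K) -> Prop)
    (T : lmodType K) (f : U -> V -> T) (t : tensor U V) :
  (forall phi, Phi phi -> linear (phi : U -> K^o)) ->
  (forall psi, Psi psi -> linear (psi : V -> K^o)) ->
  bilinear f ->
  (forall u v, (forall phi, Phi phi -> phi u = 0) -> f u v = 0) ->
  (forall u v, (forall psi, Psi psi -> psi v = 0) -> f u v = 0) ->
  (forall phi psi, Phi phi -> Psi psi ->
     tlift (fun u v => (phi u * psi v : K^o)) t = 0) ->
  tlift f t = 0.
Proof.
move=> Phil Psil fb fl fr.
have prodb phi psi : Phi phi -> Psi psi ->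
    bilinear (fun u v => (phi u * psi v : K^o)).
  move=> hphi hpsi; apply: bilinearI => k *.
    by rewrite Phil // mulrDl -mulrA.
  by rewrite Psil // mulrDr /GRing.scale /= mulrCA.
rewrite [t]tensor_sum; move: (repr t) => s {t}.
elim: {s}(size s) {-2}s (leqnn (size s)) => [|n IH] [|[x0 y0] s] //= hs ht;
  do 1?by rewrite big_nil tlift0.
have [h0|/existsNP[phi0 /not_implyP[hphi0 /eqP nz]]] :=
    pselect (forall phi, Phi phi -> phi x0 = 0).
  rewrite big_cons tliftD // tlift_tens // fl //= add0r; apply: IH => //.
  move=> phi psi hphi hpsi; have := ht _ _ hphi hpsi.
  by rewrite big_cons tliftD ?tlift_tens; try exact: prodb; rewrite /= h0 // mul0r add0r.
pose c u := phi0 u / phi0 x0.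
pose y' := y0 + \sum_(p <- s) c p.1 *: p.2.
pose s' := [seq (p.1 - c p.1 *: x0, p.2) | p <- s].
have decomp : \sum_(p <- (x0, y0) :: s) p.1 \ox p.2
    = x0 \ox y' + \sum_(p <- s') p.1 \ox p.2.
  rewrite big_cons /= /y' (bilinearDr tens_bilinear) -addrA; congr (_ + _).
  have -> : x0 \ox (\sum_(p <- s) c p.1 *: p.2)
      = \sum_(p <- s) c p.1 *: (x0 \ox p.2).
    rewrite (big_morph (tens x0) (bilinearDr tens_bilinear x0)
               (bilinear0r tens_bilinear x0)).
    by apply: eq_bigr => p _; rewrite (bilinearZr tens_bilinear).
  rewrite big_map -big_split; apply: eq_bigr => p _ /=.
  rewrite -scaleNr addrC (bilinearDl tens_bilinear) (bilinearZl tens_bilinear).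
  by rewrite scaleNr subrK.
have hy' psi : Psi psi -> psi y' = 0.
  move=> hpsi; have psil := Psil _ hpsi.
  have := ht _ _ hphi0 hpsi.
  rewrite big_cons tliftD ?tlift_tens ?tlift_sum; try exact: prodb.
  move=> /= h.
  rewrite /y' (linD psil) (lin_sum psil); apply: (mulfI nz).
  rewrite mulr0 -[RHS]h mulrDr big_distrr /=; congr (_ + _).
  apply: eq_bigr => p _; rewrite tlift_tens; last exact: prodb.
  by rewrite (linZ psil) /GRing.scale /= /c mulrA mulrCA divff // mulr1.
rewrite decomp tliftD // tlift_tens // fr // add0r; apply: IH.
  by rewrite size_map.
move=> phi psi hphi hpsi; have := ht _ _ hphi hpsi.
rewrite decomp tliftD ?tlift_tens; try exact: prodb.
by rewrite hy' // mulr0 add0r.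
Qed.

End TensorTheory.

Section TensorMapTheory.
Variable K : fieldType.

Lemma tmap_bilinear (U V U' V' : lmodType K) (f : U -> U') (g : V -> V') :
  linear f -> linear g -> bilinear (fun u v => f u \ox g v).
Proof.
move=> fl gl; apply: bilinearI => k *.
  by rewrite fl (bilinearl (@tens_bilinear _ _ _)).
by rewrite gl (bilinearr (@tens_bilinear _ _ _)).
Qed.

Lemma tmap_tens (U V U' V' : lmodType K) (f : U -> U') (g : V -> V') u v :
  linear f -> linear g -> tmap f g (u \ox v) = f u \ox g v.
Proof. by move=> fl gl; rewrite /tmap tlift_tens //; apply: tmap_bilinear. Qed.

Lemma tmap_is_linear (U V U' V' : lmodType K) (f : U -> U') (g : V -> V') :
  linear f -> linear g -> linear (tmap f g).
Proof. by move=> fl gl; apply: tlift_is_linear; apply: tmap_bilinear. Qed.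

Lemma tlift_tmap (U V U' V' : lmodType K) (T : lmodType K) (f : U -> U')
    (g : V -> V') (h : U' -> V' -> T) x :
  linear f -> linear g -> bilinear h ->
  tlift h (tmap f g x) = tlift (fun u v => h (f u) (g v)) x.
Proof.
move=> fl gl hb; have hb' : bilinear (fun u v => h (f u) (g v)).
  by apply: bilinearI => k *; rewrite ?fl ?gl ?bilinearl ?bilinearr.
apply: (tensor_linear_ext (f := fun x => tlift h (tmap f g x)) (g := tlift _)).
- by move=> k a b; rewrite tmap_is_linear // tlift_is_linear.
- exact: tlift_is_linear.
by move=> u v; rewrite tmap_tens // !tlift_tens.
Qed.

Lemma tassoc_bilinear (U V W : lmodType K) : bilinear
  (fun (x : tensor U V) (w : W) => tlift (fun u v => u \ox (v \ox w)) x).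
Proof.
pose tb U' V' := @tens_bilinear K U' V'.
have b1 w : bilinear (fun (u : U) (v : V) => u \ox (v \ox w)).
  by apply: bilinearI => k *; rewrite !(bilinearl (tb _ _), bilinearr (tb _ _)).
apply: bilinearI => [k x y w|k x w w']; first by rewrite tlift_is_linear.
rewrite /tlift /formal_sum scaler_sumr -big_split /=; apply: eq_bigr => p _.
by rewrite !(bilinearr (tb _ _)).
Qed.

Lemma tassoc_tens (U V W : lmodType K) (u : U) (v : V) (w : W) :
  tassoc ((u \ox v) \ox w) = u \ox (v \ox w).
Proof.
rewrite /tassoc tlift_tens; last exact: tassoc_bilinear.
rewrite tlift_tens //.
by apply: bilinearI => k *; rewrite !(bilinearl (@tens_bilinear _ _ _),
  bilinearr (@tens_bilinear _ _ _)).
Qed.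

Lemma tassoc_is_linear (U V W : lmodType K) : linear (@tassoc K U V W).
Proof. by apply: tlift_is_linear; apply: tassoc_bilinear. Qed.

Lemma tensor_mul_tens (A B : algType K) (a a' : A) (b b' : B) :
  (a \ox b) * (a' \ox b') = (a * a') \ox (b * b').
Proof.
rewrite [LHS]/(tensor_mul _ _) /tensor_mul tpi_sum big_allpairs_dep /=.
pose g (x : tensor A B) u v := tlift (fun c d => (u * c) \ox (v * d)) x.
have gb1 u v : bilinear (fun (c : A) (d : B) => (u * c) \ox (v * d)).
  by apply: tmap_bilinear => k x y; rewrite mulrDr scalerAr.
have gb2 (x : tensor A B) : bilinear (g x).
  apply: bilinearI => k x1 x2 x3; rewrite /g /tlift /formal_sum;
  rewrite scaler_sumr -big_split /=; apply: eq_bigr => p _; rewrite mulrDl -scalerAl;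
  by rewrite ?(bilinearl (@tens_bilinear _ _ _)) ?(bilinearr (@tens_bilinear _ _ _)).
rewrite -(tlift_tens (gb1 a b) a' b') -[RHS]/(g (a' \ox b') a b).
by rewrite -(tlift_tens (gb2 _) a b).
Qed.

Lemma tmapM (A B A' B' : algType K) (f : A -> A') (g : B -> B')
    (x y : tensor A B) :
  linear f -> linear g -> {morph f : a b / a * b} -> {morph g : a b / a * b} ->
  tmap f g (x * y) = tmap f g x * tmap f g y.
Proof.
move=> fl gl fM gM.
have t0 : tmap f g 0 = 0 by rewrite /tmap tlift0 //; apply: tmap_bilinear.
have tD a b : tmap f g (a + b) = tmap f g a + tmap f g b.
  by rewrite /tmap tliftD //; apply: tmap_bilinear.
move: x; apply: tensor_ind => [|a b|x x' hx hx'].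
- by rewrite mul0r t0 mul0r.
- move: y; apply: tensor_ind => [|c d|y y' hy hy'].
  + by rewrite mulr0 t0 mulr0.
  + by rewrite tensor_mul_tens !tmap_tens // tensor_mul_tens fM gM.
  + by rewrite mulrDr !tD hy hy' mulrDr.
by rewrite mulrDl !tD hx hx' mulrDl.
Qed.

Lemma tens_one (A B : algType K) : (1 : A) \ox (1 : B) = 1.
Proof. by []. Qed.

Lemma tlift_comp (U V T T' : lmodType K) (f : U -> V -> T)
    (g : T -> T') (t : tensor U V) :
  bilinear f -> linear g -> g (tlift f t) = tlift (fun u v => g (f u v)) t.
Proof.
move=> fb gl; have gb : bilinear (fun u v => g (f u v)).
  by apply: bilinearI => k *; rewrite ?(bilinearl fb) ?(bilinearr fb) gl.
apply: (tensor_linear_ext (f := fun t => g (tlift f t)) (g := tlift _)).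
- by move=> k x y; rewrite tlift_is_linear // gl.
- exact: tlift_is_linear.
by move=> u w; rewrite !tlift_tens.
Qed.

End TensorMapTheory.

(** * Subquotient algebras *)

(** A quotient [D / I] of a subalgebra by an ideal, inside a module with a
bilinear multiplication that need not be a ring structure: this covers both
the quotient of an algebra by an ideal and the completion of a normed algebra,
where [D] consists of the Cauchy sequences and [I] of the null sequences. *)
Record subquotient (K : fieldType) (L : lmodType K) := Subquotient {
  sq_mul : L -> L -> L;
  sq_one : L;
  sq_dom : L -> Prop;
  sq_ker : L -> Prop;
  sq_mul_bilinear : bilinear sq_mul;
  sq_mulA : associative sq_mul;
  sq_mul1l : left_id sq_one sq_mul;
  sq_mul1r : right_id sq_one sq_mul;
  sq_dom1 : sq_dom sq_one;
  sq_dom_linear : forall k x y, sq_dom x -> sq_dom y -> sq_dom (k *: x + y);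
  sq_domM : forall x y, sq_dom x -> sq_dom y -> sq_dom (sq_mul x y);
  sq_ker0 : sq_ker 0;
  sq_ker_linear : forall k x y, sq_ker x -> sq_ker y -> sq_ker (k *: x + y);
  sq_kerMl : forall x y, sq_dom x -> sq_ker y -> sq_ker (sq_mul x y);
  sq_kerMr : forall x y, sq_ker x -> sq_dom y -> sq_ker (sq_mul x y);
  sq_ker1 : ~ sq_ker sq_one
}.

Section SubquotientAlgebra.
Variables (K : fieldType) (L : lmodType K) (S : subquotient L).
Local Notation D := (sq_dom S).
Local Notation I := (sq_ker S).
Local Notation mul := (sq_mul S).
Local Notation one := (sq_one S).

Let domZ k x : D x -> D (k *: x).
Proof.
move=> Dx; have := sq_dom_linear (k - 1) Dx Dx.
by rewrite -{2}[x]scale1r -scalerDl subrK.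
Qed.

Let domD x y : D x -> D y -> D (x + y).
Proof. by move=> Dx Dy; have := sq_dom_linear 1 Dx Dy; rewrite scale1r. Qed.

Let dom0 : D 0.
Proof. by have := domZ 0 (sq_dom1 S); rewrite scale0r. Qed.

Let kerZ k x : I x -> I (k *: x).
Proof. by move=> /sq_ker_linear h; have := h k _ (sq_ker0 S); rewrite addr0. Qed.

Let kerD x y : I x -> I y -> I (x + y).
Proof. by move=> Ix Iy; have := sq_ker_linear 1 Ix Iy; rewrite scale1r. Qed.

Let kerN x : I x -> I (- x).
Proof. by rewrite -scaleN1r; apply: kerZ. Qed.

(** A chosen representative of the class of [x], through which the
quotient is a subtype of [L]. *)
Definition sq_canon (x : L) : L := xget 0 [set y | D y /\ I (x - y)].

Let canonP x : D x -> D (sq_canon x) /\ I (x - sq_canon x).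
Proof.
move=> Dx; rewrite /sq_canon; case: xgetP => [y -> [Dy Iy] //|/(_ x)] [].
by split=> //; rewrite subrr; apply: sq_ker0.
Qed.

Let canon_eq x y : I (x - y) -> sq_canon x = sq_canon y.
Proof.
move=> Ixy; rewrite /sq_canon; congr xget; apply/seteqP.
split=> z [Dz Iz]; split=> //.
  by rewrite -(subrKA x); apply: kerD => //; rewrite -opprB; apply: kerN.
by rewrite -(subrKA y); apply: kerD.
Qed.

Definition subquot := {x : L | `[< D x /\ sq_canon x = x >]}.
HB.instance Definition _ := Choice.on subquot.

Lemma sq_canon_dom x : D x -> `[< D (sq_canon x) /\ sq_canon (sq_canon x) = sq_canon x >].
Proof.
move=> Dx; apply/asboolP; have [Dc Ic] := canonP Dx; split=> //.
by apply/esym/canon_eq.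
Qed.

Definition sq_pi (x : L) : subquot :=
  insubd (exist _ (sq_canon 0) (sq_canon_dom dom0)) (sq_canon x).
Definition sq_repr (a : subquot) : L := val a.

Lemma sq_repr_dom a : D (sq_repr a).
Proof. by have /asboolP[] := valP a. Qed.

Lemma sq_reprK : cancel sq_repr sq_pi.
Proof.
move=> a; apply: val_inj; have /asboolP[Da ca] := valP a.
by rewrite insubdK /sq_repr ?ca // -topredE /=; exact: valP a.
Qed.

Lemma sq_pi_surj a : exists2 x, D x & a = sq_pi x.
Proof. by exists (sq_repr a); rewrite ?sq_reprK //; apply: sq_repr_dom. Qed.

Let val_pi x : D x -> val (sq_pi x) = sq_canon x.
Proof. by move=> Dx; rewrite insubdK // -topredE /= sq_canon_dom. Qed.

Lemma sq_pi_eq x y : D x -> D y -> sq_pi x = sq_pi y <-> I (x - y).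
Proof.
move=> Dx Dy; split=> [/(congr1 val)|Ixy].
  rewrite !val_pi // => e; have [_ Ix] := canonP Dx; have [_ Iy] := canonP Dy.
  rewrite -(subrKA (sq_canon x)); apply: kerD => //.
  by rewrite e -opprB; apply: kerN.
by rewrite /sq_pi (canon_eq Ixy).
Qed.

Lemma sq_repr_pi x : D x -> I (x - sq_repr (sq_pi x)).
Proof. by move=> Dx; apply/sq_pi_eq; rewrite ?sq_reprK //; apply: sq_repr_dom. Qed.

Definition sq_zero := sq_pi 0.
Definition sq_add a b := sq_pi (sq_repr a + sq_repr b).
Definition sq_opp a := sq_pi (- sq_repr a).
Definition sq_scale k a := sq_pi (k *: sq_repr a).
Definition sq_times a b := sq_pi (mul (sq_repr a) (sq_repr b)).
Definition sq_unit := sq_pi one.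

Let addE x y : D x -> D y -> sq_add (sq_pi x) (sq_pi y) = sq_pi (x + y).
Proof.
move=> Dx Dy; apply/esym/sq_pi_eq; do 1?by apply: domD => //; apply: sq_repr_dom.
by rewrite opprD addrACA; apply: kerD; apply: sq_repr_pi.
Qed.

Let scaleE k x : D x -> sq_scale k (sq_pi x) = sq_pi (k *: x).
Proof.
move=> Dx; apply/esym/sq_pi_eq; do 1?by apply: domZ => //; apply: sq_repr_dom.
by rewrite -scalerBr; apply: kerZ; apply: sq_repr_pi.
Qed.

Let oppE x : D x -> sq_opp (sq_pi x) = sq_pi (- x).
Proof. by move=> Dx; rewrite -scaleN1r -scaleE // /sq_scale scaleN1r. Qed.

Let mulE x y : D x -> D y -> sq_times (sq_pi x) (sq_pi y) = sq_pi (mul x y).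
Proof.
move=> Dx Dy; apply/esym/sq_pi_eq; do 1?by apply: sq_domM => //; apply: sq_repr_dom.
set x' := sq_repr _; set y' := sq_repr _; have mb := sq_mul_bilinear S.
have -> : mul x y - mul x' y' = mul (x - x') y + mul x' (y - y').
  by rewrite (bilinearBl mb) (bilinearBr mb) addrA subrK.
by apply: kerD; [apply: sq_kerMr|apply: sq_kerMl] => //;
  (apply: sq_repr_pi || apply: sq_repr_dom).
Qed.

Local Ltac elt a := have [{}a ? ->] := sq_pi_surj a.
Local Ltac dm := auto 10 using domD, domZ, sq_domM, sq_dom1, dom0.

Let addA : associative sq_add.
Proof. by move=> a b c; elt a; elt b; elt c; rewrite !addE ?addrA; dm. Qed.
Let addC : commutative sq_add.
Proof. by move=> a b; elt a; elt b; rewrite !addE // addrC. Qed.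
Let add0 : left_id sq_zero sq_add.
Proof. by move=> a; elt a; rewrite addE ?add0r; dm. Qed.
Let addN : left_inverse sq_zero sq_opp sq_add.
Proof.
by move=> a; elt a; rewrite oppE // addE ?addNr -?scaleN1r; dm.
Qed.
HB.instance Definition _ := GRing.isZmodule.Build subquot addA addC add0 addN.

Lemma sq_piD x y : D x -> D y -> sq_pi (x + y) = sq_pi x + sq_pi y.
Proof. by move=> Dx Dy; rewrite [RHS]addE. Qed.

Let scA a b x : sq_scale a (sq_scale b x) = sq_scale (a * b) x.
Proof. by elt x; rewrite !scaleE ?scalerA; dm. Qed.
Let sc1 : left_id 1 sq_scale.
Proof. by move=> x; elt x; rewrite scaleE ?scale1r. Qed.
Let scDr : right_distributive sq_scale +%R.
Proof. by move=> a x y; elt x; elt y; rewrite -sq_piD ?scaleE -?sq_piD ?scalerDr; dm. Qed.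
Let scDl x : {morph sq_scale^~ x : a b / a + b}.
Proof. by move=> a b; elt x; rewrite !scaleE -?sq_piD ?scalerDl; dm. Qed.
HB.instance Definition _ :=
  GRing.Zmodule_isLmodule.Build K subquot scA sc1 scDr scDl.

Lemma sq_piZ k x : D x -> sq_pi (k *: x) = k *: sq_pi x.
Proof. by move=> Dx; rewrite [RHS]scaleE. Qed.
Lemma sq_pi0 : sq_pi 0 = 0.
Proof. by []. Qed.
Lemma sq_pi_eq0 x : D x -> sq_pi x = 0 <-> I x.
Proof. by move=> Dx; rewrite -sq_pi0 sq_pi_eq // subr0. Qed.

Let mb := sq_mul_bilinear S.
Let mulA : associative sq_times.
Proof. by move=> a b c; elt a; elt b; elt c; rewrite !mulE ?sq_mulA; dm. Qed.
Let mul1l : left_id sq_unit sq_times.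
Proof. by move=> a; elt a; rewrite mulE ?sq_mul1l; dm. Qed.
Let mul1r : right_id sq_unit sq_times.
Proof. by move=> a; elt a; rewrite mulE ?sq_mul1r; dm. Qed.
Let mulDl : left_distributive sq_times +%R.
Proof.
move=> a b c; elt a; elt b; elt c.
by rewrite -sq_piD ?mulE -?sq_piD ?(bilinearDl mb); dm.
Qed.
Let mulDr : right_distributive sq_times +%R.
Proof.
move=> a b c; elt a; elt b; elt c.
by rewrite -sq_piD ?mulE -?sq_piD ?(bilinearDr mb); dm.
Qed.
Let one_neq0 : sq_unit != 0.
Proof. by apply/eqP => /(sq_pi_eq0 (sq_dom1 S)); apply: sq_ker1. Qed.
HB.instance Definition _ := GRing.Zmodule_isNzRing.Build subquot
  mulA mul1l mul1r mulDl mulDr one_neq0.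

Lemma sq_piM x y : D x -> D y -> sq_pi (mul x y) = sq_pi x * sq_pi y.
Proof. by move=> Dx Dy; rewrite [RHS]mulE. Qed.
Let scAl k (a b : subquot) : k *: (a * b) = k *: a * b.
Proof. by elt a; elt b; rewrite -?(sq_piM, sq_piZ) ?(bilinearZl mb); dm. Qed.
HB.instance Definition _ := GRing.Lmodule_isLalgebra.Build K subquot scAl.
Let scAr k (a b : subquot) : k *: (a * b) = a * (k *: b).
Proof. by elt a; elt b; rewrite -?(sq_piM, sq_piZ) ?(bilinearZr mb); dm. Qed.
HB.instance Definition _ := GRing.Lalgebra_isAlgebra.Build K subquot scAr.

End SubquotientAlgebra.
Global Opaque sq_pi sq_repr sq_add sq_scale sq_times sq_opp sq_zero sq_unit.

(** * Comatrices and the antipode *)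

Section Inverses.
Variables (A : pzRingType) (I : finType).
Implicit Types x y z : I -> I -> A.

Definition inverse_family x y := forall i j, \sum_k x i k * y k j = (i == j)%:R.

Lemma inverse_family_uniq x y z :
  inverse_family x y -> inverse_family y z -> x =2 z.
Proof.
move=> xy yz i j.
have e : \sum_k \sum_l x i k * y k l * z l j = \sum_k x i k * (k == j)%:R.
  apply: eq_bigr => k _; rewrite -yz big_distrr /=.
  by apply: eq_bigr => l _; rewrite mulrA.
have sumr (f : I -> A) : \sum_k f k * (k == j)%:R = f j.
  rewrite (bigD1 j) //= eqxx mulr1 big1 ?addr0 // => k /negPf ->.
  by rewrite mulr0.
have suml (f : I -> A) : \sum_k (i == k)%:R * f k = f i.
  rewrite (bigD1 i) //= eqxx mul1r big1 ?addr0 // => k.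
  by rewrite eq_sym => /negPf ->; rewrite mul0r.
rewrite -(sumr (x i)) -e exchange_big -(suml (z ^~ j)) /=.
by apply: eq_bigr => l _; rewrite -xy big_distrl.
Qed.

End Inverses.

Section Comatrix.
Variables (K : fieldType) (H : hopfAlgType K).
Local Notation S := (@antipode K H).
Local Notation Delta := (@comul K H).
Local Notation eps := (@counit K H).
Implicit Types a b : H.

Local Notation tb := (@tens_bilinear K H H).

(** The matrix coefficients of a corepresentation, over an arbitrary finite index
type: tensor products are indexed by products, and duals by the same type. *)
Definition comatrix (I : finType) (w : I -> I -> H) :=
  (forall i j, Delta (w i j) = \sum_k w i k \ox w k j) /\
  (forall i j, eps (w i j) = (i == j)%:R).

Lemma antipode_mul_bilinear : bilinear (fun a b : H => S a * b).
Proof.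
apply: bilinearI => k *; first by rewrite linearP mulrDl scalerAl.
by rewrite mulrDr scalerAr.
Qed.

Lemma mul_antipode_bilinear : bilinear (fun a b : H => a * S b).
Proof.
apply: bilinearI => k *; first by rewrite mulrDl scalerAl.
by rewrite linearP mulrDr scalerAr.
Qed.

Lemma antipode_comatrixl (I : finType) (w : I -> I -> H) :
  comatrix w -> inverse_family (fun i j => S (w i j)) w.
Proof.
have mulS := antipode_mul_bilinear.
move=> [hD he] i j; have := antipodel (w i j); rewrite hD he tlift_sum //.
rewrite scaler_nat => <-; apply: eq_bigr => k _; by rewrite tlift_tens.
Qed.

Lemma antipode_comatrixr (I : finType) (w : I -> I -> H) :
  comatrix w -> inverse_family w (fun i j => S (w i j)).
Proof.
have mulS := mul_antipode_bilinear.
move=> [hD he] i j; have := antipoder (w i j); rewrite hD he tlift_sum //.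
rewrite scaler_nat => <-; apply: eq_bigr => k _; by rewrite tlift_tens.
Qed.

Lemma comatrix_unit : comatrix (fun _ _ : unit => 1 : H).
Proof.
split=> i j; rewrite rmorph1; last by case: i j => [] [].
by rewrite (bigD1 tt) //= big1 ?addr0 // => -[].
Qed.

Lemma antipode1 : S 1 = 1.
Proof.
have := antipode_comatrixl comatrix_unit tt tt.
by rewrite (bigD1 tt) //= big1 ?addr0 ?mulr1 // => -[].
Qed.

Lemma comatrix_mul (I J : finType) (w : I -> I -> H) (z : J -> J -> H) :
  comatrix w -> comatrix z ->
  comatrix (fun p q : I * J => w p.1 q.1 * z p.2 q.2).
Proof.
move=> [wD we] [zD ze]; split=> [] [i i'] [j j'] /=.
  rewrite rmorphM /= wD zD big_distrl -(pair_bigA _ (fun k l =>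
    (w i k * z i' l) \ox (w k j * z l j'))) /=.
  apply: eq_bigr => k _; rewrite big_distrr /=.
  by apply: eq_bigr => l _; rewrite tensor_mul_tens.
by rewrite rmorphM /= we ze -natrM mulnb.
Qed.

(** Both sides are the inverse of the tensor product of the two comatrices. *)
Lemma antipode_comatrixM (I J : finType) (w : I -> I -> H) (z : J -> J -> H) i j i' j' :
  comatrix w -> comatrix z ->
  S (w i j * z i' j') = S (z i' j') * S (w i j).
Proof.
move=> cw cz; have cwz := comatrix_mul cw cz.
have hr : inverse_family (fun p q : I * J => w p.1 q.1 * z p.2 q.2)
    (fun p q => S (z p.2 q.2) * S (w p.1 q.1)).
  move=> [k k'] [l l'] /=.
  rewrite -(pair_bigA _ (fun m m' =>
    w k m * z k' m' * (S (z m' l') * S (w m l)))) /=.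
  transitivity (\sum_m w k m * (k' == l')%:R * S (w m l)).
    apply: eq_bigr => m _; rewrite -(antipode_comatrixr cz) big_distrr big_distrl /=.
    by apply: eq_bigr => m' _; rewrite !mulrA.
  rewrite xpair_eqE -mulnb natrM -(antipode_comatrixr cw) big_distrl /=.
  by apply: eq_bigr => m _; rewrite -!mulrA; congr (_ * _); apply/esym/commr_nat.
exact: (inverse_family_uniq (antipode_comatrixl cwz) hr (i, i') (j, j')).
Qed.

(** The transpose of [S w] is again a comatrix: both sides of the formula for
[Delta (S w_ij)] are inverse to [Delta w = w_12 w_13]. *)
Lemma comatrix_antipode (I : finType) (w : I -> I -> H) :
  comatrix w -> comatrix (fun i j => S (w j i)).
Proof.
move=> cw; have [wD we] := cw.
have hr : inverse_family (fun i j => Delta (w i j))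
    (fun i j => \sum_k S (w k j) \ox S (w i k)).
  move=> i j /=.
  transitivity (\sum_k (w i k * S (w k j)) \ox (1 : H)).
    transitivity (\sum_l \sum_k \sum_m (w i k * S (w m j)) \ox (w k l * S (w l m))).
      apply: eq_bigr => l _; rewrite wD big_distrl; apply: eq_bigr => k _ /=.
      by rewrite big_distrr; apply: eq_bigr => m _ /=; rewrite tensor_mul_tens.
    rewrite exchange_big; apply: eq_bigr => k _ /=.
    rewrite exchange_big /= (bigD1 k) //= [X in _ + X]big1 ?addr0; last first.
      move=> m /negPf nmk.
      rewrite -(big_morph _ (bilinearDr tb _) (bilinear0r tb _)).
      by rewrite (antipode_comatrixr cw) eq_sym nmk (bilinear0r tb).
    rewrite -(big_morph _ (bilinearDr tb _) (bilinear0r tb _)).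
    by rewrite (antipode_comatrixr cw) eqxx.
  rewrite -(big_morph (fun a => a \ox (1 : H)) (fun a b => bilinearDl tb a b 1)
    (bilinear0l tb 1)) (antipode_comatrixr cw).
  by case: (i == j); rewrite ?(bilinear0l tb).
have hl : inverse_family (fun i j => Delta (S (w i j))) (fun i j => Delta (w i j)).
  move=> i j; rewrite -(rmorph_nat Delta) -(antipode_comatrixl cw) rmorph_sum.
  by apply: eq_bigr => k _; rewrite rmorphM.
split=> i j; first by rewrite (inverse_family_uniq hl hr).
have := congr1 eps (antipode_comatrixl cw j i).
rewrite rmorph_nat rmorph_sum eq_sym => <-.
rewrite (bigD1 i) //= big1 ?addr0 => [|k /negPf nki]; rewrite rmorphM /= we.
  by rewrite eqxx mulr1.
by rewrite nki mulr0.
Qed.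

Lemma corepresentation_comatrix n (v : 'M[H]_n) :
  corepresentation v -> comatrix (fun i j => v i j).
Proof.
move=> [hD he]; split=> i j.
  have := congr1 (fun A : 'M_n => A i j) hD; rewrite !mxE => ->.
  by apply: eq_bigr => k _; rewrite !mxE tensor_mul_tens mulr1 mul1r.
by have := congr1 (fun A : 'M_n => A i j) he; rewrite !mxE.
Qed.
(** In a left-faithful model all elements have this form
([left_faithful_coefficient]).  It gives access to the antipode, which the
axioms determine through comatrices. *)
Definition is_coefficient a := exists (I : finType) (w : I -> I -> H)
  (f : I -> I -> K), comatrix w /\ a = \sum_i \sum_j f i j *: w i j.

Lemma comatrix_coefficient (I : finType) (w : I -> I -> H) i j :
  comatrix w -> is_coefficient (w i j).
Proof.
move=> cw; exists I, w, (fun k l => (i == k)%:R * (j == l)%:R); split=> //.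
rewrite (bigD1 i) //= (bigD1 j) //= !eqxx mul1r scale1r !big1 ?addr0 //.
  move=> k /negPf nk; rewrite big1 // => l _.
  by rewrite eq_sym nk mul0r scale0r.
by move=> k /negPf nk; rewrite eq_sym nk mulr0 scale0r.
Qed.

Lemma is_coefficient_subalgebra : subalgebra is_coefficient.
Proof.
split=> [|a b [I [w [f [cw ->]]]] [J [z [g [cz ->]]]]|
          a b [I [w [f [cw ->]]]] [J [z [g [cz ->]]]]|k a [I [w [f [cw ->]]]]].
- exact: (comatrix_coefficient tt tt comatrix_unit).
- pose wz (p q : I + J) := match p, q with
    | inl i, inl j => w i j | inr i, inr j => z i j | _, _ => 0 end.
  pose fg (p q : I + J) := match p, q with
    | inl i, inl j => f i j | inr i, inr j => g i j | _, _ => 0 end.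
  exists (I + J)%type, wz, fg; split; last first.
    rewrite big_sumType /=; congr (_ + _); apply: eq_bigr => i _;
      rewrite big_sumType /=.
      by rewrite [X in _ + X]big1 ?addr0 // => j _; rewrite scale0r.
    by rewrite [X in X + _]big1 ?add0r // => j _; rewrite scale0r.
  have [[wD we] [zD ze]] := (cw, cz).
  split=> -[i|i] [j|j]; rewrite ?wD ?zD ?we ?ze ?linear0 // big_sumType /=.
  - by rewrite [X in _ + X]big1 ?addr0 // => k _; rewrite (bilinear0l tb).
  - by rewrite !big1 ?addr0 // => k _; rewrite ?(bilinear0l tb) ?(bilinear0r tb).
  - by rewrite !big1 ?addr0 // => k _; rewrite ?(bilinear0l tb) ?(bilinear0r tb).
  - by rewrite [X in X + _]big1 ?add0r // => k _; rewrite (bilinear0l tb).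
- exists (I * J)%type, (fun p q => w p.1 q.1 * z p.2 q.2),
    (fun p q => f p.1 q.1 * g p.2 q.2); split; first exact: comatrix_mul.
  rewrite -(pair_bigA _ (fun i i' => \sum_q
    (f i q.1 * g i' q.2) *: (w i q.1 * z i' q.2))) /=.
  rewrite big_distrl; apply: eq_bigr => i _ /=.
  rewrite big_distrr; apply: eq_bigr => i' _ /=.
  rewrite -(pair_bigA _ (fun j j' => (f i j * g i' j') *: (w i j * z i' j'))) /=.
  rewrite big_distrl; apply: eq_bigr => j _ /=.
  rewrite big_distrr; apply: eq_bigr => j' _ /=.
  by rewrite -scalerAl -scalerAr scalerA.
- exists I, w, (fun i j => k * f i j); split=> //.
  rewrite scaler_sumr; apply: eq_bigr => i _; rewrite scaler_sumr.
  by apply: eq_bigr => j _; rewrite scalerA.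
Qed.

Lemma iter_antipode_coefficient (I : finType) (w : I -> I -> H) i j k :
  comatrix w -> is_coefficient (iter k S (w i j)).
Proof.
move=> cw; suff [w' cw' [e|e]] : exists2 w' : I -> I -> H, comatrix w' &
    (forall i j, iter k S (w i j) = w' i j) \/
    (forall i j, iter k S (w i j) = w' j i).
- by rewrite e; apply: comatrix_coefficient.
- by rewrite e; apply: comatrix_coefficient.
elim: k => [|k [w' cw' IH]]; first by exists w => //; left.
exists (fun i j => S (w' j i)); first exact: comatrix_antipode.
by case: IH => e; [right|left] => i' j' /=; rewrite e.
Qed.

(** The antipode is antimultiplicative on products of comatrices, by uniqueness
of inverses, hence on all sums of coefficients. *)
Lemma antipode_antimul a b :
  is_coefficient a -> is_coefficient b -> S (a * b) = S b * S a.
Proof.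
move=> [I [w [f [cw ->]]]] [J [z [g [cz ->]]]].
rewrite big_distrl !linear_sum big_distrr /=; apply: eq_bigr => i _.
rewrite big_distrl !linear_sum big_distrr /=; apply: eq_bigr => j _.
rewrite big_distrr linear_sum big_distrl /=; apply: eq_bigr => i' _.
rewrite big_distrr !linear_sum big_distrl /=; apply: eq_bigr => j' _.
rewrite -scalerAl -scalerAr !linearZ /= antipode_comatrixM //.
by rewrite -scalerAr -scalerAl !scalerA mulrC.
Qed.

End Comatrix.

(** * Quotients of Hopf algebras *)

(** The condition on the comultiplication is [Delta I <= I (x) H + H (x) I],
expressed by the bilinear maps that vanish on the right-hand side. *)
Record hopf_ideal (K : fieldType) (H : hopfAlgType K) := HopfIdeal {
  hi_mem :> H -> Prop;
  hi_0 : hi_mem 0;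
  hi_linear : forall k a b, hi_mem a -> hi_mem b -> hi_mem (k *: a + b);
  hi_mulL : forall a b, hi_mem b -> hi_mem (a * b);
  hi_mulR : forall a b, hi_mem a -> hi_mem (a * b);
  hi_counit : forall a, hi_mem a -> counit a = 0;
  hi_antipode : forall a, hi_mem a -> hi_mem (antipode a);
  hi_comul : forall a, hi_mem a ->
    forall (T : lmodType K) (f : H -> H -> T), bilinear f ->
      (forall b c, hi_mem b -> f b c = 0) ->
      (forall b c, hi_mem c -> f b c = 0) -> tlift f (comul a) = 0
}.

Section HopfQuotient.
Variables (K : fieldType) (H : hopfAlgType K) (I : hopf_ideal H).

Let mul_bil : bilinear ( *%R : H -> H -> H).
Proof.
by apply: bilinearI => k *; rewrite ?(mulrDl, mulrDr) -?(scalerAl, scalerAr).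
Qed.

(** The counit of [1] is not zero, so a Hopf ideal is proper. *)
Let one_notin : ~ I 1.
Proof. by move=> /hi_counit/eqP; rewrite rmorph1 oner_eq0. Qed.

Definition hopf_subquotient : subquotient H :=
  @Subquotient K H *%R 1 (fun=> True) I mul_bil (@mulrA H) (@mul1r H)
    (@mulr1 H) Logic.I (fun _ _ _ _ _ => Logic.I) (fun _ _ _ _ => Logic.I)
    (hi_0 I) (@hi_linear _ _ I) (fun x y _ => @hi_mulL _ _ I x y)
    (fun x y Ix _ => @hi_mulR _ _ I x y Ix) one_notin.

Definition hopf_quot := subquot hopf_subquotient.
HB.instance Definition _ := GRing.Algebra.on hopf_quot.

Definition hopf_pi (a : H) : hopf_quot := sq_pi hopf_subquotient a.

Lemma hopf_pi_linear : linear hopf_pi.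
Proof. by move=> k a b; rewrite /hopf_pi sq_piD // sq_piZ. Qed.

Lemma hopf_pi_monoid_morphism : monoid_morphism hopf_pi.
Proof. by split=> // a b; rewrite /hopf_pi -sq_piM. Qed.

HB.instance Definition _ := GRing.isLinear.Build K H hopf_quot *:%R hopf_pi
  hopf_pi_linear.
HB.instance Definition _ := GRing.isMonoidMorphism.Build H hopf_quot hopf_pi
  hopf_pi_monoid_morphism.

Lemma hopf_piZ k a : hopf_pi (k *: a) = k *: hopf_pi a.
Proof. by rewrite /hopf_pi sq_piZ. Qed.
Lemma hopf_piM a b : hopf_pi (a * b) = hopf_pi a * hopf_pi b.
Proof. by rewrite /hopf_pi -sq_piM. Qed.
Lemma hopf_pi1 : hopf_pi 1 = 1.
Proof. by []. Qed.

Lemma hopf_pi_surj (x : hopf_quot) : exists a, x = hopf_pi a.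
Proof. by have [a _ ->] := sq_pi_surj x; exists a. Qed.

Lemma hopf_pi_eq0 a : hopf_pi a = 0 <-> I a.
Proof. exact: (@sq_pi_eq0 _ _ hopf_subquotient). Qed.

Definition hopf_lift (T : Type) (f : H -> T) (x : hopf_quot) := f (sq_repr x).

Lemma hopf_lift_pi (T : zmodType) (f : {additive H -> T}) a :
  (forall a, I a -> f a = 0) -> hopf_lift f (hopf_pi a) = f a.
Proof.
move=> f0; apply/esym/eqP; rewrite -subr_eq0 -raddfB; apply/eqP/f0.
exact: (@sq_repr_pi _ _ hopf_subquotient).
Qed.

Let pl := hopf_pi_linear.

Let comul_ker a : I a -> tmap hopf_pi hopf_pi (comul a) = 0.
Proof.
move=> /hi_comul; apply=> [|b c /hopf_pi_eq0 ->|b c /hopf_pi_eq0 ->].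
- exact: (tmap_bilinear pl pl).
- by rewrite (bilinear0l (@tens_bilinear _ _ _)).
- by rewrite (bilinear0r (@tens_bilinear _ _ _)).
Qed.

Let pcomul a := tmap hopf_pi hopf_pi (comul a).
Let pcomul_linear : linear pcomul.
Proof. by move=> k a b; rewrite /pcomul (linearP comul) tmap_is_linear. Qed.
HB.instance Definition _ := GRing.isLinear.Build K H _ *:%R pcomul pcomul_linear.

Definition hopf_quot_comul := hopf_lift (fun a => tmap hopf_pi hopf_pi (comul a)).
Definition hopf_quot_counit := hopf_lift (@counit K H).
Definition hopf_quot_antipode := hopf_lift (fun a => hopf_pi (antipode a)).

Lemma hopf_quot_comulE a :
  hopf_quot_comul (hopf_pi a) = tmap hopf_pi hopf_pi (comul a).
Proof. exact: (hopf_lift_pi _ (f := pcomul)). Qed.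

Lemma hopf_quot_counitE a : hopf_quot_counit (hopf_pi a) = counit a.
Proof. by apply: hopf_lift_pi => b; apply: hi_counit. Qed.

Let panti a := hopf_pi (antipode a).
Let panti_linear : linear panti.
Proof. by move=> k a b; rewrite /panti (linearP antipode) pl. Qed.
HB.instance Definition _ := GRing.isLinear.Build K H _ *:%R panti panti_linear.

Lemma hopf_quot_antipodeE a :
  hopf_quot_antipode (hopf_pi a) = hopf_pi (antipode a).
Proof.
apply: (hopf_lift_pi _ (f := panti)) => b Ib.
by apply/hopf_pi_eq0/hi_antipode.
Qed.

Local Ltac elt x := have [{}x ->] := hopf_pi_surj x.

Let tmap_mul (x y : tensor H H) :
  tmap hopf_pi hopf_pi (x * y) = tmap hopf_pi hopf_pi x * tmap hopf_pi hopf_pi y.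
Proof. by apply: tmapM => // a b; apply: hopf_piM. Qed.

Let qcomul_linear : linear hopf_quot_comul.
Proof.
move=> k x y; elt x; elt y.
by rewrite -pl !hopf_quot_comulE (linearP comul) tmap_is_linear.
Qed.
Let qcomul_mul : monoid_morphism hopf_quot_comul.
Proof.
split=> [|x y]; last first.
  by elt x; elt y; rewrite -rmorphM !hopf_quot_comulE rmorphM tmap_mul.
rewrite -hopf_pi1 hopf_quot_comulE rmorph1 -(tens_one H H).
by rewrite tmap_tens // rmorph1.
Qed.
HB.instance Definition _ := GRing.isLinear.Build K hopf_quot _ *:%R
  hopf_quot_comul qcomul_linear.
HB.instance Definition _ := GRing.isMonoidMorphism.Build hopf_quot _
  hopf_quot_comul qcomul_mul.

Let qcounit_linear : linear (hopf_quot_counit : hopf_quot -> K^o).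
Proof.
by move=> k x y; elt x; elt y; rewrite -pl !hopf_quot_counitE linearP.
Qed.
Let qcounit_mul : monoid_morphism (hopf_quot_counit : hopf_quot -> K^o).
Proof.
split=> [|x y]; first by rewrite -hopf_pi1 hopf_quot_counitE rmorph1.
by elt x; elt y; rewrite -rmorphM !hopf_quot_counitE rmorphM.
Qed.
HB.instance Definition _ := GRing.isLinear.Build K hopf_quot K^o *:%R
  hopf_quot_counit qcounit_linear.
HB.instance Definition _ := GRing.isMonoidMorphism.Build hopf_quot K^o
  hopf_quot_counit qcounit_mul.

Let qanti_linear : linear hopf_quot_antipode.
Proof.
by move=> k x y; elt x; elt y; rewrite -pl !hopf_quot_antipodeE linearP pl.
Qed.
HB.instance Definition _ := GRing.isLinear.Build K hopf_quot hopf_quot *:%R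
  hopf_quot_antipode qanti_linear.

Let tmapE a b : tmap hopf_pi hopf_pi (a \ox b) = hopf_pi a \ox hopf_pi b.
Proof. by rewrite tmap_tens. Qed.

(** Transports an identity between the structure maps of [H], stated with [tlift],
to the quotient. *)
Lemma tlift_hopf_pi (T T' : lmodType K) (h : hopf_quot -> hopf_quot -> T)
    (g : H -> H -> T') (phi : T' -> T) (t : tensor H H) :
  bilinear h -> bilinear g -> linear phi ->
  (forall a b, h (hopf_pi a) (hopf_pi b) = phi (g a b)) ->
  tlift h (tmap hopf_pi hopf_pi t) = phi (tlift g t).
Proof.
move=> hb gb phil e; rewrite tlift_tmap //.
have hb' : bilinear (fun a b => h (hopf_pi a) (hopf_pi b)).
  by apply: bilinearI => k *; [rewrite pl (bilinearl hb)|rewrite pl (bilinearr hb)].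
apply: (tensor_linear_ext (g := fun t => phi (tlift g t))).
- exact: tlift_is_linear.
- by move=> k x y; rewrite tlift_is_linear // phil.
by move=> u v; rewrite !tlift_tens.
Qed.

Let qcounitl x : tlift (fun b c => hopf_quot_counit b *: c) (hopf_quot_comul x) = x.
Proof.
elt x; rewrite hopf_quot_comulE -[in RHS](counitl x).
apply: tlift_hopf_pi => //.
- apply: bilinearI => k *; first by rewrite qcounit_linear scalerDl scalerA.
  by rewrite scalerDr !scalerA mulrC.
- apply: bilinearI => k *; first by rewrite (linearP counit) scalerDl scalerA.
  by rewrite scalerDr !scalerA mulrC.
- by move=> a b; rewrite hopf_quot_counitE hopf_piZ.
Qed.

Let qcounitr x : tlift (fun b c => hopf_quot_counit c *: b) (hopf_quot_comul x) = x.
Proof.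
elt x; rewrite hopf_quot_comulE -[in RHS](counitr x).
apply: tlift_hopf_pi => //.
- apply: bilinearI => k *; last by rewrite qcounit_linear scalerDl scalerA.
  by rewrite scalerDr !scalerA mulrC.
- apply: bilinearI => k *; last by rewrite (linearP counit) scalerDl scalerA.
  by rewrite scalerDr !scalerA mulrC.
- by move=> a b; rewrite hopf_quot_counitE hopf_piZ.
Qed.

Let qantil x : tlift (fun b c => hopf_quot_antipode b * c) (hopf_quot_comul x)
  = (hopf_quot_counit x)%:A.
Proof.
elt x; rewrite hopf_quot_comulE hopf_quot_counitE.
have -> : (counit x : K) *: (1 : hopf_quot) = hopf_pi ((counit x : K) *: 1).
  by rewrite hopf_piZ hopf_pi1.
transitivity (hopf_pi (tlift (fun b c : H => antipode b * c) (comul x))); last first.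
  by rewrite antipodel.
have h1 : bilinear (fun b c => hopf_quot_antipode b * c).
  apply: bilinearI => k a b c; first by rewrite qanti_linear mulrDl -scalerAl.
  by rewrite mulrDr -scalerAr.
apply: (tlift_hopf_pi _ h1 (antipode_mul_bilinear H) pl) => a b.
by rewrite hopf_quot_antipodeE hopf_piM.
Qed.

Let qantir x : tlift (fun b c => b * hopf_quot_antipode c) (hopf_quot_comul x)
  = (hopf_quot_counit x)%:A.
Proof.
elt x; rewrite hopf_quot_comulE hopf_quot_counitE.
have -> : (counit x : K) *: (1 : hopf_quot) = hopf_pi ((counit x : K) *: 1).
  by rewrite hopf_piZ hopf_pi1.
transitivity (hopf_pi (tlift (fun b c : H => b * antipode c) (comul x))); last first.
  by rewrite antipoder.
have h1 : bilinear (fun b c => b * hopf_quot_antipode c).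
  apply: bilinearI => k a b c; last by rewrite qanti_linear mulrDr -scalerAr.
  by rewrite mulrDl -scalerAl.
apply: (tlift_hopf_pi _ h1 (mul_antipode_bilinear H) pl) => a b.
by rewrite hopf_quot_antipodeE hopf_piM.
Qed.

Let qcomulA x : tassoc (tmap hopf_quot_comul idfun (hopf_quot_comul x))
  = tmap idfun hopf_quot_comul (hopf_quot_comul x).
Proof.
elt x; rewrite hopf_quot_comulE.
have cl : linear (@comul K H) by move=> k a b; rewrite linearP.
have idl (U : lmodType K) : linear (@idfun U) by [].
have ppl := tmap_is_linear pl pl.
pose p3 := tmap hopf_pi (tmap hopf_pi hopf_pi).
have p3l : linear p3 by apply: tmap_is_linear.
transitivity (p3 (tmap idfun comul (comul x))); last first.
  apply/esym/tlift_hopf_pi => //; try by apply: tmap_bilinear => //.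
  by move=> a b; rewrite /p3 tmap_tens // hopf_quot_comulE.
rewrite -comulA.
apply: (tensor_linear_ext
  (f := fun t => tassoc (tmap hopf_quot_comul idfun (tmap hopf_pi hopf_pi t)))
  (g := fun t => p3 (tassoc (tmap comul idfun t)))).
- by move=> k t t'; rewrite ppl tmap_is_linear // tassoc_is_linear.
- by move=> k t t'; rewrite tmap_is_linear // tassoc_is_linear p3l.
move=> a b; rewrite !tmap_tens // hopf_quot_comulE /=.
have tb := fun V W => @tens_bilinear K V W.
apply: (tensor_linear_ext
  (f := fun t => tassoc (tmap hopf_pi hopf_pi t \ox hopf_pi b))
  (g := fun t => p3 (tassoc (t \ox b)))).
- by move=> k t t'; rewrite ppl (bilinearl (tb _ _)) tassoc_is_linear.
- by move=> k t t'; rewrite (bilinearl (tb _ _)) tassoc_is_linear p3l.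
by move=> c d; rewrite tmapE !tassoc_tens /p3 !tmap_tens.
Qed.

HB.instance Definition _ := isHopfAlgebra.Build K hopf_quot
  qcomulA qcounitl qcounitr qantil qantir.

Lemma hopf_pi_comul a : comul (hopf_pi a) = tmap hopf_pi hopf_pi (comul a).
Proof. exact: hopf_quot_comulE. Qed.
Lemma hopf_pi_counit a : counit (hopf_pi a) = counit a.
Proof. exact: hopf_quot_counitE. Qed.
Lemma hopf_pi_antipode a : antipode (hopf_pi a) = hopf_pi (antipode a).
Proof. exact: hopf_quot_antipodeE. Qed.

End HopfQuotient.

(** * Representations compatible with the adjoint *)

Section InversePowers.
Variables (K : fieldType) (n : nat).

(** By Cayley-Hamilton, the inverse of a matrix is a polynomial in it.  The powers
are given by their recursion, as ['M_n] is a ring with [1 != 0] only for positive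
[n]. *)
Lemma inverse_power_comb (B Bi : 'M[K]_n) (b : nat -> 'M[K]_n) :
  b 0 = 1%:M -> (forall k, b k.+1 = B *m b k) -> Bi *m B = 1%:M ->
  exists N (c : nat -> K), Bi = \sum_(k < N) c k *: b k.
Proof.
case: n B Bi b => [|n'] B Bi b b0 bS BiB.
  by exists 0, (fun=> 0); rewrite [Bi]flatmx0 [RHS]flatmx0.
have bE k : b k = B ^+ k.
  by elim: k => [|k IH]; rewrite ?b0 ?expr0 // bS IH exprS.
pose p := char_poly B; pose N := (size p).-1.
have sp : size p = N.+1 by rewrite /N /p size_char_poly.
have p0 : p`_0 != 0.
  have /mulmx1_unit[_ uB] := BiB.
  by rewrite char_poly_det mulf_neq0 ?signr_eq0 // -unitfE.
have ch : \sum_(k < N.+1) p`_k *: B ^+ k = 0.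
  rewrite -[RHS](Cayley_Hamilton B) /horner_mx /horner_morph horner_coef.
  rewrite size_map_poly_id0 ?sp; last first.
    by rewrite fmorph_eq0 lead_coef_eq0 -size_poly_eq0 sp.
  by apply: eq_bigr => k _; rewrite coef_map /= -mul_scalar_mx.
exists N, (fun k => - p`_k.+1 / p`_0).
apply: (scalerI p0); rewrite scaler_sumr.
have := congr1 (mulmx Bi) ch; rewrite mulmx0 big_ord_recl mulmxDr /=.
rewrite expr0 -scalemxAr mulmx1 => /eqP; rewrite addr_eq0 => /eqP ->.
rewrite mulmx_sumr -sumrN; apply: eq_bigr => k _.
rewrite scalerA mulrC divfK // scaleNr; congr (- _).
by rewrite -scalemxAr exprS mulmxA BiB mul1mx bE.
Qed.

End InversePowers.

Section UnitaryRepresentations.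
Variables (R : realType) (n : nat).
Local Notation C := R[i].
Variables (H : hopfAlgType C) (v : 'M[H]_n) (P : 'M[C]_n).
Hypotheses (cv : corepresentation v) (uP : P \in unitmx).
Local Notation S := (@antipode C H).

(** The two conditions on the antipode say that the image of [v] is unitary, and
that it satisfies the twist condition for [P].  They are what the representation
of a model of a twisted biunitary has, and they pass to convolution products. *)
Definition unirep d (rho : H -> 'M[C]_d) : Prop :=
  [/\ linear rho, rho 1 = 1%:M, forall a b, rho (a * b) = rho a *m rho b,
      forall i j, rho (S (v i j)) = adjmx (rho (v j i))
    & forall i j, rho (S (S (v i j)))
        = \sum_k \sum_l (invmx P i k * P l j) *: rho (v k l)].

Let cw := corepresentation_comatrix cv.

Lemma comul_S i j : comul (S (v i j)) = \sum_k S (v k j) \ox S (v i k).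
Proof. exact: (comatrix_antipode cw).1. Qed.

Lemma comul_SS i j : comul (S (S (v i j))) = \sum_k S (S (v i k)) \ox S (S (v k j)).
Proof. exact: (comatrix_antipode (comatrix_antipode cw)).1. Qed.

(** In the convolution product of two representations on which [S^2] is
conjugation by [P], the inner factors [P] and [P^-1] cancel. *)
Lemma twisted_sum (U V T : lmodType C) (g : U -> V -> T) x y i j :
  bilinear g ->
  \sum_k g (\sum_a \sum_b (invmx P i a * P b k) *: x a b)
           (\sum_c \sum_d (invmx P k c * P d j) *: y c d)
  = \sum_a \sum_d (invmx P i a * P d j) *: \sum_b g (x a b) (y b d).
Proof.
move=> gb; pose gl z := big_morph (g^~ z) (fun a b => bilinearDl gb a b z) (bilinear0l gb z).
pose gr z := big_morph (g z) (bilinearDr gb z) (bilinear0r gb z).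
transitivity (\sum_k \sum_a \sum_b \sum_c \sum_d
   (invmx P i a * P d j * (P b k * invmx P k c)) *: g (x a b) (y c d)).
  apply: eq_bigr => k _; rewrite gl; apply: eq_bigr => a _.
  rewrite gl; apply: eq_bigr => b _; rewrite gr; apply: eq_bigr => c _.
  rewrite gr; apply: eq_bigr => d _.
  by rewrite (bilinearZl gb) (bilinearZr gb) scalerA; congr (_ *: _); ring.
rewrite exchange_big; apply: eq_bigr => a _ /=.
rewrite exchange_big /=.
under [RHS]eq_bigr => d _ do rewrite scaler_sumr.
rewrite [RHS]exchange_big; apply: eq_bigr => b _ /=.
have PP c : \sum_k P b k * invmx P k c = (b == c)%:R.
  by have := congr1 (fun A : 'M_n => A b c) (mulmxV uP); rewrite !mxE.
rewrite exchange_big /= (bigD1 b) //= [X in _ + X]big1 ?addr0 => [|c ncb].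
  rewrite exchange_big; apply: eq_bigr => d _ /=.
  by rewrite -scaler_suml -mulr_sumr PP eqxx mulr1.
rewrite exchange_big big1 // => d _ /=.
by rewrite -scaler_suml -mulr_sumr PP eq_sym (negPf ncb) mulr0 scale0r.
Qed.

Section Convolution.
Variables (d e : nat) (rho : H -> 'M[C]_d) (sig : H -> 'M[C]_e).
Hypotheses (hr : unirep rho) (hs : unirep sig).

Definition convrep (a : H) : 'M[C]_(d * e) :=
  tlift (fun x y => rho x *t sig y) (comul a).

Lemma tensmx_bilinear (m1 m2 n1 n2 : nat) :
  bilinear (fun (A : 'M[C]_(m1, m2)) (B : 'M[C]_(n1, n2)) => A *t B).
Proof.
apply: bilinearI => k *; apply/matrixP => i j; rewrite !mxE.
  by rewrite mulrDl mulrA.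
by rewrite mulrDr mulrCA.
Qed.

Let conv_bil : bilinear (fun x y => rho x *t sig y).
Proof.
have tb := tensmx_bilinear d d e e.
case: hr => rl _ _ _ _; case: hs => sl _ _ _ _; apply: bilinearI => k *.
  by rewrite rl (bilinearl tb).
by rewrite sl (bilinearr tb).
Qed.

Let conv_mul (x y : tensor H H) :
  tlift (fun x y => rho x *t sig y) (x * y)
  = tlift (fun x y => rho x *t sig y) x *m tlift (fun x y => rho x *t sig y) y.
Proof.
case: hr => _ _ rM _ _; case: hs => _ _ sM _ _.
move: x; apply: tensor_ind => [|a b|x x' hx hx'].
- by rewrite mul0r tlift0 // mul0mx.
- move: y; apply: tensor_ind => [|c c'|y y' hy hy'].
  + by rewrite mulr0 tlift0 // mulmx0.
  + by rewrite tensor_mul_tens !tlift_tens // tensmx_mul rM sM.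
  + by rewrite mulrDr !tliftD // hy hy' mulmxDr.
by rewrite mulrDl !tliftD // hx hx' mulmxDl.
Qed.

(** The antipode reverses the comultiplication, and so does the transposition of
the indices in the adjoint: the two Kronecker factors stay in place. *)
Lemma unirep_conv : unirep convrep.
Proof.
have tb := tensmx_bilinear d d e e.
rewrite /convrep; case: (hr) (hs) => rl r1 rM rS rSS [sl s1 sM sS sSS]; split.
- by move=> k a b; rewrite linearP tlift_is_linear.
- rewrite rmorph1 -(tens_one H H) tlift_tens // r1 s1.
  apply/matrixP => i j; rewrite !mxE -natrM mulnb -xpair_eqE.
  by rewrite -!surjective_pairing (can_eq (@mxtens_unindexK d e)).
- by move=> a b; rewrite rmorphM conv_mul.
- move=> i j; rewrite comul_S cw.1 !tlift_sum //.
  apply/matrixP => p q.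
  rewrite summxE !mxE summxE rmorph_sum; apply: eq_bigr => k _ /=.
  rewrite !tlift_tens // rS sS.
  by rewrite !mxE rmorphM.
- move=> i j; rewrite comul_SS tlift_sum //.
  transitivity (\sum_k rho (S (S (v i k))) *t sig (S (S (v k j)))).
    by apply: eq_bigr => k _; rewrite tlift_tens.
  under eq_bigr => k _ do rewrite rSS sSS.
  rewrite (twisted_sum (fun a b => rho (v a b)) (fun a b => sig (v a b)) i j tb).
  apply: eq_bigr => a _; apply: eq_bigr => b _; congr (_ *: _).
  rewrite (cw.1 a b) (tlift_sum conv_bil).
  by apply: eq_bigr => k _; rewrite tlift_tens.
Qed.

Lemma convrepE a p q p' q' :
  convrep a (mxtens_index (p, q)) (mxtens_index (p', q'))
  = tlift (fun x y => (rho x p p' * sig y q q' : C^o)) (comul a).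
Proof.
rewrite /convrep (@tlift_comp _ _ _ _ C^o _
  (fun A : 'M_(d * e) => A (mxtens_index (p, q)) (mxtens_index (p', q')))) //.
  by congr tlift; apply/funext => x; apply/funext => y; rewrite tensmxE.
by move=> k A B; rewrite !mxE.
Qed.

End Convolution.

Lemma unirep_counit : unirep (fun a => (counit a : C)%:M : 'M[C]_1).
Proof.
have eS i j : counit (S (v i j)) = (i == j)%:R.
  by rewrite (comatrix_antipode cw).2 eq_sym.
have eSS i j : counit (S (S (v i j))) = (i == j)%:R.
  exact: (comatrix_antipode (comatrix_antipode cw)).2.
split.
- move=> k a b; rewrite linearP; apply/matrixP => p q.
  by rewrite !mxE mulrnDl -mulrnAr.
- by rewrite rmorph1.
- by move=> a b; rewrite rmorphM scalar_mxM.
- move=> i j; rewrite eS cw.2 eq_sym; apply/matrixP => p q.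
  by rewrite !mxE [q == p]eq_sym; case: eqP; case: eqP; rewrite ?mulr1n ?conjC1 ?conjC0 ?mulr0n.
move=> i j; rewrite eSS.
under eq_bigr => k _.
  under eq_bigr => l _ do rewrite cw.2.
  rewrite (bigD1 k) //= big1 => [|l nlk]; last first.
    by rewrite eq_sym (negPf nlk) raddf0 scaler0.
  rewrite eqxx addr0; over.
rewrite -scaler_suml -scalemx1.
have := congr1 (fun A : 'M_n => A i j) (mulVmx uP); rewrite !mxE => ->.
by rewrite -scalemx1 scale1r.
Qed.

End UnitaryRepresentations.

(** * The common kernel of the compatible representations *)

Section CommonKernel.
Variables (R : realType) (n : nat).
Local Notation C := R[i].
Variables (H : hopfAlgType C) (v : 'M[H]_n) (P : 'M[C]_n).
Hypotheses (cv : corepresentation v) (uP : P \in unitmx).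
Hypothesis hall : forall a : H, is_coefficient a.
Local Notation S := (@antipode C H).

Definition common_kernel (a : H) :=
  forall d (rho : H -> 'M[C]_d), unirep v P rho -> rho a = 0.

Let entry (phi : H -> C) := exists d (rho : H -> 'M[C]_d) i j,
  unirep v P rho /\ phi = fun a => rho a i j.

Let entry_linear phi : entry phi -> linear (phi : H -> C^o).
Proof.
by move=> [d [rho [i [j [[rl _ _ _ _] ->]]]]] k a b; rewrite rl !mxE.
Qed.

Let entry_kernel a : (forall phi, entry phi -> phi a = 0) <-> common_kernel a.
Proof.
split=> [h d rho hr|h phi [d [rho [i [j [hr ->]]]]]].
  apply/matrixP => i j; rewrite mxE.
  exact: (h (fun a => rho a i j) (ex_intro _ d (ex_intro _ rho
    (ex_intro _ i (ex_intro _ j (conj hr erefl)))))).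
by rewrite h // mxE.
Qed.

(** The tensors killed by all [rho (x) sigma] are those of
[J (x) H + H (x) J], where [J] is the common kernel; this follows from
[tensor_separation], applied to the matrix entries. *)
Lemma common_kernel_tensor (T : lmodType C) (f : H -> H -> T) (t : tensor H H) :
  bilinear f ->
  (forall b c, common_kernel b -> f b c = 0) ->
  (forall b c, common_kernel c -> f b c = 0) ->
  (forall d e (rho : H -> 'M[C]_d) (sig : H -> 'M[C]_e) i i' j j',
     unirep v P rho -> unirep v P sig ->
     tlift (fun x y => (rho x i i' * sig y j j' : C^o)) t = 0) ->
  tlift f t = 0.
Proof.
move=> fb fl fr h; apply: (@tensor_separation _ _ _ entry entry) => //.
- by move=> b c /entry_kernel; apply: fl.
- by move=> b c /entry_kernel; apply: fr.
by move=> _ _ [d [rho [i [i' [hr ->]]]]] [e [sig [j [j' [hs ->]]]]]; apply: h.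
Qed.

Lemma common_kernel_comul a : common_kernel a ->
  forall (T : lmodType C) (f : H -> H -> T), bilinear f ->
    (forall b c, common_kernel b -> f b c = 0) ->
    (forall b c, common_kernel c -> f b c = 0) -> tlift f (comul a) = 0.
Proof.
move=> ha T f fb fl fr; apply: common_kernel_tensor => //.
move=> d e rho sig i i' j j' hr hs.
by rewrite -(convrepE hr hs) (ha _ _ (unirep_conv cv uP hr hs)) mxE.
Qed.

Lemma common_kernel_counit a : common_kernel a -> counit a = 0.
Proof.
by move=> /(_ _ _ (unirep_counit cv uP))/matrixP/(_ 0 0); rewrite !mxE.
Qed.

Section ConvolutionPowers.
Variables (d : nat) (rho : H -> 'M[C]_d).
Hypothesis hr : unirep v P rho.

(** The convolution powers of [rho], with matrix products in place of tensor
products, so that they all act on the same space. *)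
Fixpoint convpow k (a : H) : 'M[C]_d :=
  if k is k'.+1 then tlift (fun x y => rho x *m convpow k' y) (comul a)
  else (counit a : C)%:M.

Let convpow_bil k : linear (convpow k) ->
  bilinear (fun x y => rho x *m convpow k y).
Proof.
case: hr => rl _ _ _ _ cl; apply: bilinearI => c *.
  by rewrite rl mulmxDl scalemxAl.
by rewrite cl mulmxDr scalemxAr.
Qed.

Lemma convpow_linear k : linear (convpow k).
Proof.
elim: k => [|k IH] c a b /=.
  rewrite linearP; apply/matrixP => p q.
  by rewrite !mxE mulrnDl -mulrnAr.
by rewrite linearP tlift_is_linear //; apply: convpow_bil.
Qed.

(** [Delta a] lies in [J (x) H + H (x) J], where [J] is the common kernel, and
[rho] and the lower powers vanish on [J]. *)
Lemma convpow_kernel k a : common_kernel a -> convpow k a = 0.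
Proof.
elim: k a => [|k IH] a ha /=.
  by rewrite common_kernel_counit // raddf0.
apply: common_kernel_comul => //.
- exact/convpow_bil/convpow_linear.
- by move=> b c /(_ _ _ hr) ->; rewrite mul0mx.
- by move=> b c /IH ->; rewrite mulmx0.
Qed.

Lemma convpow_comatrix (I : finType) (w : I -> I -> H) k i j :
  comatrix w ->
  convpow k.+1 (w i j) = \sum_l rho (w i l) *m convpow k (w l j).
Proof.
have b := convpow_bil (@convpow_linear k).
move=> [wD _] /=; rewrite wD tlift_sum //.
by apply: eq_bigr => l _; rewrite tlift_tens.
Qed.

Let rho_sum (I : finType) (F : I -> H) : rho (\sum_i F i) = \sum_i rho (F i).
Proof.
by case: hr => rl _ _ _ _; apply: (lin_sum rl).
Qed.

(** On the span of the entries of one comatrix, [rho \o S] is the convolution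
inverse of [rho], hence a polynomial in [rho]. *)
Lemma antipode_convpow (I : finType) (w : I -> I -> H) : comatrix w ->
  exists N (c : nat -> C), forall i j,
    rho (S (w i j)) = \sum_(k < N) c k *: convpow k (w i j).
Proof.
move=> cw; pose T : finType := (I * 'I_d)%type.
(* The block matrix with blocks [f (w i j)]; convolution becomes its product. *)
pose big (f : H -> 'M[C]_d) : 'M[C]_#|T| := \matrix_(s, t)
  f (w (enum_val s).1 (enum_val t).1) (enum_val s).2 (enum_val t).2.
have bigM (f g h : H -> 'M[C]_d) :
    (forall i j, h (w i j) = \sum_l f (w i l) *m g (w l j)) ->
    big h = big f *m big g.
  move=> e; apply/matrixP => s t; rewrite !mxE e.
  rewrite (reindex (@enum_rank T)) /=; last first.
    by apply: onW_bij; exact: enum_rank_bij.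
  rewrite summxE (eq_bigr (fun p : T => f (w (enum_val s).1 p.1) (enum_val s).2 p.2
      * g (w p.1 (enum_val t).1) p.2 (enum_val t).2)) => [|p _]; last first.
    by rewrite !mxE !enum_rankK.
  rewrite -(pair_bigA _ (fun l r => f (w (enum_val s).1 l) (enum_val s).2 r
      * g (w l (enum_val t).1) r (enum_val t).2)) /=.
  by apply: eq_bigr => l _; rewrite mxE.
case: (hr) => rl r1 rM _ _.
have big1 h : (forall i j, h (w i j) = (i == j)%:R%:M) -> big h = 1%:M.
  move=> e; apply/matrixP => s t; rewrite !mxE e !mxE -(inj_eq enum_val_inj).
  case: (enum_val s) => i p; case: (enum_val t) => j q /=.
  by rewrite xpair_eqE -mulnb natrM mulr_natr.
have [] := @inverse_power_comb _ _ (big rho) (big (fun a => rho (S a)))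
    (fun k => big (convpow k)).
- by apply: big1 => i j /=; rewrite cw.2.
- by move=> k; apply: bigM => i j; apply: convpow_comatrix.
- rewrite -(bigM _ _ (fun a => (counit a : C)%:M)) => [|i j].
    by apply: big1 => i j /=; rewrite cw.2.
  transitivity (rho (\sum_l S (w i l) * w l j)).
    rewrite (antipode_comatrixl cw) cw.2; case: (i == j); first by rewrite r1.
    by rewrite (lin0 rl) raddf0.
  by rewrite rho_sum; apply: eq_bigr => l _; rewrite rM.
move=> N [c e]; exists N, c => i j; apply/matrixP => p q.
have := congr1 (fun A : 'M_#|T| => A (enum_rank ((i, p) : T)) (enum_rank ((j, q) : T))) e.
rewrite mxE !enum_rankK /= => ->; rewrite !summxE; apply: eq_bigr => k _.
by rewrite !mxE !enum_rankK.
Qed.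

End ConvolutionPowers.

Lemma common_kernel_antipode a : common_kernel a -> common_kernel (S a).
Proof.
move=> ha d rho hr; have [I [w [f [cw ea]]]] := hall a.
have [N [c e]] := antipode_convpow hr cw.
case: (hr) => rl _ _ _ _.
have lin (T : lmodType C) (g : H -> T) : linear g ->
    g a = \sum_i \sum_j f i j *: g (w i j).
  move=> gl; rewrite ea (lin_sum gl); apply: eq_bigr => i _.
  by rewrite (lin_sum gl); apply: eq_bigr => j _; rewrite (linZ gl).
rewrite (lin _ (fun a => rho (S a))); last by move=> k x y; rewrite linearP rl.
transitivity (\sum_(k < N) c k *: convpow rho k a); last first.
  by rewrite big1 // => k _; rewrite convpow_kernel // scaler0.
under [RHS]eq_bigr => k _.
  rewrite (lin _ _ (convpow_linear hr k)) scaler_sumr.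
  under eq_bigr do rewrite scaler_sumr.
  over.
rewrite [RHS]exchange_big; apply: eq_bigr => i _ /=.
rewrite [RHS]exchange_big; apply: eq_bigr => j _ /=.
by rewrite e scaler_sumr; apply: eq_bigr => k _; rewrite !scalerA mulrC.
Qed.

(** Transparent, so that membership unfolds to [common_kernel]. *)
Definition common_kernel_ideal : hopf_ideal H.
Proof.
apply: (@HopfIdeal _ H common_kernel).
- by move=> d rho [rl _ _ _ _]; apply: (lin0 rl).
- by move=> k a b ha hb d rho hr; case: (hr) => rl _ _ _ _;
    rewrite rl ha // hb // scaler0 addr0.
- by move=> a b hb d rho hr; case: (hr) => _ _ rM _ _; rewrite rM hb // mulmx0.
- by move=> a b ha d rho hr; case: (hr) => _ _ rM _ _; rewrite rM ha // mul0mx.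
- exact: common_kernel_counit.
- exact: common_kernel_antipode.
- exact: common_kernel_comul.
Defined.

End CommonKernel.

(** * Quotients of the minimal model *)

Section QuotientMap.
Variables (K : fieldType) (H : hopfAlgType K) (I : hopf_ideal H) (m : nat)
  (f : {lrmorphism H -> 'M[K]_m}) (hf : forall a, I a -> f a = 0).

(** The hypothesis is an argument in order that the instances below can find
it. *)
Definition hopf_quot_map (_ : forall a, I a -> f a = 0) : hopf_quot I -> 'M[K]_m :=
  hopf_lift f.

Lemma hopf_quot_mapE a : hopf_quot_map hf (hopf_pi I a) = f a.
Proof. exact: hopf_lift_pi. Qed.

Let quot_map_linear : linear (hopf_quot_map hf).
Proof.
move=> k x y; have [a ->] := hopf_pi_surj x; have [b ->] := hopf_pi_surj y.
by rewrite -hopf_pi_linear !hopf_quot_mapE linearP.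
Qed.
Let quot_map_monoid : monoid_morphism (hopf_quot_map hf).
Proof.
split=> [|x y]; first by rewrite -(hopf_pi1 I) hopf_quot_mapE rmorph1.
have [a ->] := hopf_pi_surj x; have [b ->] := hopf_pi_surj y.
by rewrite -hopf_piM !hopf_quot_mapE rmorphM.
Qed.
HB.instance Definition _ := GRing.isLinear.Build K (hopf_quot I) 'M[K]_m *:%R
  (hopf_quot_map hf) quot_map_linear.
HB.instance Definition _ := GRing.isMonoidMorphism.Build (hopf_quot I) 'M[K]_m
  (hopf_quot_map hf) quot_map_monoid.

End QuotientMap.

Section MatrixEntry.
Variables (K : fieldType) (n : nat) (i j : 'I_n).

Definition mx_entry (A : 'M[K]_n) : K^o := A i j.
Let mx_entry_linear : linear mx_entry.
Proof. by move=> k A B; rewrite /mx_entry !mxE. Qed.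
HB.instance Definition _ := GRing.isLinear.Build K 'M[K]_n K^o *:%R mx_entry
  mx_entry_linear.

Lemma entry_coefficients (A : algType K) (v : 'M[A]_n) : coefficients v (v i j).
Proof.
exists mx_entry; rewrite (bigD1 i) //= (bigD1 j) //= /mx_entry mxE !eqxx scale1r.
rewrite !big1 ?addr0 // => [k nki|l nlj].
  by rewrite big1 // => l _; rewrite mxE eq_sym (negPf nki) scale0r.
by rewrite mxE eqxx eq_sym (negPf nlj) scale0r.
Qed.

End MatrixEntry.

Section LeftFaithful.
Variables (K : fieldType) (n m : nat) (u : 'M['M[K]_m]_n) (M : model u).
Local Notation H := (model_alg M).
Local Notation v := (model_corep M).
Local Notation S := (@antipode K H).

Let iterS_linear k : linear (iter k S).
Proof.
by elim: k => [|k IH] c a b //=; rewrite IH linearP.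
Qed.

Lemma left_faithful_ind (X : H -> Prop) : left_faithful M ->
  subalgebra X -> (forall k i j, X (iter k S (v i j))) -> forall a, X a.
Proof.
move=> lf Xs Xg a; have : (@setT H) a by [].
rewrite -lf; apply => //; split=> // _ [k _ [_ [f ->] <-]].
have [X1 XD XM XZ] := Xs.
have X0 : X 0 by have := XZ 0 _ X1; rewrite scale0r.
have l0 : iter k S 0 = 0.
  exact: lin0 (iterS_linear k).
have lD x y : iter k S (x + y) = iter k S x + iter k S y.
  by have := iterS_linear k 1 x y; rewrite !scale1r.
have lZ c x : iter k S (c *: x) = c *: iter k S x.
  by have := iterS_linear k c x 0; rewrite l0 !addr0.
rewrite (big_morph _ lD l0); apply: (big_ind X) => // i _.
rewrite (big_morph _ lD l0); apply: (big_ind X) => // j _.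
by rewrite lZ; apply: XZ.
Qed.

(** The antipode maps comatrices to transposes of comatrices, so the generators
are coefficients, and coefficients form a subalgebra. *)
Lemma left_faithful_coefficient : left_faithful M ->
  forall a : H, is_coefficient a.
Proof.
move=> lf; apply: left_faithful_ind => //.
  exact: is_coefficient_subalgebra.
move=> k i j; apply: (iter_antipode_coefficient (w := fun i j => v i j)).
exact/corepresentation_comatrix/model_corepP.
Qed.

(** [H / I] is again a left-faithful model.  Followed by the morphism [H / I -> H]
that terminality provides, the projection is an endomorphism of the model [H],
hence the identity. *)
Lemma minimal_model_hopf_ideal (I : hopf_ideal H) : minimal_model M ->
  (forall a, I a -> model_rep M a = 0) -> forall a, I a -> a = 0.
Proof.
move=> [lf univ] Irep; pose p := hopf_pi I.
have cvp : corepresentation (map_mx p v).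
  have [hD he] := corepresentation_comatrix (model_corepP M).
  split; apply/matrixP => i j; rewrite !mxE.
    rewrite hopf_pi_comul hD /tmap tlift_sum; last first.
      by apply: tmap_bilinear; apply: hopf_pi_linear.
    apply: eq_bigr => k _; rewrite !mxE tensor_mul_tens mulr1 mul1r.
    by rewrite tlift_tens //; apply: tmap_bilinear; apply: hopf_pi_linear.
  by rewrite hopf_pi_counit he.
have ep : map_mx (hopf_quot_map Irep) (map_mx p v) = u.
  rewrite -[RHS](model_eq M); apply/matrixP => i j; rewrite !mxE.
  exact: hopf_quot_mapE.
pose M' := @Model K n m u (hopf_quot I) (map_mx p v) (hopf_quot_map Irep) cvp ep.
have lf' : left_faithful M'.
  apply/seteqP; split=> // x _; have [a ->] := hopf_pi_surj x => X [Xs Xg].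
  have [X1 XD XM XZ] := Xs.
  apply: (left_faithful_ind (X := fun a => X (p a))) => //.
    split=> // [b c Xb Xc|b c Xb Xc|k b Xb].
    - by rewrite /p raddfD; apply: XD.
    - by rewrite /p hopf_piM; apply: XM.
    - by rewrite /p hopf_piZ; apply: XZ.
  move=> k i j; apply: Xg; exists k => //; exists (p (v i j)); last first.
    by elim: k => [|k IH] //=; rewrite IH hopf_pi_antipode.
  by rewrite -[p (v i j)](mxE map_mx_key (fun i j => p (v i j))); apply: entry_coefficients.
have [f [fh fv fr] _] := univ M' lf'.
have [g _ gu] := univ M lf.
pose fp : {lrmorphism H -> H} := f \o p.
have mm1 : model_morphism (M1 := M) (M2 := M) fp.
  have [fD fe fS] := fh.
  split=> [||a]; last by rewrite -[LHS](hopf_quot_mapE Irep) fr.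
    split=> a /=.
    - rewrite fD hopf_pi_comul; apply: tlift_tmap; try exact: hopf_pi_linear.
      by apply: tmap_bilinear => k x y; rewrite linearP.
    - by rewrite fe hopf_pi_counit.
    - by rewrite fS hopf_pi_antipode.
  by rewrite -[RHS]fv; apply/matrixP => i j; rewrite !mxE.
have mm2 : model_morphism (M1 := M) (M2 := M) (idfun : {lrmorphism H -> H}).
  split=> //; first by split=> // a; exact: tensor_sum.
  by apply/matrixP => i j; rewrite !mxE.
move=> a Ia; transitivity (g a); [exact: (gu _ mm2 a)|rewrite -(gu _ mm1 a) /=].
by have /hopf_pi_eq0 -> := Ia; rewrite raddf0.
Qed.

End LeftFaithful.

(** * The involution *)

Section Twist.
Variables (R : realType) (n m : nat).
Local Notation C := R[i].
Variable u : 'M['M[C]_m]_n.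
Hypothesis hu : twisted_biunitary u.

Lemma adjmxE d (A : 'M[C]_d) i j : adjmx A i j = (A j i)^*.
Proof. by rewrite !mxE. Qed.

Lemma adjmxK d : involutive (@adjmx R d).
Proof. by move=> A; apply/matrixP => i j; rewrite !adjmxE conjCK. Qed.

Lemma adjmxM d (A B : 'M[C]_d) : adjmx (A *m B) = adjmx B *m adjmx A.
Proof. by rewrite /adjmx trmx_mul map_mxM. Qed.

Let td (A : 'M[C]_n) := tens_id m A.

Let tdM A B : td (A *m B) = td A *m td B.
Proof.
apply/matrixP => i j; rewrite !mxE raddf_sum; apply: eq_bigr => k _ /=.
by rewrite !mxE scalar_mxM.
Qed.

Let td1 : td 1%:M = 1%:M.
Proof.
apply/matrixP => i j; rewrite !mxE; case: (i == j) => //=.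
by rewrite mulr0n raddf0.
Qed.

Let conj_inv (A B X U : 'M['M[C]_m]_n) :
  B *m A = 1%:M -> A *m B = 1%:M -> X *m U = 1%:M ->
  A *m X *m B *m (A *m U *m B) = 1%:M.
Proof.
move=> BA AB XU; rewrite !mulmxA -(mulmxA (A *m X) B A) BA mulmx1.
by rewrite -(mulmxA A X U) XU mulmx1.
Qed.

(** The matrix [pi (S (v i j))] is the inverse of [u], which is its adjoint.  The
transpose of [pi (S (S (v i j)))] is the inverse of the transpose of [u^-1], and
the twist condition expresses this inverse by [u], up to conjugation with the
transpose of [P = Q * Q]. *)
Lemma twisted_biunitary_twist : exists P : 'M[C]_n,
  [/\ P \in unitmx, adjmx P = P
    & forall M : model u, unirep (model_corep M) P (model_rep M)].
Proof.
case: hu => uU [Q [[Qh _] uQ [w [uw wu] [uX Xu]]]].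
pose P := Q *m Q; have uP : P \in unitmx by rewrite unitmx_mul uQ.
exists P; split=> //; first by rewrite adjmxM [adjmx Q]Qh.
move=> M; set v := model_corep M; set pi := model_rep M.
have cw := corepresentation_comatrix (model_corepP M).
have piu i j : pi (v i j) = u i j.
  by have := congr1 (fun A : 'M_n => A i j) (model_eq M); rewrite mxE.
have PT : Q^T *m Q^T = P^T by rewrite trmx_mul.
have uPT : P^T \in unitmx by rewrite unitmx_tr.
have famM (A : pzRingType) (a b : 'M[A]_n) : a *m b = 1%:M ->
    inverse_family (fun i j => a i j) (fun i j => b i j).
  by move=> ab i j; have := congr1 (fun A : 'M_n => A i j) ab; rewrite !mxE.
pose y i j := pi (antipode (v i j)).
have yu : inverse_family y u.
  move=> i j; have := congr1 pi (antipode_comatrixl cw i j).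
  rewrite rmorph_sum rmorph_nat => <-; apply: eq_bigr => k _.
  by rewrite rmorphM /= piu.
have yw : y =2 w by apply: (inverse_family_uniq yu); apply: famM.
have yst i j : y i j = adjmx (u j i).
  rewrite yw; have := inverse_family_uniq (famM _ _ _ wu) (famM _ _ _ uU.1) i j.
  by rewrite !mxE.
pose Z := td P^T *m u^T *m td (invmx P^T).
have wZ : w^T *m Z = 1%:M.
  have [X Xu' ->] : exists2 X, X *m u^T = 1%:M &
      w^T = td P^T *m X *m td (invmx P^T).
    exists (td (invmx P^T) *m w^T *m td P^T); first by rewrite -PT.
    rewrite !mulmxA -tdM mulmxV // td1 mul1mx -mulmxA -tdM.
    by rewrite mulmxV // td1 mulmx1.
  have BA : td (invmx P^T) *m td P^T = 1%:M by rewrite -tdM mulVmx // td1.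
  have AB : td P^T *m td (invmx P^T) = 1%:M by rewrite -tdM mulmxV // td1.
  exact: (conj_inv BA AB Xu').
have zZ i j : pi (antipode (antipode (v j i))) = Z i j.
  apply: (inverse_family_uniq (y := fun i j => y j i)
    (x := fun i j => pi (antipode (antipode (v j i)))) (z := Z)).
    move=> k l.
    have := congr1 pi (antipode_comatrixl (comatrix_antipode cw) k l).
    rewrite rmorph_sum rmorph_nat => <-; apply: eq_bigr => q _.
    by rewrite rmorphM.
  move=> k l; rewrite -[RHS](famM _ _ _ wZ); apply: eq_bigr => q _.
  by rewrite yw /= [w^T k q]mxE.
split.
- by move=> k a b; rewrite linearP.
- by rewrite rmorph1.
- by move=> a b; rewrite rmorphM.
- by move=> i j; rewrite piu -yst.
move=> i j; rewrite zZ /Z mxE.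
transitivity (\sum_k \sum_l (invmx P i k * P l j) *: u k l); last first.
  by apply: eq_bigr => k _; apply: eq_bigr => l _; rewrite piu.
apply: eq_bigr => k _; rewrite !mxE big_distrl /=; apply: eq_bigr => l _.
rewrite !mxE -trmx_inv mxE.
by rewrite -[X in X = _]mulmxA mul_mx_scalar mul_scalar_mx scalerA mulrC.
Qed.

End Twist.

(** Both [S (v i j)] and the adjoint of [v] are inverse to [v]. *)
Lemma unitary_antipode (R : realType) (n : nat) (H : hopfAlgType R[i])
    (v : 'M[H]_n) (st : H -> H) i j :
  corepresentation v -> mxunitary st v -> antipode (v i j) = st (v j i).
Proof.
move=> /corepresentation_comatrix/antipode_comatrixl Sv [vs _].
have := inverse_family_uniq Sv (z := mxstar st v).
move=> h; rewrite h ?mxE // => k l.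
have := congr1 (fun A : 'M_n => A k l) vs; rewrite !mxE => <-.
by apply: eq_bigr => q _.
Qed.

Section HopfInvolution.
Variables (R : realType) (n : nat).
Local Notation C := R[i].
Variables (H : hopfAlgType C) (v : 'M[H]_n) (P : 'M[C]_n).
Local Notation S := (@antipode C H).
Hypotheses (cv : corepresentation v) (uP : P \in unitmx) (Ph : adjmx P = P).
Hypothesis hall : forall a : H, is_coefficient a.
Hypothesis hgen : forall X : H -> Prop, subalgebra X ->
  (forall k i j, X (iter k S (v i j))) -> forall a, X a.
Hypothesis sep : forall a, common_kernel v P a -> a = 0.

Let cw := corepresentation_comatrix cv.

Lemma unirep_eq a b :
  (forall d (rho : H -> 'M[C]_d), unirep v P rho -> rho a = rho b) -> a = b.
Proof.
move=> h; apply/eqP; rewrite -subr_eq0; apply/eqP/sep => d rho hr.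
by case: (hr) => rl _ _ _ _; rewrite (linB rl) h // subrr.
Qed.

Lemma unirep_linear d (rho : H -> 'M[C]_d) : unirep v P rho -> linear rho.
Proof. by case. Qed.

Lemma antipode2 i j :
  S (S (v i j)) = \sum_k \sum_l (invmx P i k * P l j) *: v k l.
Proof.
apply: unirep_eq => d rho hr; have rl := unirep_linear hr.
case: hr => _ _ _ _ ->; rewrite (lin_sum rl); apply: eq_bigr => k _.
by rewrite (lin_sum rl); apply: eq_bigr => l _; rewrite (linZ rl).
Qed.

(** As [S^2 v] is conjugate to [v], the higher powers of [S] bring nothing new. *)
Lemma generators_ind (X : H -> Prop) : subalgebra X ->
  (forall i j, X (v i j)) -> (forall i j, X (S (v i j))) -> forall a, X a.
Proof.
move=> Xs Xv XS; apply: hgen => // k; have [X1 XD XM XZ] := Xs.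
have X0 : X 0 by have := XZ 0 _ X1; rewrite scale0r.
suff: (forall i j, X (iter k S (v i j))) /\ (forall i j, X (iter k.+1 S (v i j))).
  by case.
elim: k => [//|k [IH1 IH2]]; split=> // i j.
rewrite !iterSr antipode2.
have il : linear (iter k S) by elim: k {IH1 IH2} => [|k IH] c a b //=; rewrite IH linearP.
rewrite lin_sum //; apply: (big_ind X) => // a _.
rewrite lin_sum //; apply: (big_ind X) => // b _.
by rewrite linZ //; apply: XZ.
Qed.

Let star_spec (a b : H) := forall d (rho : H -> 'M[C]_d), unirep v P rho ->
  rho b = adjmx (rho a).

Let adjD d (A B : 'M[C]_d) : adjmx (A + B) = adjmx A + adjmx B.
Proof. by apply/matrixP => i j; rewrite !(adjmxE, mxE) rmorphD. Qed.

Let adjZ d k (A : 'M[C]_d) : adjmx (k *: A) = k^* *: adjmx A.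
Proof. by apply/matrixP => i j; rewrite !(adjmxE, mxE) rmorphM. Qed.

Let star_specv i j : star_spec (v i j) (S (v j i)).
Proof. by move=> d rho [_ _ _ -> _]. Qed.

Let star_specS i j : star_spec (S (v i j)) (v j i).
Proof. by move=> d rho [_ _ _ -> _]; rewrite adjmxK. Qed.

(** The elements that have an adjoint under all the [rho] form a subalgebra, and
[v i j] has the adjoint [S (v j i)]. *)
Let star_ex a : exists b, star_spec a b.
Proof.
move: a; apply: generators_ind; last 2 first.
- by move=> i j; exists (S (v j i)).
- by move=> i j; exists (v j i).
split=> [|a a' [b hb] [b' hb']|a a' [b hb] [b' hb']|k a [b hb]].
- exists 1 => d rho [_ r1 _ _ _]; rewrite r1; apply/matrixP => i j.
  by rewrite adjmxE !mxE eq_sym rmorph_nat.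
- exists (b + b') => d rho hr; have rl := unirep_linear hr.
  by rewrite !(linD rl) adjD hb // hb'.
- exists (b' * b) => d rho hr; case: (hr) => _ _ rM _ _.
  by rewrite !rM adjmxM hb // hb'.
exists (k^* *: b) => d rho hr; have rl := unirep_linear hr.
by rewrite !(linZ rl) adjZ hb.
Qed.

Definition hopf_star a := projT1 (cid (star_ex a)).

Lemma unirep_star a d (rho : H -> 'M[C]_d) :
  unirep v P rho -> rho (hopf_star a) = adjmx (rho a).
Proof. exact: (projT2 (cid (star_ex a))). Qed.

Let starE a b : star_spec a b -> hopf_star a = b.
Proof. by move=> h; apply: unirep_eq => d rho hr; rewrite unirep_star // h. Qed.

Lemma hopf_star_v i j : hopf_star (v i j) = S (v j i).
Proof. exact: starE. Qed.

Lemma hopf_star_Sv i j : hopf_star (S (v i j)) = v j i.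
Proof. exact: starE. Qed.

Lemma hopf_star_involution : involution hopf_star.
Proof.
split=> [a b|k a|a b||a]; apply: starE => d rho hr; have rl := unirep_linear hr.
- by rewrite !(linD rl) !unirep_star // adjD.
- by rewrite !(linZ rl) unirep_star // adjZ.
- by case: (hr) => _ _ rM _ _; rewrite !rM !unirep_star // adjmxM.
- case: (hr) => _ r1 _ _ _; rewrite r1; apply/matrixP => i j.
  by rewrite adjmxE !mxE eq_sym rmorph_nat.
- by rewrite unirep_star // adjmxK.
Qed.

Let entry_bil d e (rho : H -> 'M[C]_d) (sig : H -> 'M[C]_e) i i' j j' :
  unirep v P rho -> unirep v P sig ->
  bilinear (fun x y => (rho x i i' * sig y j j' : C^o)).
Proof.
move=> [rl _ _ _ _] [sl _ _ _ _]; apply: bilinearI => k *.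
  by rewrite rl !mxE mulrDl -mulrA.
by rewrite sl !mxE mulrDr mulrCA.
Qed.

(** The products [rho (x) sigma] separate the points of [H (x) H], because the
common kernel is zero. *)
Lemma unirep_tensor_eq (t t' : tensor H H) :
  (forall d e (rho : H -> 'M[C]_d) (sig : H -> 'M[C]_e) i i' j j',
     unirep v P rho -> unirep v P sig ->
     tlift (fun x y => (rho x i i' * sig y j j' : C^o)) t
     = tlift (fun x y => (rho x i i' * sig y j j' : C^o)) t') -> t = t'.
Proof.
move=> h; apply/eqP; rewrite -subr_eq0; apply/eqP.
have tb := @tens_bilinear C H H.
transitivity (tlift (@tens C H H) (t - t')); first exact: tensor_sum.
apply: (common_kernel_tensor (v := v) (P := P)) => //.
- by move=> b c /sep ->; rewrite (bilinear0l tb).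
- by move=> b c /sep ->; rewrite (bilinear0r tb).
move=> d e rho sig i i' j j' hr hs.
have b := entry_bil i i' j j' hr hs.
by rewrite (linB (tlift_is_linear b)) h // subrr.
Qed.

Lemma hopf_star_comul a :
  comul (hopf_star a) = tmap hopf_star hopf_star (comul a).
Proof.
apply: unirep_tensor_eq => d e rho sig i i' j j' hr hs.
rewrite -(convrepE hr hs) (unirep_star _ (unirep_conv cv uP hr hs)) adjmxE.
have b := entry_bil i i' j j' hr hs.
rewrite (convrepE hr hs) -[tmap _ _ _]/(\sum_(p <- repr (comul a))
  hopf_star p.1 \ox hopf_star p.2) (tlift_sum b).
rewrite {1}/tlift /formal_sum rmorph_sum; apply: eq_bigr => p _.
by rewrite (tlift_tens b) !unirep_star // !adjmxE rmorphM.
Qed.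

Lemma hopf_star_counit a : counit (hopf_star a) = (counit a : C)^*.
Proof.
have := unirep_star a (unirep_counit cv uP) => /matrixP/(_ 0 0).
by rewrite adjmxE !mxE.
Qed.

Let SM a b : S (a * b) = S b * S a.
Proof. exact: antipode_antimul. Qed.

(** Since [P] is hermitian, the involution sends the entries of [S^2 v] to those
of [P (S v) P^-1] transposed, and [S] turns these into [P (S^2 v) P^-1 = v]. *)
Lemma hopf_star_antipode a : S (hopf_star (S (hopf_star a))) = a.
Proof.
have [stD stZ stM st1 stK] := hopf_star_involution.
move: a; apply: generators_ind; last 2 first.
- move=> i j; rewrite hopf_star_v antipode2.
  have st0 : hopf_star 0 = 0 by have := stZ 0 0; rewrite !scaler0 conjC0 scale0r.
  rewrite (big_morph hopf_star stD st0) linear_sum /=.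
  transitivity (\sum_k \sum_l \sum_a \sum_b
     ((P i l * invmx P l a) * (P b k * invmx P k j)) *: v a b).
    apply: eq_bigr => k _; rewrite (big_morph hopf_star stD st0) linear_sum /=.
    apply: eq_bigr => l _; rewrite stZ hopf_star_v linearZ /= antipode2 scaler_sumr.
    apply: eq_bigr => a _; rewrite scaler_sumr; apply: eq_bigr => b _.
    have Pc k' l' : (P k' l')^* = P l' k' by rewrite -[in RHS]Ph adjmxE.
    have Pic k' l' : (invmx P k' l')^* = invmx P l' k'.
      rewrite -adjmxE /adjmx; congr (_ _ _).
      by rewrite trmx_inv map_invmx; congr invmx; exact: Ph.
    by rewrite scalerA rmorphM /= Pc Pic; congr (_ *: _); ring.
  have PP b c : \sum_k P b k * invmx P k c = (b == c)%:R.
    by have := congr1 (fun A : 'M_n => A b c) (mulmxV uP); rewrite !mxE.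
  transitivity (\sum_a \sum_b ((i == a)%:R * (b == j)%:R) *: v a b).
    rewrite exchange_big /=.
    under eq_bigr => l _ do rewrite exchange_big /=.
    rewrite exchange_big; apply: eq_bigr => a _ /=.
    under eq_bigr => l _ do rewrite exchange_big /=.
    rewrite exchange_big; apply: eq_bigr => b _ /=.
    rewrite -!PP big_distrlr /= scaler_suml; apply: eq_bigr => l _.
    by rewrite scaler_suml.
  rewrite (bigD1 i) //= (bigD1 j) //= !eqxx mul1r scale1r !big1 ?addr0 //.
    by move=> a nai; rewrite big1 // => b _; rewrite eq_sym (negPf nai) mul0r scale0r.
  by move=> b /negPf nbj; rewrite nbj mulr0 scale0r.
- by move=> i j; rewrite !hopf_star_Sv.
split=> [|a b ha hb|a b ha hb|k a ha].
- by rewrite st1 antipode1 st1 antipode1.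
- by rewrite stD raddfD /= stD raddfD /= ha hb.
- by rewrite stM SM stM SM ha hb.
- by rewrite stZ linearZ /= stZ linearZ /= conjCK ha.
Qed.

Theorem hopf_star_hopf_involution : hopf_involution hopf_star.
Proof.
split; [exact: hopf_star_involution|exact: hopf_star_comul|
  exact: hopf_star_counit|exact: hopf_star_antipode].
Qed.

Lemma hopf_star_unitary : mxunitary hopf_star v.
Proof.
split; apply/matrixP => i j; rewrite !mxE.
  rewrite -(antipode_comatrixr cw); apply: eq_bigr => k _.
  by rewrite !mxE hopf_star_v.
rewrite -(antipode_comatrixl cw); apply: eq_bigr => k _.
by rewrite !mxE hopf_star_v.
Qed.

(** An involution is determined by its values on [v i j], which are those of
[unitary_antipode], and on the adjoints of these. *)
Lemma hopf_star_uniq (st' : H -> H) :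
  involution st' -> mxunitary st' v -> st' =1 hopf_star.
Proof.
move=> [stD stZ stM st1 stK] vs.
have hv i j : st' (v i j) = S (v j i) by rewrite (unitary_antipode _ _ cv vs).
have [sD sZ sM s1 sK] := hopf_star_involution.
apply: generators_ind; last 2 first.
- by move=> i j; rewrite hv hopf_star_v.
- by move=> i j; rewrite hopf_star_Sv -(stK (v j i)) hv.
split=> [|a b ha hb|a b ha hb|k a ha].
- by rewrite st1 s1.
- by rewrite stD sD ha hb.
- by rewrite stM sM ha hb.
- by rewrite stZ sZ ha.
Qed.

End HopfInvolution.

Import numFieldNormedType.Exports.
Local Open Scope classical_set_scope.

(** * C*-seminorms and completions *)

Section ComplexModulus.
Variable R : realType.
Local Notation C := R[i].

Definition cmod (k : C) : R := complex.Re `|k|.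

Lemma cmodE (k : C) : `|k| = (cmod k)%:C%C.
Proof. by rewrite /cmod; case: k => a b; rewrite normc_def. Qed.

Lemma cmod_ge0 k : 0 <= cmod k.
Proof. by have := normr_ge0 k; rewrite cmodE lecR. Qed.

Lemma cmodM k l : cmod (k * l) = cmod k * cmod l.
Proof.
have := normrM k l; rewrite !cmodE => h.
by have := congr1 (@complex.Re R) h; rewrite /= mul0r subr0.
Qed.

Lemma cmodD k l : cmod (k + l) <= cmod k + cmod l.
Proof. by have := ler_normD k l; rewrite !cmodE -rmorphD lecR. Qed.

Lemma cmod_eq0 k : cmod k = 0 -> k = 0.
Proof. by move=> h; apply/normr0_eq0; rewrite cmodE h. Qed.

Lemma cmod_real (r : R) : cmod r%:C%C = `|r|.
Proof. by rewrite /cmod normc_def /= expr0n addr0 sqrtr_sqr. Qed.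

Lemma cmodN k : cmod (- k) = cmod k.
Proof. by rewrite /cmod normrN. Qed.

Lemma cmod1 : cmod 1 = 1.
Proof. by rewrite /cmod normr1. Qed.

Lemma cmod_conj k : cmod (Num.conj k) = cmod k.
Proof. by rewrite /cmod norm_conjC. Qed.

Lemma conj_real (r : R) : Num.conj (r%:C%C : C) = r%:C%C.
Proof. by rewrite conj_Creal // complex_real. Qed.

Lemma cmod_half : cmod (2^-1 : C) = 2^-1.
Proof.
have -> : (2^-1 : C) = (2^-1 : R)%:C%C by rewrite fmorphV rmorph_nat.
by rewrite cmod_real ger0_norm // invr_ge0.
Qed.

End ComplexModulus.

(** The algebras considered carry unbundled operations, because [tensor A A]
is both a ring and a module without being an [algType]. *)
Record star_alg (R : realType) (B : lmodType R[i]) := StarAlg {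
  sa_mul : B -> B -> B;
  sa_one : B;
  sa_star : B -> B;
  sa_bilinear : bilinear sa_mul;
  sa_mulA : associative sa_mul;
  sa_mul1l : left_id sa_one sa_mul;
  sa_mul1r : right_id sa_one sa_mul;
  sa_starD : forall a b, sa_star (a + b) = sa_star a + sa_star b;
  sa_starZ : forall k a, sa_star (k *: a) = Num.conj k *: sa_star a;
  sa_starM : forall a b, sa_star (sa_mul a b) = sa_mul (sa_star b) (sa_star a);
  sa_star1 : sa_star sa_one = sa_one;
  sa_starK : involutive sa_star
}.

Lemma sa_star0 (R : realType) (B : lmodType R[i]) (S : star_alg B) :
  sa_star S 0 = 0.
Proof. by apply: (addrI (sa_star S 0)); rewrite -sa_starD !addr0. Qed.

Section AlgStar.
Variables (R : realType) (A : algType R[i]) (st : A -> A).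
Hypothesis hst : involution st.

Let mul_bil : bilinear ( *%R : A -> A -> A).
Proof.
apply: bilinearI => k a b c; first by rewrite mulrDl -scalerAl.
by rewrite mulrDr -scalerAr.
Qed.

Let stD a b : st (a + b) = st a + st b. Proof. by case: hst. Qed.
Let stZ k a : st (k *: a) = Num.conj k *: st a. Proof. by case: hst. Qed.
Let stM a b : st (a * b) = st b * st a. Proof. by case: hst. Qed.
Let st1 : st 1 = 1. Proof. by case: hst. Qed.
Let stK a : st (st a) = a. Proof. by case: hst. Qed.

Definition alg_star : star_alg A :=
  @StarAlg R A *%R 1 st mul_bil (@mulrA A) (@mul1r A) (@mulr1 A)
    stD stZ stM st1 stK.

End AlgStar.

Record cstar_seminorm (R : realType) (B : lmodType R[i]) (S : star_alg B)
    (p : B -> R) : Prop := CstarSeminorm {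
  cs_ge0 : forall a, 0 <= p a;
  cs_add : forall a b, p (a + b) <= p a + p b;
  cs_scale : forall k a, p (k *: a) = cmod k * p a;
  cs_mul : forall a b, p (sa_mul S a b) <= p a * p b;
  cs_star : forall a, p (sa_mul S (sa_star S a) a) = p a ^+ 2
}.

Lemma cstar_norm_seminorm (R : realType) (A : algType R[i]) (st : A -> A)
    (hst : involution st) (N : A -> R) :
  cstar_norm st N -> cstar_seminorm (alg_star hst) N.
Proof.
by move=> [[n0 n00] nD nZ nM nS]; split.
Qed.

Section CstarSeminormTheory.
Variables (R : realType) (B : lmodType R[i]) (S : star_alg B) (p : B -> R).
Hypothesis hp : cstar_seminorm S p.
Local Notation mul := (sa_mul S).
Local Notation one := (sa_one S).
Local Notation st := (sa_star S).

Lemma cs0 : p 0 = 0.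
Proof. by rewrite -(scale0r (0 : B)) (cs_scale hp) // cmod_real normr0 mul0r. Qed.

Lemma csN a : p (- a) = p a.
Proof. by rewrite -scaleN1r (cs_scale hp) // cmodN cmod1 mul1r. Qed.

Lemma cs_sub a b : p (a - b) <= p a + p b.
Proof. by rewrite -(csN b) (cs_add hp). Qed.

Lemma cs_subC a b : p (a - b) = p (b - a).
Proof. by rewrite -csN opprB. Qed.

Lemma cs_trans a b c : p (a - c) <= p (a - b) + p (b - c).
Proof. by rewrite -(subrKA b a) (cs_add hp). Qed.

Lemma cs_lt3 b a c e : p (a - b) < e / 2 -> p (b - c) <= e / 2 -> p (a - c) < e.
Proof. by have := cs_trans a b c; lra. Qed.

Lemma cs_lt4 b c a d e :
  p (b - a) < e / 3 -> p (b - c) < e / 3 -> p (c - d) < e / 3 -> p (a - d) < e.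
Proof.
by have := cs_trans a b d; have := cs_trans b c d; rewrite (cs_subC a b); lra.
Qed.

Lemma cs_dist a b : `|p a - p b| <= p (a - b).
Proof.
rewrite ler_norml; have h1 := cs_add hp (a - b) b; have h2 := cs_add hp (b - a) a.
rewrite !subrK in h1 h2; rewrite cs_subC in h2.
by apply/andP; split; lra.
Qed.

Let cs_starle a : p a <= p (st a).
Proof.
have [->|pa] := eqVneq (p a) 0; first exact: (cs_ge0 hp).
have := cs_mul hp (st a) a; rewrite (cs_star hp) // expr2 ler_pM2r //.
by rewrite lt_neqAle eq_sym pa (cs_ge0 hp).
Qed.

Lemma cs_isom a : p (st a) = p a.
Proof. by apply/eqP; rewrite eq_le cs_starle -{2}[a](sa_starK S) cs_starle. Qed.

Lemma cs_one : p one = 0 \/ p one = 1.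
Proof.
have := cs_star hp one; rewrite sa_star1 sa_mul1l expr2 => /eqP h.
have [->|nz] := eqVneq (p one) 0; [by left|right].
by apply: (mulfI nz); rewrite mulr1 -(eqP h).
Qed.

End CstarSeminormTheory.

Section Completion.
Variables (R : realType) (B : lmodType R[i]) (S : star_alg B) (p : B -> R).
Hypothesis hp : cstar_seminorm S p.
(* An [algType] is a nonzero ring, so the completion for the zero seminorm is
excluded. *)
Hypothesis p1 : p (sa_one S) != 0.
Local Notation mul := (sa_mul S).
Local Notation one := (sa_one S).
Local Notation st := (sa_star S).
Implicit Types x y : nat -> B.

Definition cauchy_for x := forall e, 0 < e ->
  exists k, forall i j, (k <= i)%N -> (k <= j)%N -> p (x i - x j) < e.
Definition null_for x := forall e, 0 < e ->
  exists k, forall i, (k <= i)%N -> p (x i) < e.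

Let mb := sa_bilinear S.
Let mulB (a b c d : B) : mul a b - mul c d = mul (a - c) b + mul c (b - d).
Proof.
by rewrite (bilinearBl mb) (bilinearBr mb) addrA subrK.
Qed.

Lemma cauchy_cst a : cauchy_for (fun=> a).
Proof. by move=> e e0; exists 0 => i j _ _; rewrite subrr (cs0 hp). Qed.

Lemma cauchy_bounded x : cauchy_for x -> exists2 c, 0 < c & forall i, p (x i) <= c.
Proof.
move=> /(_ 1 ltr01)[k hk].
exists (1 + p (x k) + \sum_(i < k) p (x i)) => [|i].
  by rewrite ltr_pwDl ?ltr_pwDl ?(cs_ge0 hp) // sumr_ge0 // => i _; apply: cs_ge0 hp _.
have s0 : 0 <= \sum_(i < k) p (x i) by rewrite sumr_ge0 // => l _; apply: cs_ge0 hp _.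
have [ik|ki] := ltnP i k; last first.
  have := cs_add hp (x i - x k) (x k); rewrite subrK.
  have := hk _ _ ki (leqnn k); lra.
have : p (x i) <= \sum_(i < k) p (x i).
  rewrite (bigD1 (Ordinal ik)) //= lerDl sumr_ge0 // => l _.
  exact: cs_ge0 hp _.
have := cs_ge0 hp (x k); lra.
Qed.

Let linear_small c a b e : 0 < e ->
  p a < e / 2 / (cmod c + 1) -> p b < e / 2 -> p (c *: a + b) < e.
Proof.
move=> e0; rewrite ltr_pdivlMr ?ltr_wpDl ?cmod_ge0 // => h1 h2.
apply: (le_lt_trans (cs_add hp _ _)); rewrite (cs_scale hp).
have : cmod c * p a <= p a * (cmod c + 1).
  by rewrite mulrC mulrDr mulr1 lerDl (cs_ge0 hp).
by move: h1 h2; lra.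
Qed.

Let half_pos (c : R[i]) (e : R) : 0 < e -> 0 < e / 2 / (cmod c + 1).
Proof. by move=> e0; rewrite !divr_gt0 // ltr_wpDl ?cmod_ge0. Qed.

Lemma cauchy_linear c x y :
  cauchy_for x -> cauchy_for y -> cauchy_for (c *: x + y).
Proof.
move=> hx hy e e0; have [k1 h1] := hx _ (half_pos c e0).
have [k2 h2] := hy (e / 2) (divr_gt0 e0 (ltr0Sn _ 1)).
exists (maxn k1 k2) => i j; rewrite !geq_max => /andP[i1 i2] /andP[j1 j2].
rewrite !fctE opprD addrACA -scalerBr; apply: linear_small => //.
- exact: h1.
- exact: h2.
Qed.

Lemma cauchy_mul x y :
  cauchy_for x -> cauchy_for y -> cauchy_for (fun i => mul (x i) (y i)).
Proof.
move=> hx hy e e0.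
have [c c0 hc] := cauchy_bounded hx; have [d d0 hd] := cauchy_bounded hy.
have [k1 h1] := hx (e / 2 / d) (divr_gt0 (divr_gt0 e0 (ltr0Sn _ 1)) d0).
have [k2 h2] := hy (e / 2 / c) (divr_gt0 (divr_gt0 e0 (ltr0Sn _ 1)) c0).
exists (maxn k1 k2) => i j; rewrite !geq_max => /andP[i1 i2] /andP[j1 j2].
rewrite mulB; apply: (le_lt_trans (cs_add hp _ _)).
have := h1 _ _ i1 j1; rewrite ltr_pdivlMr // => h1'.
have := h2 _ _ i2 j2; rewrite ltr_pdivlMr // => h2'.
have := le_trans (cs_mul hp (x i - x j) (y i)) (ler_wpM2l (cs_ge0 hp _) (hd i)).
have := le_trans (cs_mul hp (x j) (y i - y j)) (ler_wpM2r (cs_ge0 hp _) (hc j)).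
rewrite [c * _]mulrC; lra.
Qed.

Lemma null0 : null_for 0.
Proof. by move=> e e0; exists 0 => i _; rewrite [p _](cs0 hp). Qed.

Lemma null_linear c x y : null_for x -> null_for y -> null_for (c *: x + y).
Proof.
move=> hx hy e e0; have [k1 h1] := hx _ (half_pos c e0).
have [k2 h2] := hy (e / 2) (divr_gt0 e0 (ltr0Sn _ 1)).
exists (maxn k1 k2) => i; rewrite !geq_max => /andP[i1 i2]; rewrite !fctE.
apply: linear_small => //; [exact: h1|exact: h2].
Qed.

Lemma null_mull x y :
  cauchy_for x -> null_for y -> null_for (fun i => mul (x i) (y i)).
Proof.
move=> /cauchy_bounded[c c0 hc] hy e e0.
have [k h] := hy (e / c) (divr_gt0 e0 c0); exists k => i ki.
have := h _ ki; rewrite ltr_pdivlMr // mulrC; apply: le_lt_trans.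
by rewrite (le_trans (cs_mul hp _ _)) // ler_wpM2r // (cs_ge0 hp).
Qed.

Lemma null_mulr x y :
  null_for x -> cauchy_for y -> null_for (fun i => mul (x i) (y i)).
Proof.
move=> hx /cauchy_bounded[c c0 hc] e e0.
have [k h] := hx (e / c) (divr_gt0 e0 c0); exists k => i ki.
have := h _ ki; rewrite ltr_pdivlMr //; apply: le_lt_trans.
by rewrite (le_trans (cs_mul hp _ _)) // ler_wpM2l // (cs_ge0 hp).
Qed.

Let null1 : ~ null_for (fun=> one).
Proof.
move=> /(_ (p one)) []; last by move=> k /(_ k (leqnn k)); rewrite ltxx.
by rewrite lt_neqAle eq_sym p1 (cs_ge0 hp).
Qed.

Definition seq_mul x y i := mul (x i) (y i).

Let seq_bil : bilinear seq_mul.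
Proof.
by apply: bilinearI => k *; apply/funext => i; rewrite /seq_mul ?fctE
  ?(bilinearl mb) ?(bilinearr mb).
Qed.
Let seqA : associative seq_mul.
Proof. by move=> x y z; apply/funext => i; rewrite /seq_mul sa_mulA. Qed.
Let seq1l : left_id (fun=> one) seq_mul.
Proof. by move=> x; apply/funext => i; rewrite /seq_mul sa_mul1l. Qed.
Let seq1r : right_id (fun=> one) seq_mul.
Proof. by move=> x; apply/funext => i; rewrite /seq_mul sa_mul1r. Qed.

Definition completion_subquotient : @subquotient R[i] (nat -> B) :=
  Subquotient seq_bil seqA seq1l seq1r (@cauchy_cst one) cauchy_linear
    cauchy_mul null0 null_linear null_mull null_mulr null1.

Definition completion := subquot completion_subquotient.
HB.instance Definition _ := GRing.Algebra.on completion.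

Definition cpi (x : nat -> B) : completion := sq_pi completion_subquotient x.
Definition completion_map (b : B) : completion := cpi (fun=> b).

Lemma cpi_surj (a : completion) : exists2 x, cauchy_for x & a = cpi x.
Proof. exact: (@sq_pi_surj _ _ completion_subquotient a). Qed.

Lemma cpi_eq x y : cauchy_for x -> cauchy_for y ->
  cpi x = cpi y <-> null_for (x - y).
Proof. exact: (@sq_pi_eq _ _ completion_subquotient). Qed.

Lemma cpiD x y : cauchy_for x -> cauchy_for y -> cpi (x + y) = cpi x + cpi y.
Proof. exact: (@sq_piD _ _ completion_subquotient). Qed.
Lemma cpiZ k x : cauchy_for x -> cpi (k *: x) = k *: cpi x.
Proof. exact: (@sq_piZ _ _ completion_subquotient). Qed.
Lemma cpiM x y : cauchy_for x -> cauchy_for y ->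
  cpi (seq_mul x y) = cpi x * cpi y.
Proof. exact: (@sq_piM _ _ completion_subquotient). Qed.

Lemma completion_map_linear : linear completion_map.
Proof.
move=> k a b; rewrite /completion_map -cpiZ; last exact: cauchy_cst.
rewrite -cpiD //; last exact: cauchy_cst.
by have := cauchy_linear k (cauchy_cst a) (cauchy_cst 0); rewrite addr0.
Qed.

Lemma completion_map1 : completion_map one = 1.
Proof. by []. Qed.

Lemma completion_mapM a b :
  completion_map (mul a b) = completion_map a * completion_map b.
Proof. by rewrite /completion_map -cpiM //; exact: cauchy_cst. Qed.

End Completion.

Section RealSequences.
Variable R : realType.
Implicit Types (s : nat -> R).

Lemma eventuallyP (P : nat -> Prop) :
  (\forall i \near \oo, P i) <-> exists k, forall i, (k <= i)%N -> P i.
Proof.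
by split=> [[k _ hk]|[k hk]]; exists k.
Qed.

Lemma real_cvgP s (l : R) : (s i @[i --> \oo] --> l) <->
  forall e, 0 < e -> exists k, forall i, (k <= i)%N -> `|s i - l| < e.
Proof.
split=> [/cvgrPdist_lt h e e0|h].
  have /eventuallyP[k hk] := h e e0.
  by exists k => i ki; rewrite distrC hk.
apply/cvgrPdist_lt => e e0; apply/eventuallyP; have [k hk] := h e e0.
by exists k => i ki; rewrite distrC hk.
Qed.

Lemma real_cauchy s :
  (forall e, 0 < e -> exists k, forall i j, (k <= i)%N -> (k <= j)%N ->
     `|s i - s j| < e) ->
  exists l : R, s i @[i --> \oo] --> l.
Proof.
move=> h; have : cvg (s i @[i --> \oo]).
  apply/cauchy_cvgP/cauchy_exP => e e0; have [k hk] := h e e0.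
  exists (s k); apply/eventuallyP; exists k => i ki /=.
  by rewrite -ball_normE /= hk.
by move=> hc; exists (lim (s i @[i --> \oo])).
Qed.

Lemma inv_small (e : R) : 0 < e -> exists k, forall i, (k <= i)%N -> i.+1%:R^-1 < e.
Proof.
by move=> e0; apply/eventuallyP; exact: (near_infty_natSinv_lt (PosNum e0)).
Qed.

End RealSequences.

Section CompletionNorm.
Variables (R : realType) (B : lmodType R[i]) (S : star_alg B) (p : B -> R).
Hypothesis hp : cstar_seminorm S p.
Hypothesis p1 : p (sa_one S) != 0.
Local Notation mul := (sa_mul S).
Local Notation one := (sa_one S).
Local Notation st := (sa_star S).
Local Notation A := (completion hp p1).
Local Notation pi := (cpi hp p1).
Local Notation cauchy := (cauchy_for p).
Local Notation null := (null_for p).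
Local Notation j := (completion_map hp p1).
Implicit Types x y : nat -> B.

(** The limit exists, as the norms of a Cauchy sequence form a Cauchy sequence. *)
Definition cnorm (a : A) : R := lim (p (sq_repr a i) @[i --> \oo]).

Let cauchy_cvg_norm x : cauchy x -> exists l : R, p (x i) @[i --> \oo] --> l.
Proof.
move=> hx; apply: real_cauchy => e /hx[k hk]; exists k => i l ki kl.
exact: le_lt_trans (cs_dist hp _ _) (hk _ _ ki kl).
Qed.

Lemma cnormE x : cauchy x -> p (x i) @[i --> \oo] --> cnorm (pi x).
Proof.
move=> hx; rewrite /cnorm; set y := sq_repr _.
have hy : cauchy y by exact: (sq_repr_dom (pi x)).
have hxy : null (x - y) by exact: (@sq_repr_pi _ _ (completion_subquotient hp p1)).
have [l hl] := cauchy_cvg_norm hy.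
rewrite (cvg_lim _ hl) //; apply/real_cvgP => e e0.
have e20 : 0 < e / 2 by rewrite divr_gt0.
have /real_cvgP/(_ _ e20)[k1 h1] := hl; have [k2 h2] := hxy _ e20.
exists (maxn k1 k2) => i; rewrite geq_max => /andP[i1 i2].
have := h1 _ i1; have := h2 _ i2 => /(le_lt_trans (cs_dist hp _ _)).
rewrite !ltr_norml => /andP[? ?] /andP[? ?]; apply/andP; split; lra.
Qed.

Lemma cnorm_le x c k : cauchy x ->
  (forall i, (k <= i)%N -> p (x i) <= c) -> cnorm (pi x) <= c.
Proof.
move=> hx h; apply: (ler_cvg_to (cnormE hx) (cvg_cst c)).
by apply/eventuallyP; exists k.
Qed.

Lemma cnorm_map b : cnorm (j b) = p b.
Proof.
have h := cnormE (cauchy_cst hp b).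
exact: (cvg_unique _ h (cvg_cst (p b))).
Qed.

Definition cstar (a : A) : A := pi (fun i => st (sq_repr a i)).

Lemma cauchy_star x : cauchy x -> cauchy (fun i => st (x i)).
Proof.
move=> hx e /hx[k hk]; exists k => i l ki kl; rewrite -scaleN1r.
have -> : -1 = Num.conj (-1 : R[i]) by rewrite rmorphN1.
by rewrite -sa_starZ -sa_starD (cs_isom hp) scaleN1r hk.
Qed.

Lemma cstarE x : cauchy x -> cstar (pi x) = pi (fun i => st (x i)).
Proof.
move=> hx; rewrite /cstar; set y := sq_repr _.
have hy : cauchy y by exact: (sq_repr_dom (pi x)).
have hxy : null (x - y) by exact: (@sq_repr_pi _ _ (completion_subquotient hp p1)).
apply/cpi_eq; [exact: cauchy_star|exact: cauchy_star|].
move=> e /hxy[k hk]; exists k => i /hk; rewrite !fctE -[- st _]scaleN1r.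
have -> : -1 = Num.conj (-1 : R[i]) by rewrite rmorphN1.
by rewrite -sa_starZ -sa_starD (cs_isom hp) scaleN1r (cs_subC hp).
Qed.

Lemma cstar_map b : cstar (j b) = j (st b).
Proof. exact: (cstarE (cauchy_cst hp b)). Qed.

Let cl := cauchy_linear hp.
Let cD x y : cauchy x -> cauchy y -> cauchy (x + y).
Proof. by move=> hx hy; have := cl 1 hx hy; rewrite scale1r. Qed.
Let cZ k x : cauchy x -> cauchy (k *: x).
Proof. by move=> hx; rewrite -[k *: x]addr0; exact: (cl k hx (cauchy_cst hp 0)). Qed.
Let cN x : cauchy x -> cauchy (- x).
Proof. by rewrite -scaleN1r; apply: cZ. Qed.
Let piN x : cauchy x -> pi (- x) = - pi x.
Proof. by move=> hx; rewrite -[- x]scaleN1r (cpiZ hp p1 _ hx) scaleN1r. Qed.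
Let cM x y : cauchy x -> cauchy y -> cauchy (seq_mul S x y).
Proof. exact: cauchy_mul. Qed.
Let cS x : cauchy x -> cauchy (fun i => st (x i)).
Proof. exact: cauchy_star. Qed.

Lemma cstar_involution : involution cstar.
Proof.
split=> [a b|k a|a b||a].
- have [{}a ha ->] := cpi_surj a; have [{}b hb ->] := cpi_surj b.
  rewrite -(cpiD hp p1 ha hb) (cstarE (cD ha hb)) (cstarE ha) (cstarE hb).
  rewrite -(cpiD hp p1 (cS ha) (cS hb)).
  by congr pi; apply/funext => i; rewrite /= fctE sa_starD.
- have [{}a ha ->] := cpi_surj a.
  rewrite -(cpiZ hp p1 k ha) (cstarE (cZ k ha)) (cstarE ha).
  rewrite -(cpiZ hp p1 _ (cS ha)).
  by congr pi; apply/funext => i; rewrite /= !fctE sa_starZ.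
- have [{}a ha ->] := cpi_surj a; have [{}b hb ->] := cpi_surj b.
  rewrite -(cpiM hp p1 ha hb) (cstarE (cM ha hb)) (cstarE ha) (cstarE hb).
  rewrite -(cpiM hp p1 (cS hb) (cS ha)).
  by congr pi; apply/funext => i; rewrite /= /seq_mul sa_starM.
- by rewrite -(completion_map1 hp p1) cstar_map sa_star1.
- have [{}a ha ->] := cpi_surj a; rewrite (cstarE ha) (cstarE (cS ha)).
  by congr pi; apply/funext => i; rewrite sa_starK.
Qed.

Lemma cnorm_cstar_norm : cstar_norm cstar cnorm.
Proof.
split; first split=> [a|a].
- have [{}a ha ->] := cpi_surj a; apply: (ler_cvg_to (cvg_cst 0) (cnormE ha)).
  by apply/eventuallyP; exists 0 => i _; apply: cs_ge0 hp _.
- have [{}a ha ->] := cpi_surj a => a0.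
  have -> : (0 : A) = pi (fun=> 0) by [].
  apply/cpi_eq => //; first exact: (cauchy_cst hp 0).
  have := cnormE ha; rewrite a0 => /real_cvgP h e e0.
  have [k hk] := h e e0; exists k => i /hk.
  by rewrite !fctE !subr0 ger0_norm // (cs_ge0 hp).
- move=> a b; have [{}a ha ->] := cpi_surj a; have [{}b hb ->] := cpi_surj b.
  rewrite -(cpiD hp p1 ha hb).
  apply: (ler_cvg_to (cnormE (cD ha hb)) (cvgD (cnormE ha) (cnormE hb))).
  by apply/eventuallyP; exists 0 => i _; apply: cs_add hp _ _.
- move=> k a; have [{}a ha ->] := cpi_surj a.
  rewrite -(cpiZ hp p1 k ha); apply: (cvg_unique _ (cnormE (cZ k ha))) => //.
  have -> : (fun i => p ((k *: a) i)) = (fun i => cmod k * p (a i)).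
    by apply/funext => i; rewrite (cs_scale hp).
  exact: (cvgM (cvg_cst (cmod k)) (cnormE ha)).
- move=> a b; have [{}a ha ->] := cpi_surj a; have [{}b hb ->] := cpi_surj b.
  rewrite -(cpiM hp p1 ha hb).
  apply: (ler_cvg_to (cnormE (cM ha hb)) (cvgM (cnormE ha) (cnormE hb))).
  by apply/eventuallyP; exists 0 => i _; apply: cs_mul hp _ _.
- move=> a; have [{}a ha ->] := cpi_surj a.
  rewrite (cstarE ha) -(cpiM hp p1 (cS ha) ha).
  apply: (cvg_unique _ (cnormE (cM (cS ha) ha))) => //.
  have -> : (fun i => p (seq_mul S (fun i => st (a i)) a i)) = (fun i => p (a i) * p (a i)).
    by apply/funext => i; rewrite /seq_mul (cs_star hp) expr2.
  exact: (cvgM (cnormE ha) (cnormE ha)).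
Qed.

Lemma completion_dense (a : A) e : 0 < e -> exists b, cnorm (a - j b) < e.
Proof.
have [{}a ha ->] := cpi_surj a => e0; have e20 : 0 < e / 2 by rewrite divr_gt0.
have [k hk] := ha _ e20; exists (a k); have cc := cN (cauchy_cst hp (a k)).
have -> : pi a - j (a k) = pi (a - (fun=> a k)).
  by rewrite (cpiD hp p1 ha cc) (piN (cauchy_cst hp (a k))).
apply: (le_lt_trans (y := e / 2)); last by rewrite ltr_pdivrMr // ltr_pMr // ltr1n.
apply: (cnorm_le (k := k)); first exact: (cD ha cc).
by move=> i ki; apply: ltW; apply: hk.
Qed.

(** A Cauchy sequence in the completion is approximated by elements of [B], which
form a Cauchy sequence and so define its limit. *)
Lemma completion_complete : complete_norm cnorm.
Proof.
have hn := cstar_norm_seminorm cstar_involution cnorm_cstar_norm.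
move=> a ha.
have hb i : exists b, cnorm (a i - j b) < i.+1%:R^-1.
  by apply: completion_dense; rewrite invr_gt0.
pose b i := projT1 (cid (hb i)).
have bE i : cnorm (a i - j (b i)) < i.+1%:R^-1 := projT2 (cid (hb i)).
have jB c d : j (c - d) = j c - j d.
  exact: linB (completion_map_linear hp p1) c d.
have cb : cauchy b.
  move=> e e0; have e30 : 0 < e / 3 by rewrite divr_gt0.
  have [k1 h1] := ha _ e30; have [k2 h2] := inv_small e30.
  exists (maxn k1 k2) => i l; rewrite !geq_max => /andP[i1 i2] /andP[l1 l2].
  rewrite -cnorm_map jB.
  apply: (cs_lt4 hn (b := a i) (c := a l)); last 1 first.
  - exact: lt_trans (bE l) (h2 _ l2).
  - exact: lt_trans (bE i) (h2 _ i2).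
  - exact: h1.
exists (pi b) => e e0; have e20 : 0 < e / 2 by rewrite divr_gt0.
have [k1 h1] := cb _ e20; have [k2 h2] := inv_small e20.
exists (maxn k1 k2) => i; rewrite !geq_max => /andP[i1 i2].
apply: (cs_lt3 hn (b := j (b i))); first exact: lt_trans (bE i) (h2 _ i2).
have cc := cauchy_cst hp (b i).
have -> : j (b i) - pi b = pi ((fun=> b i) - b).
  by rewrite (cpiD hp p1 cc (cN cb)) (piN cb).
apply: (cnorm_le (k := k1)); first exact: (cD cc (cN cb)).
by move=> l kl; apply: ltW; apply: h1.
Qed.

Lemma completion_cstar_algebra : cstar_algebra cstar cnorm.
Proof.
by split; [exact: cstar_involution|exact: cnorm_cstar_norm|
  exact: completion_complete].
Qed.

Lemma completion_dense_isometry : dense_isometry p cnorm j.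
Proof. by split=> [b|a e]; [exact: cnorm_map|exact: completion_dense]. Qed.

End CompletionNorm.

(** * Positive elements of a C*-algebra *)

Section Positivity.
Variables (R : realType) (A : algType R[i]) (st : A -> A) (N : A -> R).
Hypothesis hA : cstar_algebra st N.
Local Notation C := R[i].
Implicit Types a b c d h x y : A.

Let hst : involution st. Proof. by case: hA. Qed.
Let hcs : cstar_norm st N. Proof. by case: hA. Qed.
Let hn := cstar_norm_seminorm hst hcs.

Let stD a b : st (a + b) = st a + st b. Proof. by case: hst. Qed.
Let stZ k a : st (k *: a) = Num.conj k *: st a. Proof. by case: hst. Qed.
Let stM a b : st (a * b) = st b * st a. Proof. by case: hst. Qed.
Let st1 : st 1 = 1. Proof. by case: hst. Qed.
Let stK a : st (st a) = a. Proof. by case: hst. Qed.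
Let stN a : st (- a) = - st a.
Proof. by rewrite -scaleN1r stZ rmorphN1 scaleN1r. Qed.

Let N_ge0 a : 0 <= N a. Proof. by case: hcs => -[]. Qed.
Let N_eq0 a : N a = 0 -> a = 0. Proof. by case: hcs => -[_ h] *; apply: h. Qed.
Let ND a b : N (a + b) <= N a + N b. Proof. by case: hcs. Qed.
Let NZ k a : N (k *: a) = cmod k * N a. Proof. by case: hcs. Qed.
Let NM a b : N (a * b) <= N a * N b. Proof. by case: hcs. Qed.
Let NS a : N (st a * a) = N a ^+ 2. Proof. by case: hcs. Qed.
Let Nst a : N (st a) = N a. Proof. exact: (cs_isom hn). Qed.
Let N0 : N 0 = 0. Proof. exact: (cs0 hn). Qed.
Let NB a b : N (a - b) <= N a + N b. Proof. exact: (cs_sub hn). Qed.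
Let NBC a b : N (a - b) = N (b - a). Proof. exact: (cs_subC hn). Qed.
Let Ntr a b c : N (a - c) <= N (a - b) + N (b - c). Proof. exact: (cs_trans hn). Qed.
Let N1 : N 1 = 1.
Proof.
by case: (cs_one hn) => // /N_eq0/eqP; rewrite oner_eq0.
Qed.

Definition selfadjoint a := st a = a.

Let N_sq a : selfadjoint a -> N (a * a) = N a ^+ 2.
Proof. by move=> sa; rewrite -{1}sa NS. Qed.

Lemma selfadjoint_sq_eq0 a : selfadjoint a -> a * a = 0 -> a = 0.
Proof.
move=> sa /(congr1 N); rewrite N_sq // N0 => /eqP.
by rewrite expf_eq0 /= => /eqP/N_eq0.
Qed.

Lemma small_eq0 a (c : R) : (forall e, 0 < e -> N a <= c * e) -> a = 0.
Proof.
move=> h; apply/N_eq0/eqP; rewrite eq_le N_ge0 andbT leNgt; apply/negP => a0.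
have c0 : 0 < 2 * (`|c| + 1) by rewrite mulr_gt0 // ltr_wpDl.
have := h _ (divr_gt0 a0 c0).
have -> : c * (N a / (2 * (`|c| + 1))) = (c / (`|c| + 1)) * (N a / 2).
  by field; rewrite gt_eqF // ltr_wpDl.
have h1 : c / (`|c| + 1) <= 1.
  by rewrite ler_pdivrMr ?ltr_wpDl // mul1r (le_trans (ler_norm c)) // lerDl.
have h2 : (c / (`|c| + 1)) * (N a / 2) <= 1 * (N a / 2).
  by rewrite ler_wpM2r // divr_ge0.
by move=> h3; move: h2 h3 a0; lra.
Qed.

Let sqB a b : a * a - b * b = (a - b) * a + b * (a - b).
Proof. by rewrite mulrBl mulrBr addrA subrK. Qed.

Let sq_diff a b :
  (a + b) * (a + b) - (a - b) * (a - b) = (2 : C) *: (b * a + a * b).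
Proof.
have e : a + b - (a - b) = (2 : C) *: b.
  by rewrite opprB addrC addrA subrK scaler_nat mulr2n.
rewrite sqB e -scalerAl -scalerAr -scalerDr mulrDr mulrBl; congr (_ *: _).
by rewrite [a * b - _]addrC addrA addrK.
Qed.

Section SquareRoot.
Variable k : A.
Hypotheses (sk : selfadjoint k) (Nk : N k <= 1).

(** If [y = (k + y * y) / 2], then [1 - y] is a root of [1 - k].  The bounds are
the same iteration for the number 1 in place of [k]. *)
Fixpoint sqrt_iter n : A :=
  if n is n'.+1 then 2^-1 *: (k + sqrt_iter n' * sqrt_iter n') else 0.
Fixpoint sqrt_bound n : R :=
  if n is n'.+1 then (1 + sqrt_bound n' * sqrt_bound n') / 2 else 0.

Local Notation y := sqrt_iter.
Local Notation t := sqrt_bound.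

Let t01 n : 0 <= t n <= 1.
Proof.
elim: n => [|n /andP[h0 h1]] /=; first by rewrite lexx ler01.
have := mulr_ge0 h0 h0; have := mulr_ile1 h0 h0 h1 h1.
by move=> *; apply/andP; split; lra.
Qed.

Let yt n : N (y n) <= t n.
Proof.
elim: n => [|n IH] /=; first by rewrite N0.
rewrite NZ cmod_half mulrC ler_pM2r ?invr_gt0 // (le_trans (ND _ _)) // lerD //.
by rewrite (le_trans (NM _ _)) // ler_pM.
Qed.

Let yd n : N (y n.+1 - y n) <= t n.+1 - t n.
Proof.
elim: n => [|n IH].
  by rewrite /= !mulr0 !subr0 addr0 NZ cmod_half; move: Nk; lra.
have -> : y n.+2 - y n.+1
    = 2^-1 *: ((y n.+1 - y n) * y n.+1 + y n * (y n.+1 - y n)).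
  rewrite -sqB -[RHS]add0r -(scaler0 _ 2^-1) -scalerDr -(subrr k) addrACA -opprD.
  by rewrite scalerBr.
have -> : t n.+2 - t n.+1
    = 2^-1 * ((t n.+1 - t n) * t n.+1 + t n * (t n.+1 - t n)).
  transitivity ((1 + t n.+1 * t n.+1) / 2 - (1 + t n * t n) / 2) => //.
  by move: (t n.+1) => s; field.
rewrite NZ cmod_half ler_pM2l ?invr_gt0 // (le_trans (ND _ _)) // lerD //.
  by rewrite (le_trans (NM _ _)) // ler_pM.
by rewrite (le_trans (NM _ _)) // ler_pM.
Qed.

Let ymono n m : N (y (n + m) - y n) <= t (n + m) - t n.
Proof.
elim: m => [|m IH]; first by rewrite addn0 !subrr N0.
rewrite addnS; have := Ntr (y (n + m).+1) (y (n + m)) (y n).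
have := yd (n + m); move: IH; lra.
Qed.

Let t_cauchy e : 0 < e -> exists k, forall i j, (k <= i)%N -> (k <= j)%N ->
  `|t i - t j| < e.
Proof.
move=> e0.
have tS n m : t n <= t (n + m).
  by have := le_trans (N_ge0 _) (ymono n m); rewrite subr_ge0.
have : cvg (t i @[i --> \oo]).
  apply: nondecreasing_is_cvgn => [i j ij|]; first by rewrite -(subnKC ij).
  by exists 1 => _ [i _ <-]; case/andP: (t01 i).
move=> /cvg_ex[l /real_cvgP/(_ (e / 2))[]]; first by rewrite divr_gt0.
move=> k' hk; exists k' => i j /hk hi /hk hj.
by move: hi hj; rewrite !ltr_norml => /andP[? ?] /andP[? ?]; apply/andP; split; lra.
Qed.

Let y_lim : exists l, forall e, 0 < e -> exists k, forall i, (k <= i)%N -> N (y i - l) < e.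
Proof.
case: hA => _ _; apply=> e /t_cauchy[k' hk]; exists k'.
have hle i j : (k' <= i)%N -> (i <= j)%N -> N (y j - y i) < e.
  move=> ki ij; apply: le_lt_trans (hk _ _ (leq_trans ki ij) ki).
  by rewrite -(subnKC ij) (le_trans (ymono _ _)) // ler_norm.
move=> i j ki kj; have [ij|/ltnW ji] := leqP i j; last exact: hle.
by rewrite NBC hle.
Qed.

(** The steps of [sqrt_iter] are bounded by those of [sqrt_bound], which is
increasing and bounded by 1; so the iteration converges, to [1 - c]. *)
Lemma sqrt_one_sub : exists c, [/\ selfadjoint c, c * c = 1 - k,
  forall b, b * k = k * b -> b * c = c * b & N (1 - c) <= 1].
Proof.
have [l hl] := y_lim.
have l_near e : 0 < e -> exists2 n, N (y n - l) < e & N (y n.+1 - l) < e.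
  by move=> /hl[n hn']; exists n; apply: hn'.
have Nl : N l <= 1.
  apply/ler_addgt0Pr => e /l_near[n hn' _].
  have := cs_add hn (l - y n) (y n); rewrite subrK NBC.
  have := yt n; have := t01 n; move=> /andP[_ h1] h2 h3.
  by move: hn' h1 h2 h3; lra.
have sl : st l = l.
  apply/eqP; rewrite -subr_eq0; apply/eqP/(small_eq0 (c := 2)) => e /l_near[n h _].
  have sy : st (y n) = y n.
    elim: n {h} => [|n IH] /=; first by rewrite -(scale0r (0 : A)) stZ rmorph0 !scale0r.
    by rewrite stZ stD stM IH sk fmorphV rmorph_nat.
  have e1 : N (st l - y n) = N (y n - l) by rewrite -[in LHS]sy -stN -stD Nst NBC.
  by have := Ntr (st l) (y n) l; rewrite e1; move: h; lra.
have cl b : b * k = k * b -> b * l = l * b.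
  move=> bk; apply/eqP; rewrite -subr_eq0; apply/eqP/(small_eq0 (c := 2 * N b)).
  move=> e /l_near[n h _].
  have by_ : b * y n = y n * b.
    elim: n {h} => [|n IH] /=; first by rewrite mulr0 mul0r.
    rewrite -scalerAr -scalerAl mulrDr mulrDl bk; congr (_ *: (_ + _)).
    by rewrite mulrA IH -mulrA IH mulrA.
  have -> : b * l - l * b = (y n - l) * b - b * (y n - l).
    by rewrite mulrBl mulrBr by_ opprB [RHS]addrC subrKA.
  have := NB ((y n - l) * b) (b * (y n - l)).
  have := NM (y n - l) b; have := NM b (y n - l).
  have := ler_wpM2l (N_ge0 b) (ltW h); lra.
have fl : l = 2^-1 *: (k + l * l).
  apply/eqP; rewrite -subr_eq0; apply/eqP/(small_eq0 (c := 2)) => e /l_near[n h h'].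
  have e1 : y n.+1 - 2^-1 *: (k + l * l)
      = 2^-1 *: ((y n - l) * y n + l * (y n - l)).
    by rewrite -sqB -scalerBr opprD addrACA subrr add0r.
  have := Ntr l (y n.+1) (2^-1 *: (k + l * l)).
  rewrite e1 NZ cmod_half (NBC l (y n.+1)); have := ND ((y n - l) * y n) (l * (y n - l)).
  have /andP[_ tn1] := t01 n.
  have h1 := le_trans (NM (y n - l) (y n)) (ler_wpM2l (N_ge0 _) (le_trans (yt n) tn1)).
  have h2 := le_trans (NM l (y n - l)) (ler_wpM2r (N_ge0 _) Nl).
  by move: h h' h1 h2; lra.
exists (1 - l); split.
- by rewrite /selfadjoint stD stN st1 sl.
- have ll : l * l = l + l - k.
    rewrite {3 4}fl -scalerDl -mulr2n -[_ *+ 2]mulr_natl divff ?pnatr_eq0 //.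
    by rewrite scale1r addrC addKr.
  have e : l - l * l = k - l by rewrite ll opprB addrCA; congr (_ + _); rewrite opprD addrA subrr add0r.
  by rewrite mulrBl mul1r mulrBr mulr1 e opprB addrA subrK.
- by move=> b /cl bl; rewrite mulrBr mulrBl mulr1 mul1r bl.
- by rewrite opprB addrC subrK.
Qed.

End SquareRoot.

Local Notation "r %:r" := (r%:C%C : C) (at level 2).

Let saZ (r : R) a : selfadjoint a -> selfadjoint (r%:r *: a).
Proof. by move=> sa; rewrite /selfadjoint stZ conj_real sa. Qed.
Let saD a b : selfadjoint a -> selfadjoint b -> selfadjoint (a + b).
Proof. by move=> sa sb; rewrite /selfadjoint stD sa sb. Qed.
Let saN a : selfadjoint a -> selfadjoint (- a).
Proof. by move=> sa; rewrite /selfadjoint stN sa. Qed.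
Let sa1 : selfadjoint 1. Proof. exact: st1. Qed.
Let saM a b : selfadjoint a -> selfadjoint b -> a * b = b * a -> selfadjoint (a * b).
Proof. by move=> sa sb ab; rewrite /selfadjoint stM sa sb. Qed.

Let NrZ (r : R) a : 0 <= r -> N (r%:r *: a) = r * N a.
Proof. by move=> r0; rewrite NZ cmod_real ger0_norm. Qed.

(** A root [d] of [h] that is itself positive, in the sense of the norm
criterion, and lies in the bicommutant of [h]. *)
Definition positive_root h d := [/\ selfadjoint d, d * d = h,
  forall b, b * h = h * b -> b * d = d * b
  & exists2 t : R, 0 < t & N (t%:r *: 1 - d) <= t].

Definition positive h := exists d, positive_root h d.

(** After division by [t], this is the root of [1 - k] with
[k = 1 - h / t]. *)
Lemma norm_positive (t : R) h : 0 < t -> selfadjoint h ->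
  N (t%:r *: 1 - h) <= t -> positive h.
Proof.
move=> t0 sh Nh; pose k := 1 - t^-1%:r *: h.
have tt : t^-1%:r * t%:r = 1 by rewrite -rmorphM mulVf ?gt_eqF.
have ek : k = t^-1%:r *: (t%:r *: 1 - h) by rewrite scalerBr scalerA tt scale1r.
have sk : selfadjoint k by apply/saD => //; apply/saN/saZ.
have Nk : N k <= 1.
  by rewrite ek NrZ ?invr_ge0 ?(ltW t0) // ler_pdivrMl // mulr1.
have [c [sc cc cb Nc]] := sqrt_one_sub sk Nk.
pose s := Num.sqrt t; have s0 : 0 < s by rewrite sqrtr_gt0.
have ss : s%:r * s%:r = t%:r by rewrite -rmorphM -expr2 sqr_sqrtr // ltW.
exists (s%:r *: c); split.
- exact: saZ.
- rewrite -scalerAl -scalerAr scalerA ss cc /k opprB addrC subrK scalerA.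
  by rewrite mulrC tt scale1r.
- move=> b bh; rewrite -scalerAr -scalerAl cb // /k mulrBr mulrBl mulr1 mul1r.
  by rewrite -scalerAr -scalerAl bh.
by exists s => //; rewrite -scalerBr NrZ ?(ltW s0) // ler_piMr // ltW.
Qed.

Let iC : C := 'i.
Let ii : iC * iC = -1. Proof. by rewrite /iC mulCii. Qed.
Let ci : Num.conj iC = - iC. Proof. by rewrite /iC conjCi. Qed.

Let cart_sq a b : selfadjoint a -> selfadjoint b -> a * b = b * a ->
  st (a + iC *: b) * (a + iC *: b) = a * a + b * b.
Proof.
move=> sa sb ab; rewrite stD stZ ci sa sb mulrDl !mulrDr -!scalerAr -!scalerAl.
by rewrite scalerA mulrN ii opprK scale1r ab scaleNr addrA addrK.
Qed.

Let re_half a b : selfadjoint a -> selfadjoint b ->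
  a = 2^-1 *: ((a + iC *: b) + st (a + iC *: b)).
Proof.
move=> sa sb; rewrite stD stZ ci sa sb scaleNr addrACA subrr addr0 -mulr2n.
by rewrite -[a *+ 2]scaler_nat scalerA mulVf ?pnatr_eq0 // scale1r.
Qed.

(** The C*-identity for [a + ib], of which [a] is the real part. *)
Let cart_norm a b : selfadjoint a -> selfadjoint b -> a * b = b * a ->
  N a ^+ 2 <= N (a * a + b * b).
Proof.
move=> sa sb ab; rewrite -(cart_sq sa sb ab) NS ler_sqr ?nnegrE //.
rewrite {1}(re_half sa sb) NZ cmod_half mulrC ler_pdivrMr //.
by have := ND (a + iC *: b) (st (a + iC *: b)); rewrite Nst mulrDr mulr1.
Qed.

(** If [1 - k * k = c * c], then [cart_norm] bounds [c] by the norm of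
[c * c + k * k = 1]. *)
Let unit_square_norm k : selfadjoint k -> N k <= 1 -> N (1 - k * k) <= 1.
Proof.
move=> sk Nk; have Nkk : N (k * k) <= 1 by rewrite N_sq // expr_le1.
have [c [sc cc cb _]] := sqrt_one_sub (saM sk sk erefl) Nkk.
have ck : c * k = k * c by rewrite cb // mulrA.
rewrite -cc N_sq //; apply: le_trans (cart_norm sc sk ck) _.
by rewrite cc subrK N1.
Qed.

Let square_norm d : selfadjoint d ->
  exists2 t : R, 0 < t & N (t%:r *: 1 - d * d) <= t.
Proof.
move=> sd; pose s : R := N d + 1.
have s0 : 0 < s by rewrite ltr_wpDl.
have ss : s^-1%:r * s%:r = 1 by rewrite -rmorphM mulVf ?gt_eqF.
exists (s * s); rewrite ?mulr_gt0 //; pose k := s^-1%:r *: d.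
have ed : d = s%:r *: k by rewrite /k scalerA mulrC ss scale1r.
have Nk : N k <= 1.
  by rewrite /k NrZ ?invr_ge0 ?(ltW s0) // ler_pdivrMl // mulr1 lerDl.
rewrite ed -scalerAl -scalerAr scalerA -rmorphM -scalerBr NrZ ?mulr_ge0 ?(ltW s0) //.
rewrite ler_piMr ?mulr_ge0 ?(ltW s0) //; apply: unit_square_norm => //.
exact: saZ.
Qed.

Lemma positive_square d : selfadjoint d -> positive (d * d).
Proof.
move=> sd; have [t t0] := square_norm sd.
by apply: norm_positive t0 _; apply: saM.
Qed.

Lemma positiveP h : positive h -> exists2 t : R, 0 < t & N (t%:r *: 1 - h) <= t.
Proof. by move=> [d [sd <- _ _]]; apply: square_norm. Qed.

Let positive_sa h : positive h -> selfadjoint h.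
Proof. by move=> [d [sd <- _ _]]; apply: saM. Qed.

(** The norm criterion of [norm_positive] is stable under sums. *)
Lemma positiveD h g : positive h -> positive g -> positive (h + g).
Proof.
move=> ph pg; have [t t0 ht] := positiveP ph; have [s s0 hs] := positiveP pg.
apply: (@norm_positive (t + s)); first exact: addr_gt0.
  by apply: saD; apply: positive_sa.
rewrite rmorphD scalerDl opprD addrACA (le_trans (ND _ _)) //.
exact: lerD.
Qed.

(** The roots [a] and [b] of [h] and [g = - h] commute, as [b] lies in the
bicommutant of [g]; then [cart_norm] bounds [a] by [a * a + b * b = 0]. *)
Lemma positive_add_eq0 h g : positive h -> positive g -> h + g = 0 -> h = 0.
Proof.
move=> [a [sa <- _ _]] [b [sb eb bb _]] hg.
have ab : a * b = b * a.
  apply: bb; have -> : g = - (a * a) by apply/eqP; rewrite -addr_eq0 addrC hg.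
  by rewrite mulrN mulNr mulrA.
have := cart_norm sa sb ab; rewrite eb hg N0 => h1.
have /eqP : N a ^+ 2 = 0 by apply/eqP; rewrite eq_le h1 sqr_ge0.
by rewrite expf_eq0 /= => /eqP/N_eq0 ->; rewrite mul0r.
Qed.

(** Let [z = c (st w)].  Then [(st z) z = - l^2], where [l = w (st w)], and
[z (st z) = - c^4], while the sum of these two products is twice the sum of the
squares of the real and imaginary parts of [z].  So a sum of positive elements
including [c^4] is zero. *)
Lemma neg_square_eq0 w c : selfadjoint c -> st w * w = - (c * c) -> c = 0.
Proof.
move=> sc ww; pose z := c * st w; pose l := w * st w.
have sl : selfadjoint l by rewrite /selfadjoint /l stM stK.
have stz : st z = w * c by rewrite /z stM stK sc.
have z1 : st z * z = - (l * l).
  rewrite stz /z mulrA -(mulrA w c c) -[c * c]opprK -ww mulrN mulNr /l.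
  by rewrite !mulrA.
have z2 : z * st z = - ((c * c) * (c * c)).
  by rewrite stz /z mulrA -(mulrA c _ w) ww mulrN !mulNr !mulrA.
pose a := 2^-1 *: (z + st z); pose b := (2^-1 * - iC) *: (z - st z).
have c2 : Num.conj (2^-1 : C) = 2^-1 by rewrite fmorphV rmorph_nat.
have sa : selfadjoint a by rewrite /selfadjoint /a stZ c2 stD stK addrC.
have sb : selfadjoint b.
  rewrite /selfadjoint /b stZ rmorphM /= c2 rmorphN /= ci opprK stD stN stK.
  by rewrite -opprB scalerN mulrN scaleNr.
have ab : (a * a + b * b) + (a * a + b * b) = st z * z + z * st z.
  rewrite /a /b -!scalerAl -!scalerAr !scalerA.
  have -> : 2^-1 * - iC * (2^-1 * - iC) = - (2^-1 * 2^-1).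
    by rewrite mulrN mulNr mulrN opprK mulrACA ii mulrN1.
  rewrite scaleNr -scalerBr -mulr2n -[_ *+ 2]scaler_nat scalerA.
  rewrite sq_diff.
  by rewrite scalerA mulrA divff ?pnatr_eq0 // mul1r mulVf ?pnatr_eq0 // scale1r.
have pa := positive_square sa; have pb := positive_square sb.
have pcc := positive_square (saM sc sc erefl).
have : c * c * (c * c) = 0.
  apply: (positive_add_eq0 pcc (positiveD (positiveD pa pb)
    (positiveD (positiveD pa pb) (positive_square sl)))).
  rewrite [X in _ + X]addrA ab z1 z2 addrAC addNr add0r addrN //.
by move/(selfadjoint_sq_eq0 (saM sc sc erefl))/(selfadjoint_sq_eq0 sc).
Qed.

(** Let [h = st x * x] and let [s] be the positive root of [h * h]; it has to be
shown that [q = s - h] vanishes.  As [h * q = - (s * q)], the element [w = x * q]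
satisfies [st w * w = - (e * q) ^ 2], where [e] is a root of [s].  Hence
[e * q = 0], so [q * s] and [q * h] are zero, and [q * q = 0]. *)
Lemma star_square_positive x : positive (st x * x).
Proof.
set h := st x * x; have sh : selfadjoint h by rewrite /selfadjoint /h stM stK.
have [s [ss shh sb [t t0 Nt]]] := positive_square sh.
have [e [se ee eb _]] := norm_positive t0 ss Nt.
have hs : h * s = s * h by apply: sb; rewrite mulrA.
pose q := s - h.
have sq : selfadjoint q by apply/saD => //; apply/saN.
have hq : h * q = - (s * q).
  by rewrite /q !mulrBr shh hs opprB.
have qs : q * s = s * q by rewrite /q mulrBl mulrBr hs.
have eq : e * q = q * e by apply/esym/eb.
have seq : selfadjoint (e * q) by exact: saM.
have eq0 : e * q = 0.
  apply: (neg_square_eq0 (w := x * q) seq).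
  rewrite stM sq mulrA -(mulrA q) -/h -mulrA hq mulrN; congr (- _).
  by rewrite !mulrA qs -ee -(mulrA e q e) -eq !mulrA.
have sq0 : s * q = 0 by rewrite -ee -mulrA eq0 mulr0.
have q0 : q = 0.
  apply: (selfadjoint_sq_eq0 sq).
  by rewrite {1}/q mulrBl hq sq0 oppr0 subr0.
have -> : h = s by apply/esym/eqP; rewrite -subr_eq0 -/q q0.
exact: norm_positive t0 ss Nt.
Qed.

(** The roots [d] of [st (x i) * x i] and [e] of the sum of the other terms
commute, and [d * d + e * e = 1]. *)
Lemma column_norm (I : finType) (x : I -> A) :
  \sum_i st (x i) * x i = 1 -> forall i, N (x i) <= 1.
Proof.
move=> x1 i; have [d [sd dd db _]] := star_square_positive (x i).
have : positive (\sum_(j | j != i) st (x j) * x j).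
  apply: (big_ind positive) => [|a b|j _].
  - by have := positive_square (_ : selfadjoint 0); rewrite mul0r; apply;
      rewrite /selfadjoint -(scale0r (0 : A)) stZ rmorph0 !scale0r.
  - exact: positiveD.
  - exact: star_square_positive.
move=> [e [se ee eb _]].
have e1 : d * d + e * e = 1 by rewrite -[RHS]x1 (bigD1 i) //= dd ee.
have de : d * e = e * d.
  apply: eb; rewrite -ee; have -> : e * e = 1 - d * d by rewrite -e1 addrC addKr.
  by rewrite mulrBr mulrBl mulr1 mul1r mulrA.
have := cart_norm sd se de; rewrite e1 N1 => Nd.
have : N (x i) ^+ 2 <= 1 by rewrite -NS -dd N_sq.
by rewrite expr_le1.
Qed.

End Positivity.

(** * Norms defined by representations *)

Section SupNonneg.
Variable R : realType.
Implicit Types (E : set R) (c : R).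

Lemma le_sup_of E c x : (forall y, E y -> y <= c) -> E x -> x <= sup E.
Proof.
move=> h Ex; apply: ub_le_sup => //; by exists c.
Qed.

Lemma sup_le_of E c : 0 <= c -> (forall y, E y -> y <= c) -> sup E <= c.
Proof.
move=> c0 h; have [->|/set0P ne] := eqVneq E set0; first by rewrite sup0.
exact: ge_sup.
Qed.

Lemma sup_ge0 E : (forall y, E y -> 0 <= y) -> 0 <= sup E.
Proof.
move=> h; have [[[x Ex] [c hc]]|ns] := pselect (has_sup E).
  by apply: le_trans (h _ Ex) (ub_le_sup _ Ex); exists c.
by rewrite sup_out.
Qed.

End SupNonneg.

Section PsdForms.
Variables (R : realType) (X : lmodType R[i]).
Local Notation C := R[i].
Variable dot : X -> X -> C.

Record psd_form : Prop := PsdForm {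
  psd_linear : forall y, linear (dot^~ y : X -> C^o);
  psd_herm : forall x y, dot x y = Num.conj (dot y x);
  psd_ge0 : forall x, 0 <= dot x x
}.

Hypothesis hd : psd_form.
Definition fnorm x : R := Num.sqrt (complex.Re (dot x x)).

Lemma psd_real x : dot x x = (complex.Re (dot x x))%:C%C.
Proof. by have := psd_ge0 hd x; case: (dot x x) => a b; rewrite lecE /= => /andP[/eqP -> _]. Qed.

Lemma psd_Re_ge0 x : 0 <= complex.Re (dot x x).
Proof. by have := psd_ge0 hd x; rewrite psd_real lecR. Qed.

Lemma fnorm_ge0 x : 0 <= fnorm x.
Proof. exact: sqrtr_ge0. Qed.

Lemma fnorm_sq x : fnorm x ^+ 2 = complex.Re (dot x x).
Proof. by rewrite sqr_sqrtr // psd_Re_ge0. Qed.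

Lemma dotDl x y z : dot (x + y) z = dot x z + dot y z.
Proof. exact: (linD (psd_linear hd z)). Qed.
Lemma dotZl k x z : dot (k *: x) z = k * dot x z.
Proof. exact: (linZ (psd_linear hd z)). Qed.
Lemma dotBl x y z : dot (x - y) z = dot x z - dot y z.
Proof. exact: (linB (psd_linear hd z)). Qed.
Lemma dotDr x y z : dot z (x + y) = dot z x + dot z y.
Proof. by rewrite (psd_herm hd) dotDl rmorphD /= -!(psd_herm hd). Qed.
Lemma dotZr k x z : dot z (k *: x) = Num.conj k * dot z x.
Proof. by rewrite (psd_herm hd) dotZl rmorphM /= -(psd_herm hd). Qed.

Lemma fnorm0 : fnorm 0 = 0.
Proof. by rewrite /fnorm (lin0 (psd_linear hd _)) sqrtr0. Qed.

Lemma fnormZ k x : fnorm (k *: x) = cmod k * fnorm x.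
Proof.
rewrite /fnorm dotZl dotZr mulrA psd_real -normCK cmodE -rmorphXn -rmorphM /=.
by rewrite sqrtrM ?sqr_ge0 // sqrtr_sqr ger0_norm // cmod_ge0.
Qed.

Lemma cauchy_schwarz x y : cmod (dot x y) <= fnorm x * fnorm y.
Proof.
pose c := dot x y; pose a := complex.Re (dot x x); pose b := complex.Re (dot y y).
have a0 : 0 <= a := psd_Re_ge0 x.
have b0 : 0 <= b := psd_Re_ge0 y.
pose m := cmod c ^+ 2.
have q (r : R) : 0 <= a - 2 * r * m + r ^+ 2 * m * b.
  have := psd_Re_ge0 (x - (r%:C%C * c) *: y).
  rewrite -scaleNr dotDl !dotDr !dotZl !dotZr -/c [dot y x](psd_herm hd) -/c.
  rewrite [dot x x]psd_real [dot y y]psd_real -/a -/b.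
  rewrite rmorphN rmorphM /= conj_real; set d := Num.conj c.
  have em : (cmod c)%:C%C ^+ 2 = c * d by rewrite -cmodE normCK.
  suff -> : a%:C%C + - (r%:C%C * d) * c
      + (- (r%:C%C * c) * d + - (r%:C%C * c) * (- (r%:C%C * d) * b%:C%C))
      = (a - 2 * r * m + r ^+ 2 * m * b)%:C%C by [].
  by rewrite /m !(rmorphD, rmorphN, rmorphM, rmorphXn) /= -expr2 em rmorph1; ring.
(* The discriminant; if [b = 0] the linear term in [r] has to vanish. *)
have mab : m <= a * b.
  have [bz|bn] := eqVneq b 0; last first.
    have bp : 0 < b by rewrite lt_neqAle eq_sym bn.
    have := q b^-1; have -> : a - 2 * b^-1 * m + b^-1 ^+ 2 * m * b = (a * b - m) / b.
      by field.
    by rewrite pmulr_lge0 ?invr_gt0 // subr_ge0.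
  rewrite bz mulr0 leNgt; apply/negP => m0.
  have := q ((a + 1) / (2 * m)).
  have -> : a - 2 * ((a + 1) / (2 * m)) * m + ((a + 1) / (2 * m)) ^+ 2 * m * b = -1.
    by rewrite bz; field; rewrite gt_eqF.
  by rewrite oppr_ge0 ler10.
rewrite -(@ler_pXn2r _ 2) ?nnegrE ?mulr_ge0 ?fnorm_ge0 ?cmod_ge0 //.
by rewrite exprMn !fnorm_sq.
Qed.

Lemma fnormD x y : fnorm (x + y) <= fnorm x + fnorm y.
Proof.
rewrite -(@ler_pXn2r _ 2) ?nnegrE ?addr_ge0 ?fnorm_ge0 //.
rewrite sqrrD !fnorm_sq dotDl !dotDr.
have h := cauchy_schwarz x y.
have Re_cmod (k : C) : complex.Re k <= cmod k.
  by rewrite /cmod; case: k => s t; rewrite normc_def /= (le_trans (ler_norm s)) //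
    -sqrtr_sqr ler_wsqrtr // lerDl sqr_ge0.
have h1 := Re_cmod (dot x y); have h2 := Re_cmod (dot y x).
have e : cmod (dot y x) = cmod (dot x y) by rewrite (psd_herm hd) cmod_conj.
rewrite e in h2.
by rewrite !raddfD /= mulr2n; move: h h1 h2; lra.
Qed.

End PsdForms.

Record star_rep (R : realType) (B : lmodType R[i]) (S : star_alg B)
    (X : lmodType R[i]) (dot : X -> X -> R[i]) (rho : B -> X -> X) : Prop :=
  StarRep {
  sr_linear : forall b, linear (rho b);
  sr_linearB : forall x, linear (rho^~ x);
  sr_one : forall x, rho (sa_one S) x = x;
  sr_mul : forall a b x, rho (sa_mul S a b) x = rho a (rho b x);
  sr_star : forall a x y, dot (rho a x) y = dot x (rho (sa_star S a) y)
}.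

(** The supremum of the operator norms of a family of representations on
pre-Hilbert spaces is a C*-seminorm, provided it is finite. *)
Section FamilyNorm.
Variables (R : realType) (B : lmodType R[i]) (S : star_alg B).
Variable Fam : forall X : lmodType R[i], (X -> X -> R[i]) -> (B -> X -> X) -> Prop.
Hypothesis Fpsd : forall X dot rho, @Fam X dot rho -> psd_form dot.
Hypothesis Frep : forall X dot rho, @Fam X dot rho -> star_rep S dot rho.
Hypothesis Fbound : forall b, exists c, forall X dot rho t, @Fam X dot rho ->
  fnorm dot (rho b t) <= c * fnorm dot t.

Definition family_set (b : B) : set R :=
  [set r | exists X dot rho t, [/\ @Fam X dot rho, fnorm dot t <= 1
     & r = fnorm dot (rho b t)]].

Definition family_norm (b : B) : R := sup (family_set b).

Let bound1 b : exists2 c, 0 <= c & forall r, family_set b r -> r <= c.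
Proof.
have [c hc] := Fbound b; exists `|c| => // _ [X [dot [rho [t [hF ht ->]]]]].
apply: le_trans (hc _ _ _ _ hF) _; rewrite (le_trans (ler_norm _)) // normrM.
by rewrite ler_piMr // ger0_norm ?fnorm_ge0.
Qed.

Lemma family_norm_ge0 b : 0 <= family_norm b.
Proof. by apply: sup_ge0 => _ [X [dot [rho [t [_ _ ->]]]]]; apply: fnorm_ge0. Qed.

Lemma family_norm_ub b X dot rho t : @Fam X dot rho -> fnorm dot t <= 1 ->
  fnorm dot (rho b t) <= family_norm b.
Proof.
move=> hF ht; have [c _ hc] := bound1 b; apply: le_sup_of hc _.
by exists X, dot, rho, t.
Qed.

Lemma family_norm_le b c : 0 <= c ->
  (forall X dot rho t, @Fam X dot rho -> fnorm dot t <= 1 ->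
     fnorm dot (rho b t) <= c) -> family_norm b <= c.
Proof.
by move=> c0 h; apply: sup_le_of => // _ [X [dot [rho [t [hF ht ->]]]]]; apply: h.
Qed.

(** The form may be degenerate: a vector of norm zero is rescaled by arbitrarily
large factors. *)
Lemma family_norm_op b X dot rho t : @Fam X dot rho ->
  fnorm dot (rho b t) <= family_norm b * fnorm dot t.
Proof.
move=> hF; have hd := Fpsd hF; have hr := Frep hF.
have key (s : R) : 0 <= s -> s * fnorm dot t <= 1 ->
    s * fnorm dot (rho b t) <= family_norm b.
  move=> s0 hs; have := @family_norm_ub b _ _ _ (s%:C%C *: t) hF.
  rewrite (linZ (sr_linear hr b)) !fnormZ // cmod_real ger0_norm //.
  by apply.
have [t0|tn] := eqVneq (fnorm dot t) 0.
  rewrite t0 mulr0 leNgt; apply/negP => h.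
  have := key ((family_norm b + 1) / fnorm dot (rho b t)).
  rewrite t0 mulr0 ler01 divfK ?gt_eqF // gerDl.
  rewrite divr_ge0 ?addr_ge0 ?family_norm_ge0 ?fnorm_ge0 // => /(_ erefl erefl).
  by rewrite ler10.
have tp : 0 < fnorm dot t by rewrite lt_neqAle eq_sym tn fnorm_ge0.
have := key (fnorm dot t)^-1; rewrite invr_ge0 fnorm_ge0 mulVf // lexx.
by move=> /(_ erefl erefl); rewrite ler_pdivrMl // mulrC.
Qed.

Let conj_sq X dot rho t b : @Fam X dot rho ->
  fnorm dot (rho b t) ^+ 2 <= family_norm (sa_mul S (sa_star S b) b) * fnorm dot t ^+ 2.
Proof.
move=> hF; have hd := Fpsd hF; have hr := Frep hF.
have h := cauchy_schwarz hd (rho (sa_mul S (sa_star S b) b) t) t.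
have e : dot (rho (sa_mul S (sa_star S b) b) t) t = dot (rho b t) (rho b t).
  by rewrite (sr_mul hr) (sr_star hr) sa_starK.
rewrite e (psd_real hd) cmod_real ger0_norm ?psd_Re_ge0 // in h.
rewrite (fnorm_sq hd) (le_trans h) // expr2 mulrA ler_wpM2r ?fnorm_ge0 //.
exact: family_norm_op.
Qed.

Theorem family_cstar_seminorm : cstar_seminorm S family_norm.
Proof.
have ad b c : family_norm (b + c) <= family_norm b + family_norm c.
  apply: family_norm_le => [|X dot rho t hF ht].
    by rewrite addr_ge0 ?family_norm_ge0.
  rewrite (linD (sr_linearB (Frep hF) t)) (le_trans (fnormD (Fpsd hF) _ _)) //.
  by rewrite lerD // family_norm_ub.
have zl k b : family_norm (k *: b) <= cmod k * family_norm b.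
  apply: family_norm_le => [|X dot rho t hF ht].
    by rewrite mulr_ge0 ?family_norm_ge0 ?cmod_ge0.
  rewrite (linZ (sr_linearB (Frep hF) t)) (fnormZ (Fpsd hF)).
  by rewrite ler_wpM2l ?cmod_ge0 // family_norm_ub.
have ml a b : family_norm (sa_mul S a b) <= family_norm a * family_norm b.
  apply: family_norm_le => [|X dot rho t hF ht].
    by rewrite mulr_ge0 ?family_norm_ge0.
  rewrite (sr_mul (Frep hF)) (le_trans (family_norm_op _ _ hF)) //.
  by rewrite ler_wpM2l ?family_norm_ge0 // family_norm_ub.
have sl b : family_norm b ^+ 2 <= family_norm (sa_mul S (sa_star S b) b).
  rewrite -[leRHS]sqr_sqrtr ?family_norm_ge0 // ler_sqr ?nnegrE ?family_norm_ge0 ?sqrtr_ge0 //.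
  apply: family_norm_le => [|X dot rho t hF ht]; first exact: sqrtr_ge0.
  rewrite -ler_sqr ?nnegrE ?fnorm_ge0 ?sqrtr_ge0 // [leRHS]sqr_sqrtr ?family_norm_ge0 //.
  rewrite (le_trans (conj_sq _ _ hF)) // ler_piMr ?family_norm_ge0 //.
  by rewrite expr_le1 // fnorm_ge0.
have st_le b : family_norm b <= family_norm (sa_star S b).
  have [->|nz] := eqVneq (family_norm b) 0; first exact: family_norm_ge0.
  have p0 : 0 < family_norm b by rewrite lt_neqAle eq_sym nz family_norm_ge0.
  have := le_trans (sl b) (ml _ _); rewrite expr2 ler_pM2r //.
have st_eq b : family_norm (sa_star S b) = family_norm b.
  by apply/eqP; rewrite eq_le st_le -{2}[b](sa_starK S) st_le.
split=> //.
- exact: family_norm_ge0.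
- move=> k b; apply/eqP; rewrite eq_le zl /=.
  have [->|k0] := eqVneq k 0.
    by rewrite cmod_real normr0 mul0r family_norm_ge0.
  have := zl k^-1 (k *: b); rewrite scalerA mulVf // scale1r => h.
  have h2 := ler_wpM2l (cmod_ge0 k) h.
  by rewrite mulrA -cmodM divff // cmod1 mul1r in h2.
- move=> b; apply/eqP; rewrite eq_le sl andbT.
  by rewrite (le_trans (ml _ _)) // st_eq expr2.
Qed.

End FamilyNorm.

Section SupSeminorms.
Variables (R : realType) (B : lmodType R[i]) (S : star_alg B).
Hypothesis bounded : forall b, exists c, forall p, cstar_seminorm S p -> p b <= c.

Definition sup_seminorm (b : B) : R :=
  sup [set r | exists2 p, cstar_seminorm S p & r = p b].

Lemma le_sup_seminorm p b : cstar_seminorm S p -> p b <= sup_seminorm b.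
Proof.
move=> hp; have [c hc] := bounded b.
apply: (le_sup_of (c := c)) => [_ [q hq ->]|]; first exact: hc.
by exists p.
Qed.

Let sup_le b c : 0 <= c -> (forall p, cstar_seminorm S p -> p b <= c) ->
  sup_seminorm b <= c.
Proof. by move=> c0 h; apply: sup_le_of => // _ [p hp ->]; apply: h. Qed.

Let s_ge0 b : 0 <= sup_seminorm b.
Proof. by apply: sup_ge0 => _ [p hp ->]; apply: cs_ge0 hp _. Qed.

Lemma sup_cstar_seminorm : cstar_seminorm S sup_seminorm.
Proof.
have zl k b : sup_seminorm (k *: b) <= cmod k * sup_seminorm b.
  apply: sup_le => [|p hp]; first by rewrite mulr_ge0 ?cmod_ge0.
  by rewrite (cs_scale hp) ler_wpM2l ?cmod_ge0 // le_sup_seminorm.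
split=> //.
- move=> a b; apply: sup_le => [|p hp]; first by rewrite addr_ge0.
  by rewrite (le_trans (cs_add hp _ _)) // lerD // le_sup_seminorm.
- move=> k b; apply/eqP; rewrite eq_le zl /=.
  have [->|k0] := eqVneq k 0; first by rewrite cmod_real normr0 mul0r.
  have := zl k^-1 (k *: b); rewrite scalerA mulVf // scale1r => h.
  have h2 := ler_wpM2l (cmod_ge0 k) h.
  by rewrite mulrA -cmodM divff // cmod1 mul1r in h2.
- move=> a b; apply: sup_le => [|p hp]; first by rewrite mulr_ge0.
  by rewrite (le_trans (cs_mul hp _ _)) // ler_pM ?(cs_ge0 hp) // le_sup_seminorm.
- move=> b; apply/eqP; rewrite eq_le; apply/andP; split.
    apply: sup_le => [|p hp]; first by rewrite sqr_ge0.
    by rewrite (cs_star hp) ler_sqr ?nnegrE ?(cs_ge0 hp) // le_sup_seminorm.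
  rewrite -[leRHS]sqr_sqrtr // ler_sqr ?nnegrE ?sqrtr_ge0 //.
  apply: sup_le => [|p hp]; first exact: sqrtr_ge0.
  rewrite -ler_sqr ?nnegrE ?sqrtr_ge0 ?(cs_ge0 hp) // sqr_sqrtr // -(cs_star hp).
  exact: le_sup_seminorm.
Qed.

End SupSeminorms.

(** * The minimal tensor norm *)

Section ConjugateModule.
Variables (R : realType) (V : lmodType R[i]).

(** The conjugate module, through which antilinear maps become linear ones. *)
Definition conjmod : Type := V.
HB.instance Definition _ := GRing.Zmodule.on conjmod.

Let cscale (k : R[i]) (x : conjmod) : conjmod := Num.conj k *: (x : V).
Let cscaleA a b x : cscale a (cscale b x) = cscale (a * b) x.
Proof. by rewrite /cscale scalerA rmorphM. Qed.
Let cscale1 : left_id 1 cscale.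
Proof. by move=> x; rewrite /cscale rmorph1 scale1r. Qed.
Let cscaleDr : right_distributive cscale +%R.
Proof. by move=> a x y; rewrite /cscale scalerDr. Qed.
Let cscaleDl x : {morph cscale^~ x : a b / a + b}.
Proof. by move=> a b; rewrite /cscale rmorphD scalerDl. Qed.
HB.instance Definition _ := GRing.Zmodule_isLmodule.Build R[i] conjmod
  cscaleA cscale1 cscaleDr cscaleDl.

End ConjugateModule.

Section AntilinearLift.
Variables (R : realType) (U V T : lmodType R[i]) (f : U -> V -> T).
Hypothesis fl : forall k a b v,
  f (k *: a + b) v = Num.conj k *: f a v + f b v.
Hypothesis fr : forall k u a b,
  f u (k *: a + b) = Num.conj k *: f u a + f u b.

Let fb : bilinear (f : U -> V -> conjmod T).
Proof. exact: (@bilinearI _ _ _ (conjmod T) f fl fr). Qed.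

Lemma antilift_tens u v : tlift f (u \ox v) = f u v.
Proof. exact: (tlift_tens fb). Qed.
Lemma antilift0 : tlift f (0 : tensor U V) = 0.
Proof. exact: (tlift0 fb). Qed.
Lemma antiliftD x y : tlift f (x + y) = tlift f x + tlift f y.
Proof. exact: (tliftD fb). Qed.
Lemma antiliftZ k x : tlift f (k *: x) = Num.conj k *: tlift f x.
Proof. exact: (tliftZ fb). Qed.

End AntilinearLift.

Section TensorStar.
Variables (R : realType) (A B : algType R[i]) (stA : A -> A) (stB : B -> B).
Hypotheses (hA : involution stA) (hB : involution stB).
Local Notation C := R[i].
Local Notation T := (tensor A B).
Implicit Types x y : T.

Let tb := @tens_bilinear C A B.

Let mulZl k x y : (k *: x) * y = k *: (x * y).
Proof.
move: x; apply: tensor_ind => [|a b|x x' hx hx'].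
- by rewrite scaler0 !mul0r scaler0.
- move: y; apply: tensor_ind => [|c d|y y' hy hy'].
  + by rewrite !mulr0 scaler0.
  + by rewrite -(bilinearZl tb) !tensor_mul_tens -(bilinearZl tb) scalerAl.
  + by rewrite !mulrDr hy hy' scalerDr.
by rewrite scalerDr !mulrDl hx hx' scalerDr.
Qed.

Let mulZr k x y : x * (k *: y) = k *: (x * y).
Proof.
move: x; apply: tensor_ind => [|a b|x x' hx hx'].
- by rewrite !mul0r scaler0.
- move: y; apply: tensor_ind => [|c d|y y' hy hy'].
  + by rewrite scaler0 !mulr0 scaler0.
  + by rewrite -(bilinearZl tb) !tensor_mul_tens -(bilinearZl tb) scalerAr.
  + by rewrite scalerDr !mulrDr hy hy' scalerDr.
by rewrite !mulrDl hx hx' scalerDr.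
Qed.

Let mul_bil : bilinear ( *%R : T -> T -> T).
Proof.
apply: bilinearI => k a b c; first by rewrite mulrDl mulZl.
by rewrite mulrDr mulZr.
Qed.

Let al k a a' (b : B) : stA (k *: a + a') \ox stB b
  = Num.conj k *: (stA a \ox stB b) + stA a' \ox stB b.
Proof. by case: hA => D Z _ _ _; rewrite D Z (bilinearl tb). Qed.
Let ar k (a : A) b b' : stA a \ox stB (k *: b + b')
  = Num.conj k *: (stA a \ox stB b) + stA a \ox stB b'.
Proof. by case: hB => D Z _ _ _; rewrite D Z (bilinearr tb). Qed.

Lemma tensor_star_tens a b : tmap stA stB (a \ox b) = stA a \ox stB b.
Proof. exact: (antilift_tens (f := fun a b => stA a \ox stB b) al ar). Qed.

Let starD x y : tmap stA stB (x + y) = tmap stA stB x + tmap stA stB y.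
Proof. exact: (antiliftD (f := fun a b => stA a \ox stB b) al ar). Qed.
Let starZ k x : tmap stA stB (k *: x) = Num.conj k *: tmap stA stB x.
Proof. exact: (antiliftZ (f := fun a b => stA a \ox stB b) al ar). Qed.
Let star0 : tmap stA stB 0 = 0.
Proof. exact: (antilift0 (f := fun a b => stA a \ox stB b) al ar). Qed.
Let starM x y : tmap stA stB (x * y) = tmap stA stB y * tmap stA stB x.
Proof.
move: x; apply: tensor_ind => [|a b|x x' hx hx'].
- by rewrite mul0r star0 mulr0.
- move: y; apply: tensor_ind => [|c d|y y' hy hy'].
  + by rewrite mulr0 star0 mul0r.
  + rewrite tensor_mul_tens !tensor_star_tens tensor_mul_tens.
    by case: hA hB => _ _ mA _ _ [_ _ mB _ _]; rewrite mA mB.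
  + by rewrite mulrDr !starD hy hy' mulrDl.
by rewrite mulrDl !starD hx hx' mulrDr.
Qed.
Let star1 : tmap stA stB 1 = 1.
Proof.
rewrite -(tens_one A B) tensor_star_tens.
by case: hA hB => _ _ _ -> _ [_ _ _ -> _].
Qed.
Let starK : involutive (tmap stA stB : T -> T).
Proof.
apply: tensor_ind => [|a b|x y hx hy]; first by rewrite !star0.
  by rewrite !tensor_star_tens; case: hA hB => _ _ _ _ -> [_ _ _ _ ->].
by rewrite !starD hx hy.
Qed.

Definition tensor_star : star_alg T :=
  StarAlg mul_bil (@mulrA T) (@mul1r T) (@mulr1 T) starD starZ starM star1 starK.

End TensorStar.

Section TensorDot.
Variables (R : realType) (X Y : lmodType R[i]).
Local Notation C := R[i].
Variables (dx : X -> X -> C) (dy : Y -> Y -> C).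
Hypotheses (hx : psd_form dx) (hy : psd_form dy).
Local Notation T := (tensor X Y).

Let inner x1 x2 (t : T) : C^o := tlift (fun y1 y2 => dx x1 y1 * dy x2 y2 : C^o) t.
Definition tdot (s t : T) : C :=
  tlift (fun x1 x2 => tlift (fun y1 y2 => dx x1 y1 * dy x2 y2 : C^o) t : C^o) s.

Let il x1 x2 k a b c : dx x1 (k *: a + b) * dy x2 c
  = Num.conj k *: (dx x1 a * dy x2 c : C^o) + dx x1 b * dy x2 c :> C^o.
Proof. by rewrite (dotDr hx) (dotZr hx) mulrDl -mulrA. Qed.
Let ir x1 x2 k c a b : dx x1 c * dy x2 (k *: a + b)
  = Num.conj k *: (dx x1 c * dy x2 a : C^o) + dx x1 c * dy x2 b :> C^o.
Proof. by rewrite (dotDr hy) (dotZr hy) mulrDr mulrCA. Qed.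

Let inner_tens x1 x2 y1 y2 : inner x1 x2 (y1 \ox y2) = dx x1 y1 * dy x2 y2.
Proof. exact: (antilift_tens (f := fun y1 y2 => dx x1 y1 * dy x2 y2 : C^o) (il x1 x2) (ir x1 x2)). Qed.
Let innerD x1 x2 s t : inner x1 x2 (s + t) = inner x1 x2 s + inner x1 x2 t.
Proof. exact: (antiliftD (f := fun y1 y2 => dx x1 y1 * dy x2 y2 : C^o) (il x1 x2) (ir x1 x2)). Qed.
Let inner0 x1 x2 : inner x1 x2 0 = 0.
Proof. exact: (antilift0 (f := fun y1 y2 => dx x1 y1 * dy x2 y2 : C^o) (il x1 x2) (ir x1 x2)). Qed.

Let outer_bil t :
  bilinear (fun x1 x2 => inner x1 x2 t).
Proof.
apply: bilinearI => k a b c; move: t; apply: tensor_ind => [|y1 y2|t t' h h'].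
- by rewrite !inner0 scaler0 addr0.
- by rewrite !inner_tens (dotDl hx) (dotZl hx) mulrDl -mulrA.
- by rewrite !innerD h h' scalerDr addrACA.
- by rewrite !inner0 scaler0 addr0.
- by rewrite !inner_tens (dotDl hy) (dotZl hy) mulrDr mulrCA.
- by rewrite !innerD h h' scalerDr addrACA.
Qed.

Lemma tdot_linear t : linear (tdot^~ t : T -> C^o).
Proof. exact: (tlift_is_linear (outer_bil t)). Qed.

Lemma tdot_tens x1 x2 y1 y2 :
  tdot (x1 \ox x2) (y1 \ox y2) = dx x1 y1 * dy x2 y2.
Proof. by rewrite -inner_tens; exact: (tlift_tens (outer_bil _)). Qed.

Let tdot0l t : tdot 0 t = 0. Proof. exact: (lin0 (tdot_linear t)). Qed.
Let tdotDl s s' t : tdot (s + s') t = tdot s t + tdot s' t.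
Proof. exact: (linD (tdot_linear t)). Qed.

Let tdotDr s t t' : tdot s (t + t') = tdot s t + tdot s t'.
Proof.
move: s; apply: tensor_ind => [|x1 x2|s s' h h'].
- by rewrite !tdot0l addr0.
- by rewrite /tdot !(tlift_tens (outer_bil _)); exact: innerD.
- by rewrite !tdotDl h h' addrACA.
Qed.
Lemma tdot0r s : tdot s 0 = 0.
Proof. by apply: (addrI (tdot s 0)); rewrite -tdotDr !addr0. Qed.

Lemma tdot_herm s t : tdot s t = Num.conj (tdot t s).
Proof.
move: s; apply: tensor_ind => [|x1 x2|s s' h h'].
- by rewrite tdot0l tdot0r rmorph0.
- move: t; apply: tensor_ind => [|y1 y2|t t' h h'].
  + by rewrite tdot0l tdot0r rmorph0.
  + by rewrite !tdot_tens (psd_herm hx) (psd_herm hy) rmorphM.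
  + by rewrite tdotDr tdotDl rmorphD h h'.
by rewrite tdotDr tdotDl rmorphD h h'.
Qed.

(** Orthogonalising the second legs of a formal sum against that of its first
term shortens the sum. *)
Lemma tdot_ge0 t : 0 <= tdot t t.
Proof.
rewrite [t]tensor_sum; move: (repr t) => s {t}.
have tb := @tens_bilinear C X Y.
elim: {s}(size s) {-2}s (leqnn (size s)) => [|n IH] [|[x0 y0] s] //= hs;
  do 1?by rewrite big_nil tdot0l.
pose c y := dy y y0 / dy y0 y0.
pose y' y := y - c y *: y0.
have orth y : dy y0 (y' y) = 0.
  rewrite (psd_herm hy); apply/eqP; rewrite conjC_eq0; apply/eqP.
  rewrite /y' -scaleNr (dotDl hy) (dotZl hy) /c.
  have [z|nz] := eqVneq (dy y0 y0) 0; last by rewrite mulNr divfK // subrr.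
  rewrite z mulr0 addr0; apply: cmod_eq0; apply/eqP; rewrite eq_le cmod_ge0 andbT.
  by rewrite (le_trans (cauchy_schwarz hy _ _)) // /fnorm z /= sqrtr0 mulr0.
pose X0 := x0 + \sum_(p <- s) c p.2 *: p.1.
pose s' := [seq (p.1, y' p.2) | p <- s].
pose t' := \sum_(p <- s') p.1 \ox p.2.
have decomp : \sum_(p <- (x0, y0) :: s) p.1 \ox p.2 = X0 \ox y0 + t'.
  rewrite big_cons /= /X0 (bilinearDl tb) -addrA; congr (_ + _).
  rewrite (big_morph (fun x => x \ox y0) (fun a b => bilinearDl tb a b y0)
    (bilinear0l tb y0)) /t' big_map -big_split; apply: eq_bigr => p _ /=.
  by rewrite /y' (bilinearBr tb) (bilinearZl tb) (bilinearZr tb) addrC subrK.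
have cross : tdot (X0 \ox y0) t' = 0.
  rewrite /t' (big_morph (tdot (X0 \ox y0)) (tdotDr _) (tdot0r _)) big_map.
  by rewrite big1 // => p _; rewrite tdot_tens orth mulr0.
rewrite decomp tdotDl !tdotDr cross [tdot t' (X0 \ox y0)]tdot_herm cross rmorph0.
rewrite addr0 add0r addr_ge0 //; first by rewrite tdot_tens mulr_ge0 ?psd_ge0.
by apply: IH; rewrite size_map.
Qed.

Lemma tdot_psd : psd_form tdot.
Proof. by split; [exact: tdot_linear|exact: tdot_herm|exact: tdot_ge0]. Qed.

End TensorDot.

Section Contraction.
Variables (R : realType) (A : algType R[i]) (st : A -> A) (N : A -> R).
Hypothesis hA : cstar_algebra st N.
Variable hst : involution st.
Variables (X : lmodType R[i]) (dot : X -> X -> R[i]) (rho : A -> X -> X).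
Hypotheses (hd : psd_form dot) (hr : star_rep (alg_star hst) dot rho).

(** If [N a <= 1] then [1 - a^* a] is the square of a selfadjoint [c], so that
[|x|^2 - |rho a x|^2 = |rho c x|^2]. *)
Lemma star_rep_contraction a x : fnorm dot (rho a x) <= N a * fnorm dot x.
Proof.
have [_ [[n0 n00] _ NZ _ NS] _] := hA.
have [sD sZ sM s1 sK] := hst.
have [a0|an] := eqVneq (N a) 0.
  rewrite a0 mul0r (n00 _ a0) (lin0 (sr_linearB hr x)) (fnorm0 hd).
  exact: lexx.
have ap : 0 < N a by rewrite lt_neqAle eq_sym an n0.
pose r : R := (N a)^-1; pose b := r%:C%C *: a.
have r0 : 0 < r by rewrite invr_gt0.
have Nb : N b = 1.
  by rewrite /b NZ -[complex.Re _]/(cmod r%:C%C) cmod_real ger0_norm ?(ltW r0) // mulVf.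
have sbb : selfadjoint st (st b * b) by rewrite /selfadjoint sM sK.
have Nbb : N (st b * b) <= 1 by rewrite NS Nb expr1n.
have [c [sc cc _ _]] := sqrt_one_sub hA sbb Nbb.
have e : dot x x - dot (rho b x) (rho b x) = dot (rho c x) (rho c x).
  have h (d : A) : dot (rho d x) (rho d x) = dot (rho (st d * d) x) x.
    by rewrite (sr_mul hr) [in RHS](sr_star hr) /= sK.
  by rewrite !h sc cc (linB (sr_linearB hr x)) (sr_one hr) (dotBl hd).
have le1 : fnorm dot (rho b x) <= fnorm dot x.
  rewrite -ler_sqr ?nnegrE ?fnorm_ge0 // !(fnorm_sq hd) -subr_ge0.
  by rewrite -raddfB /= e psd_Re_ge0.
have := le1; rewrite /b (linZ (sr_linearB hr x)) (fnormZ hd) cmod_real.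
by rewrite ger0_norm ?(ltW r0) // /r ler_pdivrMl.
Qed.

End Contraction.

Section TensorRep.
Variables (R : realType) (A B : algType R[i]) (stA : A -> A) (stB : B -> B).
Hypotheses (hA : involution stA) (hB : involution stB).
Local Notation C := R[i].
Variables (X Y : lmodType C) (dx : X -> X -> C) (dy : Y -> Y -> C).
Hypotheses (hx : psd_form dx) (hy : psd_form dy).
Variables (ra : A -> X -> X) (rb : B -> Y -> Y).
Hypotheses (hra : star_rep (alg_star hA) dx ra) (hrb : star_rep (alg_star hB) dy rb).

Definition tensor_rep (x : tensor A B) (t : tensor X Y) : tensor X Y :=
  tlift (fun a b => tmap (ra a) (rb b) t) x.

Let tl a b : linear (tmap (ra a) (rb b)).
Proof. by apply: tmap_is_linear; [exact: (sr_linear hra)|exact: (sr_linear hrb)]. Qed.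

Let tm a b x y : tmap (ra a) (rb b) (x \ox y) = ra a x \ox rb b y.
Proof. by rewrite tmap_tens; [|exact: (sr_linear hra)|exact: (sr_linear hrb)]. Qed.

Let tb := @tens_bilinear C X Y.

Let rep_bil t : bilinear (fun a b => tmap (ra a) (rb b) t).
Proof.
apply: bilinearI => k a b c; move: t; apply: tensor_ind => [|x y|t t' h h'].
- by rewrite !(lin0 (tl _ _)) scaler0 addr0.
- by rewrite !tm (sr_linearB hra) (bilinearl tb).
- by rewrite !(linD (tl _ _)) h h' scalerDr addrACA.
- by rewrite !(lin0 (tl _ _)) scaler0 addr0.
- by rewrite !tm (sr_linearB hrb) (bilinearr tb).
- by rewrite !(linD (tl _ _)) h h' scalerDr addrACA.
Qed.

Lemma tensor_rep_tens a b t : tensor_rep (a \ox b) t = tmap (ra a) (rb b) t.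
Proof. exact: (tlift_tens (rep_bil t)). Qed.

Let repB t : linear (tensor_rep^~ t).
Proof. exact: (tlift_is_linear (rep_bil t)). Qed.

Let repl x : linear (tensor_rep x).
Proof.
move=> k t t'; move: x; apply: tensor_ind => [|a b|x x' h h'].
- by rewrite !(lin0 (repB _)) scaler0 addr0.
- by rewrite !tensor_rep_tens tl.
- by rewrite !(linD (repB _)) h h' scalerDr addrACA.
Qed.

Lemma tensor_star_rep : star_rep (tensor_star hA hB) (tdot dx dy) tensor_rep.
Proof.
have td := tdot_linear hx hy; have th := tdot_herm hx hy.
have tdDr s t t' : tdot dx dy s (t + t') = tdot dx dy s t + tdot dx dy s t'.
  exact: (dotDr (tdot_psd hx hy)).
have td0r s : tdot dx dy s 0 = 0 := tdot0r hx hy s.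
split=> //.
- move=> t; rewrite -[sa_one _]/(1 \ox 1) tensor_rep_tens.
  move: t; apply: tensor_ind => [|x y|t t' h h'].
  + by rewrite (lin0 (tl _ _)).
  + by rewrite tm (sr_one hra) (sr_one hrb).
  + by rewrite (linD (tl _ _)) h h'.
- move=> x y t; rewrite -[sa_mul _ _ _]/(x * y).
  move: x; apply: tensor_ind => [|a b|x x' h h'].
  + by rewrite mul0r !(lin0 (repB _)).
  + move: y; apply: tensor_ind => [|c d|y y' h h'].
    * by rewrite mulr0 (lin0 (repB _)) (lin0 (repl _)).
    * rewrite tensor_mul_tens !tensor_rep_tens.
      move: t; apply: tensor_ind => [|x y|t t' h h'].
      - by rewrite !(lin0 (tl _ _)).
      - by rewrite !tm (sr_mul hra) (sr_mul hrb).
      - by rewrite !(linD (tl _ _)) h h'.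
    * by rewrite mulrDr !(linD (repB _)) h h' (linD (repl _)).
  + by rewrite mulrDl !(linD (repB _)) h h'.
- move=> x s t; rewrite -[sa_star _ _]/(tmap stA stB x).
  have sD a b : tmap stA stB (a + b) = tmap stA stB a + tmap stA stB b.
    exact: (sa_starD (tensor_star hA hB)).
  have s0 : tmap stA stB 0 = 0 := sa_star0 (tensor_star hA hB).
  move: x; apply: tensor_ind => [|a b|x x' h h'].
  + by rewrite s0 !(lin0 (repB _)) td0r (lin0 (td _)).
  + rewrite tensor_star_tens // !tensor_rep_tens.
    move: s; apply: tensor_ind => [|x y|s s' h h'].
    * by rewrite (lin0 (tl _ _)) !(lin0 (td _)).
    * move: t; apply: tensor_ind => [|z w|t t' h h'].
      - by rewrite (lin0 (tl _ _)) !td0r.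
      - by rewrite !tm !tdot_tens // (sr_star hra) (sr_star hrb).
      - by rewrite (linD (tl _ _)) !tdDr h h'.
    * by rewrite (linD (tl _ _)) !(linD (td _)) h h'.
  + by rewrite sD !(linD (repB _)) tdDr (linD (td _)) h h'.
Qed.

(** Each factor acts on the whole tensor product, where [star_rep_contraction]
bounds it. *)
Lemma left_star_rep : star_rep (alg_star hA) (tdot dx dy)
  (fun a => tensor_rep (a \ox 1)).
Proof.
have hr := tensor_star_rep; have [sA sZ sM s1 sK] := hB.
have tb' := @tens_bilinear C A B.
split=> [a|t|t|a b t|a s t].
- exact: (sr_linear hr).
- by move=> k a b; rewrite (bilinearl tb') (sr_linearB hr).
- exact: (sr_one hr).
- by rewrite -(sr_mul hr) /= tensor_mul_tens mulr1.
- by rewrite (sr_star hr) /= tensor_star_tens // s1.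
Qed.

Lemma right_star_rep : star_rep (alg_star hB) (tdot dx dy)
  (fun b => tensor_rep (1 \ox b)).
Proof.
have hr := tensor_star_rep; have [sA sZ sM s1 sK] := hA.
have tb' := @tens_bilinear C A B.
split=> [a|t|t|a b t|a s t].
- exact: (sr_linear hr).
- by move=> k a b; rewrite (bilinearr tb') (sr_linearB hr).
- exact: (sr_one hr).
- by rewrite -(sr_mul hr) /= tensor_mul_tens mulr1.
- by rewrite (sr_star hr) /= tensor_star_tens // s1.
Qed.

End TensorRep.

Section HilbertForm.
Variables (R : realType) (K : hilbert R).

Lemma hilbert_psd : psd_form (hilbert_dot K).
Proof.
split=> [y k a b|x y|x].
- exact: linearPl.
- by rewrite [LHS]hermC expr0 mul1r.
- have [->|x0] := eqVneq x 0; first by rewrite linear0l.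
  by apply/ltW/neq0_dnorm_gt0.
Qed.

Lemma star_representation_rep (A : algType R[i]) (st : A -> A)
    (hst : involution st) (rho : A -> K -> K) :
  star_representation st rho -> star_rep (alg_star hst) (hilbert_dot K) rho.
Proof. by move=> [[l _] lA r1 rM rS]; split. Qed.

End HilbertForm.

Section MinNorm.
Variables (R : realType) (A B : algType R[i]) (stA : A -> A) (stB : B -> B).
Variables (NA : A -> R) (NB : B -> R).
Hypotheses (hA : cstar_algebra stA NA) (hB : cstar_algebra stB NB).
Local Notation C := R[i].

Let iA : involution stA. Proof. by case: hA. Qed.
Let iB : involution stB. Proof. by case: hB. Qed.

(** The family in the definition of [min_norm], as a family of pre-Hilbert
spaces. *)
Inductive min_family : forall X : lmodType C, (X -> X -> C) ->
    (tensor A B -> X -> X) -> Prop :=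
  MinFamily (K1 K2 : hilbert R) (ra : A -> K1 -> K1) (rb : B -> K2 -> K2) of
    star_representation stA ra & star_representation stB rb :
  min_family (tdot (hilbert_dot K1) (hilbert_dot K2)) (tensor_rep ra rb).

Let fam_psd (X : lmodType C) (dot : X -> X -> C) rho : min_family dot rho -> psd_form dot.
Proof. by case=> *; apply: tdot_psd; apply: hilbert_psd. Qed.

Let fam_rep (X : lmodType C) (dot : X -> X -> C) rho :
  min_family dot rho -> star_rep (tensor_star iA iB) dot rho.
Proof.
case=> K1 K2 ra rb ha hb; apply: tensor_star_rep; try exact: hilbert_psd.
- exact: star_representation_rep.
- exact: star_representation_rep.
Qed.

Let fam_bound (x : tensor A B) : exists c,
  forall (X : lmodType C) (dot : X -> X -> C) rho t,
  min_family dot rho -> fnorm dot (rho x t) <= c * fnorm dot t.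
Proof.
have [_ [[nA _] _ _ _ _] _] := hA.
move: x; apply: tensor_ind => [|a b|x y [c hc] [d hd]].
- exists 0 => X dot rho t hF.
  by rewrite (lin0 (sr_linearB (fam_rep hF) t)) mul0r (fnorm0 (fam_psd hF)).
- exists (NA a * NB b) => X dot rho t hF; have hr := fam_rep hF.
  have -> : rho (a \ox b) t = rho (a \ox 1) (rho (1 \ox b) t).
    by rewrite -(sr_mul hr) /= tensor_mul_tens mulr1 mul1r.
  case: hF {hr} t => K1 K2 ra rb ha hb t.
  have h1 := hilbert_psd K1; have h2 := hilbert_psd K2.
  have sa := star_representation_rep iA ha.
  have sb := star_representation_rep iB hb.
  have ca := star_rep_contraction hA (tdot_psd h1 h2)
    (left_star_rep h1 h2 sa sb) a (tensor_rep ra rb (1 \ox b) t).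
  have cb := star_rep_contraction hB (tdot_psd h1 h2)
    (right_star_rep h1 h2 sa sb) b t.
  apply: (le_trans ca); rewrite -mulrA.
  exact: (ler_wpM2l (nA a) cb).
exists (c + d) => X dot rho t hF; have hr := fam_rep hF.
rewrite (linD (sr_linearB hr t)) (le_trans (fnormD (fam_psd hF) _ _)) // mulrDl.
by rewrite lerD // ?hc ?hd.
Qed.

Lemma min_norm_family : min_norm stA stB = family_norm min_family.
Proof.
apply/funext => x; congr sup; apply/seteqP; split=> r.
  move=> [K1 [K2 [ra [rb [t [ha hb ht ->]]]]]].
  by exists (tensor K1 K2), (tdot (hilbert_dot K1) (hilbert_dot K2)),
    (tensor_rep ra rb), t.
move=> [X [dot [rho [t [hF]]]]]; case: hF t => K1 K2 ra rb ha hb t ht ->.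
by exists K1, K2, ra, rb, t.
Qed.

Lemma min_norm_cstar_seminorm :
  cstar_seminorm (tensor_star iA iB) (min_norm stA stB).
Proof.
rewrite min_norm_family.
exact: (family_cstar_seminorm fam_psd fam_rep fam_bound).
Qed.

Lemma min_norm_ge (K1 K2 : hilbert R) ra rb (t : tensor K1 K2) x :
  star_representation stA ra -> star_representation stB rb ->
  tensor_hnorm t <= 1 -> tensor_hnorm (tensor_rep ra rb x t) <= min_norm stA stB x.
Proof.
move=> ha hb ht; rewrite min_norm_family.
exact: (family_norm_ub fam_bound x (MinFamily ha hb) ht).
Qed.

Lemma min_tensor_exists : min_norm stA stB 1 != 0 ->
  exists (T : algType C) (stT : T -> T) (NT : T -> R) (i : tensor A B -> T),
    is_min_tensor stA stB stT NT i.
Proof.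
move=> n1; have hp := min_norm_cstar_seminorm.
exists (completion hp n1), (@cstar _ _ _ _ hp n1), (@cnorm _ _ _ _ hp n1),
  (completion_map hp n1).
split.
- exact: completion_cstar_algebra.
- exact: completion_map_linear.
- split; [exact: (completion_map1 hp n1)|exact: (completion_mapM hp n1)].
- by move=> x; rewrite cstar_map.
- exact: completion_dense_isometry.
Qed.

End MinNorm.

(** * Extension by continuity *)

Section Extension.
Variables (R : realType) (H A T : algType R[i]).
Variables (NH : H -> R) (stA : A -> A) (NA : A -> R) (stT : T -> T) (NT : T -> R).
Variables (j : {lrmorphism H -> A}) (phi : H -> T).
Hypotheses (hA : cstar_algebra stA NA) (hT : cstar_algebra stT NT).
Hypothesis hj : dense_isometry NH NA j.
Hypotheses (pl : linear phi) (pm : monoid_morphism phi).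
Hypothesis pN : forall h, NT (phi h) <= NH h.

Let iA : involution stA. Proof. by case: hA. Qed.
Let iT : involution stT. Proof. by case: hT. Qed.
Let nA : cstar_seminorm (alg_star iA) NA.
Proof. by apply: cstar_norm_seminorm; case: hA. Qed.
Let nT : cstar_seminorm (alg_star iT) NT.
Proof. by apply: cstar_norm_seminorm; case: hT. Qed.

Let pjN h h' : NT (phi h - phi h') <= NA (j h - j h').
Proof. by rewrite -(linB pl) -raddfB hj.1. Qed.

Let approx a e : 0 < e -> exists h, NA (a - j h) < e.
Proof. exact: hj.2. Qed.

(** The value at [a] is characterised by an estimate against all of [H], which
does not depend on an approximating sequence. *)
Let spec a l := forall h, NT (l - phi h) <= NA (a - j h).

Let spec_ex a : exists l, spec a l.
Proof.
have ap n : exists h, NA (a - j h) < n.+1%:R^-1 by apply: approx; rewrite invr_gt0.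
pose h n := projT1 (cid (ap n)).
have hE n : NA (a - j (h n)) < n.+1%:R^-1 := projT2 (cid (ap n)).
have [_ _ cT] := hT.
have [|l hl] := cT (fun n => phi (h n)).
  move=> e e0; have [k hk] := inv_small (divr_gt0 e0 (ltr0Sn _ 1)).
  exists k => n m kn km; apply: le_lt_trans (pjN _ _) _.
  apply: (cs_lt3 nA (b := a)).
    by rewrite (cs_subC nA); apply: lt_trans (hE n) (hk _ kn).
  by apply/ltW/(lt_trans (hE m))/hk.
exists l => g; apply/ler_addgt0Pr => e e0.
have e20 : 0 < e / 2 by rewrite divr_gt0.
have [k1 h1] := hl _ e20; have [k2 h2] := inv_small e20.
pose n := maxn k1 k2.
have l1 := h1 n (leq_maxl _ _).
have l2 := lt_trans (hE n) (h2 n (leq_maxr _ _)).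
have t1 := cs_trans nT l (phi (h n)) (phi g).
have t2 := cs_trans nA (j (h n)) a (j g).
have t3 := pjN (h n) g.
rewrite (cs_subC nT) in l1; rewrite (cs_subC nA) in l2.
by move: l1 l2 t1 t2 t3; lra.
Qed.

Definition extension a : T := projT1 (cid (spec_ex a)).

Lemma extension_spec a h : NT (extension a - phi h) <= NA (a - j h).
Proof. exact: (projT2 (cid (spec_ex a))). Qed.

(** Approximate values determine the extension; each algebraic identity below is
obtained from it by approximating the arguments. *)
Lemma extension_eq a l (c : R) : 0 <= c ->
  (forall e, 0 < e -> e <= 1 -> exists h,
     NA (a - j h) <= c * e /\ NT (l - phi h) <= c * e) ->
  l = extension a.
Proof.
move=> c0 ha; apply/eqP; rewrite -subr_eq0; apply/eqP.
apply: (small_eq0 hT (c := c + c)) => e e0.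
pose e1 := Num.min e 1.
have e10 : 0 < e1 by rewrite lt_min e0 ltr01.
have e11 : e1 <= 1 by rewrite ge_min lexx orbT.
have [h [h1 h2]] := ha e1 e10 e11.
have t1 := cs_trans nT l (phi h) (extension a).
have t2 := extension_spec a h.
rewrite (cs_subC nT) in t2.
have : c * e1 <= c * e by rewrite ler_wpM2l // ge_min lexx.
by move: h1 h2 t1 t2; lra.
Qed.

Lemma extensionE h : extension (j h) = phi h.
Proof.
apply/esym/(extension_eq (lexx 0)) => e _ _; exists h.
by rewrite !subrr (cs0 nA) (cs0 nT) mul0r lexx.
Qed.

Let approx2 a e : 0 < e -> exists2 h, NA (a - j h) <= e
  & NT (extension a - phi h) <= e.
Proof.
move=> /(approx a)[h /ltW hh]; exists h => //.
exact: le_trans (extension_spec a h) hh.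
Qed.

Lemma extension_linear : linear extension.
Proof.
move=> k a b; apply/esym/(extension_eq (c := cmod k + 1)) => [|e e0 _].
  by rewrite addr_ge0 ?cmod_ge0.
have [h ha ha'] := approx2 a e0; have [g hb hb'] := approx2 b e0.
have sp (V : lmodType R[i]) (x y z w : V) :
    k *: x + y - (k *: z + w) = k *: (x - z) + (y - w).
  by rewrite opprD addrACA scalerBr.
exists (k *: h + g); rewrite linearP pl !sp !mulrDl !mul1r; split.
  apply: le_trans (cs_add nA _ _) _; rewrite (cs_scale nA) lerD //.
  exact: (ler_wpM2l (cmod_ge0 k) ha).
apply: le_trans (cs_add nT _ _) _; rewrite (cs_scale nT) lerD //.
exact: (ler_wpM2l (cmod_ge0 k) ha').
Qed.

Let extension1 : extension 1 = 1.
Proof. by rewrite -(rmorph1 j) extensionE pm.1. Qed.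

Let mul_close (B : algType R[i]) (st : B -> B) (i : involution st) (N : B -> R)
    (hN : cstar_seminorm (alg_star i) N) (x y z w : B) e :
  0 < e -> e <= 1 -> N (x - z) <= e -> N (y - w) <= e ->
  N (x * y - z * w) <= (N x + N y + 1) * e.
Proof.
move=> e0 e1 h1 h2.
have -> : x * y - z * w = x * (y - w) + (x - z) * w.
  by rewrite mulrBr mulrBl addrA subrK.
have t1 := cs_add hN (x * (y - w)) ((x - z) * w).
have t2 := cs_mul hN x (y - w); have t3 := cs_mul hN (x - z) w.
have Nw : N w <= N y + 1.
  have := cs_add hN (w - y) y; rewrite subrK (cs_subC hN w); move: h2 e1; lra.
have u1 := ler_wpM2l (cs_ge0 hN x) h2.
have u2 := ler_pM (cs_ge0 hN (x - z)) (cs_ge0 hN w) h1 Nw.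
move: t1 t2 t3 u1 u2; rewrite /sa_mul /=; lra.
Qed.

Let extensionM a b : extension (a * b) = extension a * extension b.
Proof.
pose c := NA a + NA b + 1 + (NT (extension a) + NT (extension b) + 1).
have g0 := cs_ge0 nA; have g1 := cs_ge0 nT.
apply/esym/(extension_eq (c := c)) => [|e e0 e1].
  by rewrite /c !addr_ge0.
have [h ha ha'] := approx2 a e0; have [g hb hb'] := approx2 b e0.
exists (h * g); rewrite rmorphM pm.2 /c mulrDl; split.
  apply: le_trans (mul_close nA e0 e1 ha hb) _.
  by rewrite lerDl mulr_ge0 ?(ltW e0) // !addr_ge0.
apply: le_trans (mul_close nT e0 e1 ha' hb') _.
by rewrite lerDr mulr_ge0 ?(ltW e0) // !addr_ge0.
Qed.

Let extension_star (st : H -> H) : (forall h, j (st h) = stA (j h)) ->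
  (forall h, phi (st h) = stT (phi h)) ->
  forall a, extension (stA a) = stT (extension a).
Proof.
move=> js ps a; apply/esym/(extension_eq ler01) => e e0 _.
have [h ha ha'] := approx2 a e0; exists (st h); rewrite js ps mul1r.
have sB (B : algType R[i]) (s : B -> B) (i : involution s) x y : s (x - y) = s x - s y.
  case: i => sD sZ _ _ _; rewrite sD -scaleN1r sZ rmorphN1 scaleN1r //.
by rewrite -(sB _ _ iA) -(sB _ _ iT) (cs_isom nA) (cs_isom nT).
Qed.

Lemma extension_morphism : exists delta : {lrmorphism A -> T},
  (forall h, delta (j h) = phi h) /\
  forall st : H -> H, (forall h, j (st h) = stA (j h)) ->
    (forall h, phi (st h) = stT (phi h)) ->
    forall a, delta (stA a) = stT (delta a).
Proof.
pose lin := GRing.isLinear.Build R[i] A T *:%R extension extension_linear.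
pose mon := GRing.isMonoidMorphism.Build A T extension (conj extension1 extensionM).
pose delta : {lrmorphism A -> T} := HB.pack extension lin mon.
by exists delta; split; [exact: extensionE|exact: extension_star].
Qed.

End Extension.

(** * The scalars as a C*-algebra and as a Hilbert space *)

Section Scalars.
Variable R : realType.
Local Notation C := R[i].

Lemma cmod_sq (k : C) : Num.conj k * k = (cmod k ^+ 2)%:C%C.
Proof. by rewrite mulrC -normCK cmodE rmorphXn. Qed.

Lemma cmod_complete : complete_norm (@cmod R : C -> R).
Proof.
move=> x hx.
have Re_le (k : C) : `|complex.Re k| <= cmod k.
  rewrite /cmod; case: k => s t; rewrite normc_def /= -sqrtr_sqr ler_wsqrtr //.
  by rewrite lerDl sqr_ge0.
have Im_le (k : C) : `|complex.Im k| <= cmod k.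
  rewrite /cmod; case: k => s t; rewrite normc_def /= -sqrtr_sqr ler_wsqrtr //.
  by rewrite lerDr sqr_ge0.
have le_ReIm (k : C) : cmod k <= `|complex.Re k| + `|complex.Im k|.
  case: k => s t /=; have -> : (s +i* t)%C = s%:C%C + ('i * t%:C)%C.
    by rewrite [LHS]complexE.
  apply: le_trans (cmodD _ _) _; rewrite cmodM !cmod_real.
  have -> : cmod ('i%C : C) = 1 by rewrite /cmod normc_def /= expr0n add0r expr1n sqrtr1.
  by rewrite mul1r.
have [|a ha] := @real_cauchy R (fun n => complex.Re (x n)).
  move=> e /hx[k hk]; exists k => i l ki kl; rewrite -raddfB.
  exact: le_lt_trans (Re_le _) (hk _ _ ki kl).
have [|b hb] := @real_cauchy R (fun n => complex.Im (x n)).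
  move=> e /hx[k hk]; exists k => i l ki kl; rewrite -raddfB.
  exact: le_lt_trans (Im_le _) (hk _ _ ki kl).
exists (a +i* b)%C => e e0; have e20 : 0 < e / 2 by rewrite divr_gt0.
have /real_cvgP/(_ _ e20)[k1 h1] := ha; have /real_cvgP/(_ _ e20)[k2 h2] := hb.
exists (maxn k1 k2) => i; rewrite geq_max => /andP[i1 i2].
apply: le_lt_trans (le_ReIm _) _; rewrite !raddfB /=.
by have := h1 _ i1; have := h2 _ i2; lra.
Qed.

Lemma scalar_involution : @involution R C^o Num.conj.
Proof.
split=> [a b|k a|a b||a]; rewrite ?rmorphD ?rmorph1 ?conjCK //.
  by rewrite -[k *: a]/(k * a) rmorphM.
by rewrite rmorphM mulrC.
Qed.

Lemma scalar_cstar_algebra : @cstar_algebra R C^o Num.conj (@cmod R).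
Proof.
split; [exact: scalar_involution| |exact: cmod_complete].
split; first by split=> a; [exact: cmod_ge0|exact: cmod_eq0].
- exact: cmodD.
- exact: cmodM.
- by move=> a b; rewrite cmodM.
- by move=> a; rewrite cmodM cmod_conj expr2.
Qed.

Definition scalar_dot (x y : C^o) : C := x * Num.conj y.

Let scalar_dot_bil : bilinear_for *%R (Num.conj \; *%R) scalar_dot.
Proof.
split=> [y k a b|x k a b]; rewrite /scalar_dot /=.
  by rewrite mulrDl -mulrA.
by rewrite rmorphD rmorphM mulrDr mulrCA.
Qed.
HB.instance Definition _ := bilinear_isBilinear.Build C C^o C^o C *%R
  (Num.conj \; *%R) scalar_dot scalar_dot_bil.
Let scalar_dot_herm x y : scalar_dot x y = (-1) ^+ false * Num.conj (scalar_dot y x).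
Proof. by rewrite expr0 mul1r /scalar_dot rmorphM /= conjCK mulrC. Qed.
HB.instance Definition _ := isHermitianSesquilinear.Build C C^o false Num.conj
  scalar_dot scalar_dot_herm.
Let scalar_dot_pos (x : C^o) : x != 0 -> 0 < scalar_dot x x.
Proof. by move=> x0; rewrite /scalar_dot -normCK exprn_gt0 // normr_gt0. Qed.
HB.instance Definition _ := isDotProduct.Build C C^o scalar_dot scalar_dot_pos.

Lemma scalar_hnormE (x : C) : Num.sqrt (complex.Re (scalar_dot x x)) = cmod x.
Proof.
by rewrite /scalar_dot mulrC cmod_sq /= sqrtr_sqr ger0_norm // cmod_ge0.
Qed.

Definition scalar_hilbert : hilbert R.
Proof.
apply: (@Hilbert R C^o scalar_dot).
have -> : (fun x : C => Num.sqrt (complex.Re (scalar_dot x x))) = @cmod R.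
  by apply/funext => x; apply: scalar_hnormE.
exact: cmod_complete.
Defined.

End Scalars.

(** * The C*-norm of a matrix representation *)

Section MatrixNorm.
Variables (R : realType) (d : nat).
Local Notation C := R[i].
Local Notation X := 'cV[C]_d.

Definition cv_dot (x y : X) : C := \sum_i x i 0 * Num.conj (y i 0).

Lemma cv_dot_psd : psd_form cv_dot.
Proof.
split=> [y k a b|x y|x].
- rewrite /cv_dot scaler_sumr -big_split /=.
  by apply: eq_bigr => i _; rewrite !mxE mulrDl -mulrA.
- rewrite /cv_dot rmorph_sum; apply: eq_bigr => i _.
  by rewrite rmorphM /= conjCK mulrC.
- by apply: sumr_ge0 => i _; rewrite -normCK exprn_ge0.
Qed.
Let hd := cv_dot_psd.

Lemma cv_dot_definite x : fnorm cv_dot x = 0 -> x = 0.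
Proof.
move=> x0; have : cv_dot x x = 0.
  by rewrite (psd_real hd) -(fnorm_sq hd) x0 expr0n.
move=> /eqP; rewrite psumr_eq0 => [/allP h|i _]; last by rewrite -normCK exprn_ge0.
apply/matrixP => i k; rewrite ord1 mxE.
have := h i (mem_index_enum _); rewrite -normCK /= expf_eq0 /= normr_eq0.
by move=> /eqP.
Qed.

Lemma cv_dot_adj (A : 'M[C]_d) x y : cv_dot (A *m x) y = cv_dot x (adjmx A *m y).
Proof.
rewrite /cv_dot.
under eq_bigr => i _ do rewrite mxE mulr_suml.
rewrite exchange_big /=; apply: eq_bigr => k _.
rewrite mxE rmorph_sum mulr_sumr; apply: eq_bigr => i _.
by rewrite rmorphM !mxE /= conjCK; ring.
Qed.

Lemma fnorm_mulmx (A : 'M[C]_d) : exists c, forall x,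
  fnorm cv_dot (A *m x) <= c * fnorm cv_dot x.
Proof.
exists (\sum_i \sum_j cmod (A i j)) => x.
have edot i : cv_dot (delta_mx i 0) (delta_mx i 0) = 1.
  rewrite /cv_dot (bigD1 i) //= !mxE !eqxx /= mul1r conjC1 big1 ?addr0 // => k nki.
  by rewrite mxE (negPf nki) mul0r.
have en i : fnorm cv_dot (delta_mx i 0) = 1 by rewrite /fnorm edot /= sqrtr1.
have ec j : cmod (x j 0) <= fnorm cv_dot x.
  have -> : x j 0 = cv_dot x (delta_mx j 0).
    rewrite /cv_dot (bigD1 j) //= !mxE !eqxx /= conjC1 mulr1 big1 ?addr0 // => k nki.
    by rewrite mxE (negPf nki) conjC0 mulr0.
  by have := cauchy_schwarz hd x (delta_mx j 0); rewrite en mulr1.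
have dec : A *m x = \sum_i \sum_j (A i j * x j 0) *: delta_mx i 0.
  apply/matrixP => i k; rewrite ord1 mxE summxE [RHS](bigD1 i) //= summxE.
  rewrite [X in _ + X]big1 ?addr0 => [|l nli]; last first.
    by rewrite summxE big1 // => j _; rewrite !mxE eq_sym (negPf nli) mulr0.
  by apply: eq_bigr => j _; rewrite !mxE !eqxx /= mulr1.
have fsum (F : 'I_d -> X) : fnorm cv_dot (\sum_i F i) <= \sum_i fnorm cv_dot (F i).
  elim/big_ind2: _ => [|a b a' b' h h'|i _] //; first by rewrite (fnorm0 hd).
  by apply: le_trans (fnormD hd _ _) _; apply: lerD.
rewrite dec (le_trans (fsum _)) // mulr_suml ler_sum // => i _.
rewrite (le_trans (fsum _)) // mulr_suml ler_sum // => j _.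
by rewrite (fnormZ hd) en mulr1 cmodM ler_wpM2l // cmod_ge0.
Qed.

End MatrixNorm.

Section MatrixRepNorm.
Variables (R : realType) (d : nat) (A : algType R[i]) (st : A -> A).
Local Notation C := R[i].
Hypothesis hst : involution st.
Variable rho : A -> 'M[C]_d.
Hypotheses (rl : linear rho) (r1 : rho 1 = 1%:M)
  (rM : forall a b, rho (a * b) = rho a *m rho b)
  (rS : forall a, rho (st a) = adjmx (rho a)).

(** With this family, [family_norm] is the operator norm of [rho]. *)
Inductive matrix_family : forall X : lmodType C, (X -> X -> C) -> (A -> X -> X) -> Prop :=
  MatrixFamily : matrix_family (@cv_dot R d) (fun a x => rho a *m x).

Lemma matrix_rep_seminorm : exists2 p, cstar_seminorm (alg_star hst) p
  & forall a, p a = 0 -> rho a = 0.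
Proof.
have fpsd (X : lmodType C) (dot : X -> X -> C) r : matrix_family dot r -> psd_form dot.
  by case; exact: cv_dot_psd.
have frep (X : lmodType C) (dot : X -> X -> C) r :
    matrix_family dot r -> star_rep (alg_star hst) dot r.
  case; split=> [a k x y|x k a b|x|a b x|a x y] /=.
  - by rewrite mulmxDr scalemxAr.
  - by rewrite rl mulmxDl scalemxAl.
  - by rewrite r1 mul1mx.
  - by rewrite rM mulmxA.
  - by rewrite cv_dot_adj rS.
have fbound (a : A) : exists c, forall (X : lmodType C) (dot : X -> X -> C) r t,
    matrix_family dot r -> fnorm dot (r a t) <= c * fnorm dot t.
  have [c hc] := fnorm_mulmx (rho a); exists c => X dot r t hF.
  by case: hF t => t; apply: hc.
exists (family_norm matrix_family); first exact: (family_cstar_seminorm fpsd frep fbound).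
move=> a pa; apply/matrixP => i k.
have := family_norm_op fpsd frep fbound a (delta_mx k 0) MatrixFamily.
rewrite pa mul0r => h.
have : fnorm (@cv_dot R d) (rho a *m delta_mx k 0) = 0.
  by apply/eqP; rewrite eq_le h fnorm_ge0.
move=> /cv_dot_definite/matrixP/(_ i 0); rewrite !mxE => <-.
rewrite (bigD1 k) //= mxE !eqxx /= mulr1 big1 ?addr0 // => l nlk.
by rewrite mxE (negPf nlk) mulr0.
Qed.

End MatrixRepNorm.

Lemma seminorm_pullback (R : realType) (B B' : lmodType R[i]) (S : star_alg B)
    (S' : star_alg B') (p : B -> R) (f : B' -> B) :
  cstar_seminorm S p -> linear f ->
  (forall a b, f (sa_mul S' a b) = sa_mul S (f a) (f b)) ->
  (forall a, f (sa_star S' a) = sa_star S (f a)) ->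
  cstar_seminorm S' (fun a => p (f a)).
Proof.
move=> hp fl fM fS; split.
- by move=> a; apply: cs_ge0 hp _.
- by move=> a b; rewrite (linD fl); apply: cs_add hp _ _.
- by move=> k a; rewrite (linZ fl); apply: cs_scale hp _ _.
- by move=> a b; rewrite fM; apply: cs_mul hp _ _.
- by move=> a; rewrite fM fS; apply: cs_star hp _.
Qed.

(** * Hopf star-algebras generated by a unitary corepresentation *)

Lemma hopf_involution_alg (R : realType) (H : hopfAlgType R[i]) (st : H -> H) :
  hopf_involution st -> involution st.
Proof. by case. Qed.

Section UnitaryCorepresentation.
Variables (R : realType) (n : nat).
Local Notation C := R[i].
Variables (H : hopfAlgType C) (v : 'M[H]_n) (st : H -> H).
Local Notation S := (@antipode C H).
Hypotheses (hst : hopf_involution st) (cv : corepresentation v).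
Hypothesis vU : mxunitary st v.
Hypothesis gen : forall X : H -> Prop, subalgebra X ->
  (forall i j, X (v i j)) -> (forall i j, X (S (v i j))) -> forall a, X a.
Hypothesis hall : forall a : H, is_coefficient a.

Let ist : involution st := hopf_involution_alg hst.
Local Notation HS := (alg_star ist).

Hypothesis sep : forall a, (forall p, cstar_seminorm HS p -> p a = 0) -> a = 0.

Let SvE i j : S (v i j) = st (v j i).
Proof. exact: unitary_antipode. Qed.

Let column j : \sum_k st (v k j) * v k j = 1.
Proof.
have := congr1 (fun A : 'M_n => A j j) vU.2; rewrite !mxE eqxx /= => h; rewrite -[RHS]h.
by apply: eq_bigr => k _; rewrite !mxE.
Qed.

(** Unitarity of [v] is the hypothesis of [column_norm], in the completion for
[p]. *)
Lemma corepresentation_entry_norm p i j : cstar_seminorm HS p -> p (v i j) <= 1.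
Proof.
move=> hp; have [p0|p1] := eqVneq (p (sa_one HS)) 0.
  by rewrite -[v i j]mul1r (le_trans (cs_mul hp _ _)) // p0 mul0r ler01.
rewrite -(cnorm_map hp p1).
apply: (column_norm (completion_cstar_algebra hp p1)
  (x := fun k => completion_map hp p1 (v k j))).
have jl := completion_map_linear hp p1.
rewrite -[RHS](completion_map1 hp p1) -[sa_one HS]/(1 : H) -(column j) (lin_sum jl).
by apply: eq_bigr => k _; rewrite cstar_map -completion_mapM.
Qed.

(** The bounded elements form a subalgebra, which contains the generators by
[corepresentation_entry_norm]. *)
Lemma seminorms_bounded a : exists c, forall p, cstar_seminorm HS p -> p a <= c.
Proof.
move: a; apply: gen; last 2 first.
- by move=> i j; exists 1 => p; apply: corepresentation_entry_norm.
- move=> i j; exists 1 => p hp; rewrite SvE [p _](cs_isom hp).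
  exact: corepresentation_entry_norm.
split=> [|a b [c hc] [e he]|a b [c hc] [e he]|k a [c hc]].
- by exists 1 => p hp; case: (cs_one hp) => /= ->; rewrite ?ler01.
- exists (c + e) => p hp.
  by rewrite (le_trans (cs_add hp _ _)) // lerD ?hc ?he.
- exists (c * e) => p hp.
  by rewrite (le_trans (cs_mul hp _ _)) // ler_pM ?(cs_ge0 hp) ?hc ?he.
- exists (cmod k * c) => p hp.
  by rewrite (cs_scale hp) ler_wpM2l ?cmod_ge0 ?hc.
Qed.

Definition hopf_norm : H -> R := sup_seminorm HS.

Let hN : cstar_seminorm HS hopf_norm := sup_cstar_seminorm seminorms_bounded.

Lemma hopf_norm_eq0 a : hopf_norm a = 0 -> a = 0.
Proof.
move=> a0; apply: sep => p hp; apply/eqP; rewrite eq_le (cs_ge0 hp) andbT -a0.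
exact: (le_sup_seminorm seminorms_bounded).
Qed.

Lemma hopf_norm_biggest : biggest_cstar_norm st hopf_norm.
Proof.
split; last first.
  move=> N' hN' a; apply: (le_sup_seminorm seminorms_bounded).
  exact: cstar_norm_seminorm.
split; first by split=> a; [exact: (cs_ge0 hN)|exact: hopf_norm_eq0].
- exact: (cs_add hN).
- exact: (cs_scale hN).
- exact: (cs_mul hN).
- exact: (cs_star hN).
Qed.

Let N1 : hopf_norm (sa_one HS) != 0.
Proof. by apply/eqP => /hopf_norm_eq0/eqP; rewrite oner_eq0. Qed.

Let jl := completion_map_linear hN N1.
Let jm : monoid_morphism (completion_map hN N1).
Proof. by split; [exact: completion_map1|exact: completion_mapM]. Qed.

HB.instance Definition _ := GRing.isLinear.Build C H (completion hN N1) *:%R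
  (completion_map hN N1) jl.
HB.instance Definition _ := GRing.isMonoidMorphism.Build H (completion hN N1)
  (completion_map hN N1) jm.

Lemma hopf_completion_exists :
  exists (A : algType C) (stA : A -> A) (NA : A -> R) (j : {lrmorphism H -> A}),
    cstar_completion st hopf_norm stA NA j.
Proof.
exists (completion hN N1), (@cstar _ _ _ _ hN N1), (@cnorm _ _ _ _ hN N1),
  (completion_map hN N1).
split; [exact: completion_cstar_algebra| |exact: completion_dense_isometry].
by move=> a; rewrite cstar_map.
Qed.

End UnitaryCorepresentation.

(** * Woronowicz' axioms *)

Section Woronowicz.
Variables (R : realType) (n : nat).
Local Notation C := R[i].
Variables (H : hopfAlgType C) (v : 'M[H]_n) (st : H -> H).
Local Notation S := (@antipode C H).
Hypotheses (hst : hopf_involution st) (cv : corepresentation v).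
Hypothesis vU : mxunitary st v.
Hypothesis gen : forall X : H -> Prop, subalgebra X ->
  (forall i j, X (v i j)) -> (forall i j, X (S (v i j))) -> forall a, X a.
Hypothesis hall : forall a : H, is_coefficient a.

Let ist : involution st := hopf_involution_alg hst.
Local Notation HS := (alg_star ist).

Variable N : H -> R.
Hypotheses (N0 : forall a, N a = 0 -> a = 0)
  (Nmax : forall p, cstar_seminorm HS p -> forall a, p a <= N a).
Variables (A : algType C) (stA : A -> A) (NA : A -> R) (j : {lrmorphism H -> A}).
Hypothesis hA : cstar_algebra stA NA.
Hypothesis js : forall a, j (st a) = stA (j a).
Hypothesis hj : dense_isometry N NA j.

Let iA : involution stA. Proof. by case: hA. Qed.
Let jl : linear j. Proof. by move=> k a b; rewrite linearP. Qed.
Let cw := corepresentation_comatrix cv.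

Let epsN a : cmod (counit a) <= N a.
Proof.
apply: (Nmax (p := fun a => cmod (counit a))).
apply: (seminorm_pullback (S := alg_star (scalar_involution R)) (p := @cmod R)
  (f := @counit C H)) => [|k b c|b c|b].
- by apply: cstar_norm_seminorm; case: (scalar_cstar_algebra R).
- by rewrite linearP.
- by rewrite /= rmorphM.
- by case: hst.
Qed.

Let eps_lin : linear (@counit C H : H -> C^o).
Proof. by move=> k a b; rewrite linearP. Qed.

Let eps_mon : monoid_morphism (@counit C H : H -> C^o).
Proof. by split=> [|a b]; rewrite ?rmorph1 ?rmorphM. Qed.

Let character : exists chi : {lrmorphism A -> C^o},
  forall a, chi (stA a) = Num.conj (chi a : C).
Proof.
have [chi [_ chiS]] :=
  extension_morphism hA (scalar_cstar_algebra R) hj eps_lin eps_mon epsN.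
by exists chi; apply: (chiS _ js); case: hst.
Qed.

Let character_rep : exists rho, @star_representation R A stA (scalar_hilbert R) rho.
Proof.
have [chi chiS] := character.
exists (fun a (x : C^o) => chi a * x : C^o).
split=> [|x k a b|x|a b x|a x y].
- split=> [a k x y|a]; first by rewrite mulrDr -[k *: x]/(k * x) mulrCA.
  exists (cmod (chi a)) => x.
  have hE (y : C^o) : hnorm (K := scalar_hilbert R) y = cmod y.
    exact: scalar_hnormE.
  by rewrite !hE cmodM.
- by rewrite linearP mulrDl -[k *: chi a]/(k * chi a) -mulrA.
- by rewrite rmorph1 mul1r.
- by rewrite rmorphM mulrA.
- rewrite -[LHS]/(chi a * x * Num.conj y) -[RHS]/(x * Num.conj (chi (stA a) * y)).
  by rewrite chiS rmorphM /= conjCK; ring.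
Qed.

(** The counit extends to a character of [A], and the norm of [1] is at least its
value under the product of two copies of this one-dimensional representation. *)
Lemma min_norm1 : min_norm stA stA (1 : tensor A A) != 0.
Proof.
have [rho chi_rep] := character_rep.
pose K := scalar_hilbert R; pose t : tensor K K := (1 : C^o) \ox (1 : C^o).
have ht : tensor_hnorm t = 1.
  rewrite /tensor_hnorm -[tensor_dot _ _]/(tdot (hilbert_dot K) (hilbert_dot K) t t).
  rewrite tdot_tens; try exact: hilbert_psd.
  by rewrite -[hilbert_dot _ _ _]/(1 * Num.conj 1 : C) rmorph1 !mulr1 /= sqrtr1.
have sr := star_representation_rep iA chi_rep.
have := min_norm_ge hA hA 1 chi_rep chi_rep (t := t).
rewrite (sr_one (tensor_star_rep (hilbert_psd K) (hilbert_psd K) sr sr)) ht.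
by move=> /(_ (lexx 1)) h; rewrite gt_eqF // (lt_le_trans ltr01 h).
Qed.

Let SvE i k : S (v i k) = st (v k i).
Proof. exact: unitary_antipode. Qed.

Local Notation As := (generated_star_subalgebra stA (map_mx j v)).

Let As_sub : star_subalgebra stA As.
Proof.
split; first split.
- by move=> X [[[]]].
- by move=> a b ha hb X hX; case: (hX) => [[[_ h _ _] _] _]; apply: h; [apply: ha|apply: hb].
- by move=> a b ha hb X hX; case: (hX) => [[[_ _ h _] _] _]; apply: h; [apply: ha|apply: hb].
- by move=> k a ha X hX; case: (hX) => [[[_ _ _ h] _] _]; apply: h; apply: ha.
- by move=> a ha X hX; case: (hX) => [[_ h] _]; apply: h; apply: ha.
Qed.

(** [H] is generated by the [v i j] and the [S (v i j)], which are their adjoints. *)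
Lemma generated_star_subalgebra_range a : As a <-> exists h, a = j h.
Proof.
split=> [|[h ->]].
  move=> /(_ (fun a => exists h, a = j h)); apply; split; last first.
    move=> _ [f ->]; exists (\sum_i \sum_k f (delta_mx i k) *: v i k).
    rewrite linear_sum; apply: eq_bigr => i _; rewrite linear_sum.
    by apply: eq_bigr => k _; rewrite linearZ mxE.
  split=> [|_ [h ->]]; last by exists (st h); rewrite js.
  split=> [|_ _ [h ->] [g ->]|_ _ [h ->] [g ->]|k _ [h ->]].
  - by exists 1; rewrite rmorph1.
  - by exists (h + g); rewrite rmorphD.
  - by exists (h * g); rewrite rmorphM.
  - by exists (k *: h); rewrite linearZ.
have [[X1 XD XM XZ] XS] := As_sub.
have Xv i k : As (j (v i k)).
  move=> X [_]; apply; have := entry_coefficients i k (map_mx j v).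
  by rewrite mxE.
move: h; apply: gen => // [|i k]; last by rewrite SvE js; apply: XS.
split=> [|b c|b c|k b].
- by rewrite rmorph1.
- by rewrite rmorphD; apply: XD.
- by rewrite rmorphM; apply: XM.
- by rewrite linearZ; apply: XZ.
Qed.

Let j_inj : injective j.
Proof.
move=> a b ab; apply/eqP; rewrite -subr_eq0; apply/eqP/N0.
have [[[_ _] _ _ _ _] _] : cstar_norm stA NA /\ True by case: hA.
have nA : cstar_seminorm (alg_star iA) NA.
  by apply: cstar_norm_seminorm; case: hA.
by rewrite -hj.1 raddfB /= ab subrr (cs0 nA).
Qed.

(** The isometry [j] is injective, because the norm of [H] is definite. *)
Let kappa_ex a : exists b, forall h, a = j h -> b = j (S h).
Proof.
have [[h ->]|nh] := pselect (exists h, a = j h); last first.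
  by exists 0 => h ah; case: nh; exists h.
by exists (j (S h)) => g /j_inj ->.
Qed.

Let kappa a := projT1 (cid (kappa_ex a)).

Let kappaE h : kappa (j h) = j (S h).
Proof. exact: (projT2 (cid (kappa_ex (j h)))). Qed.

(** The norm of [tmap j j (comul h)] is a C*-seminorm of [h], hence at most [N h]. *)
Let comul_extension : exists (T : algType C) (stT : T -> T) (NT : T -> R)
    (i : tensor A A -> T) (delta : {lrmorphism A -> T}),
  [/\ is_min_tensor stA stA stT NT i, forall a, delta (stA a) = stT (delta a)
    & forall h, delta (j h) = i (tmap j j (comul h))].
Proof.
have [T [stT [NT [i hi]]]] := min_tensor_exists hA hA min_norm1.
case: (hi) => hT il im is_ [iN _].
have jM : {morph j : a b / a * b} by move=> a b; rewrite rmorphM.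
have tjl := tmap_is_linear jl jl.
pose f h := tmap j j (comul h).
have fl : linear f by move=> k a b; rewrite /f linearP tjl.
have fM a b : f (a * b) = f a * f b by rewrite /f rmorphM /= tmapM.
have f1 : f 1 = 1 by rewrite /f rmorph1 tmap_tens // rmorph1.
have fS a : f (st a) = tmap stA stA (f a).
  rewrite /f; case: hst => _ -> _ _.
  have hD := sa_starD (tensor_star ist ist); have aD := sa_starD (tensor_star iA iA).
  rewrite /= in hD aD.
  have h0 : tmap st st 0 = 0 := sa_star0 (tensor_star ist ist).
  have a0 : tmap stA stA 0 = 0 := sa_star0 (tensor_star iA iA).
  move: (comul a); apply: tensor_ind => [|x y|x y hx hy].
  - by rewrite h0 (lin0 tjl) a0.
  - by rewrite tensor_star_tens // !(tmap_tens _ _ jl jl) tensor_star_tens // !js.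
  - by rewrite hD !(linD tjl) aD hx hy.
pose phi h := i (f h).
have phil : linear phi by move=> k a b; rewrite /phi fl il.
have phim : monoid_morphism phi.
  by split=> [|a b]; rewrite /phi ?f1 ?im.1 // fM im.2.
have phiN h : NT (phi h) <= N h.
  rewrite iN; apply: (Nmax (p := fun h => min_norm stA stA (f h))).
  exact: (seminorm_pullback (min_norm_cstar_seminorm hA hA) fl).
have [delta [dj ds]] := extension_morphism hA hT hj phil phim phiN.
exists T, stT, NT, i, delta; split=> //.
by apply: (ds _ js) => h; rewrite /phi fS is_.
Qed.

Lemma completion_woronowicz : woronowicz_axioms stA NA (map_mx j v).
Proof.
have nA : cstar_seminorm (alg_star iA) NA.
  by apply: cstar_norm_seminorm; case: hA.
have As_j h : As (j h) by apply/generated_star_subalgebra_range; exists h.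
have map1 : map_mx j (1%:M : 'M_n) = 1%:M :> 'M[A]_n.
  by apply/matrixP => i k; rewrite !mxE rmorph_nat.
have mapM (x y : 'M[H]_n) : map_mx j (x *m y) = map_mx j x *m map_mx j y.
  by rewrite map_mxM.
split.
- split=> //; rewrite /mxunitary; have -> : mxstar stA (map_mx j v) = map_mx j (mxstar st v).
    by apply/matrixP => i k; rewrite !mxE js.
  by case: vU => e e'; split; rewrite -mapM ?e ?e' map1.
- by move=> a e /(hj.2 a)[h hh]; exists (j h).
- have [T [stT [NT [i [delta [hi ds dj]]]]]] := comul_extension.
  exists T, stT, NT, i, delta; split=> //; apply/matrixP => p q; rewrite !mxE dj.
  case: hi => _ il im _ _.
  rewrite cw.1 (lin_sum (tmap_is_linear jl jl)) (lin_sum il); apply: eq_bigr => k _.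
  rewrite tmap_tens // !mxE -im.2 tensor_mul_tens mulr1 mul1r //.
- exists kappa; split.
  + by move=> _ /generated_star_subalgebra_range[h ->]; rewrite kappaE.
  + move=> k a b /generated_star_subalgebra_range[h ->].
    move=> /generated_star_subalgebra_range[g ->].
    by rewrite -linearP !kappaE !linearP.
  + move=> a b /generated_star_subalgebra_range[h ->].
    move=> /generated_star_subalgebra_range[g ->].
    by rewrite -rmorphM !kappaE antipode_antimul // rmorphM.
  + have -> : map_mx kappa (map_mx j v) = map_mx j (map_mx S v).
      by apply/matrixP => i k; rewrite !mxE kappaE.
    split; rewrite -mapM -map1; congr (map_mx j _); apply/matrixP => i k.
      rewrite !mxE -(antipode_comatrixr cw).
      by apply: eq_bigr => l _; rewrite mxE.
    rewrite !mxE -(antipode_comatrixl cw).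
    by apply: eq_bigr => l _; rewrite mxE.
  + move=> _ /generated_star_subalgebra_range[h ->].
    by rewrite -js kappaE -js kappaE; case: hst => _ _ _ ->.
Qed.

End Woronowicz.

(** * The minimal model of a twisted biunitary *)

Theorem theorem5p1 (R : realType) (n m : nat) (u : 'M['M[R[i]]_m]_n)
    (hu : twisted_biunitary u) (M : model u) (hM : minimal_model M) :
  exists st : model_alg M -> model_alg M,
    [/\ hopf_involution st,
        mxunitary st (model_corep M)
          /\ (forall a, model_rep M (st a) = adjmx (model_rep M a)),
        exists N : model_alg M -> R,
          [/\ biggest_cstar_norm st N,
              exists (A : algType R[i]) (stA : A -> A) (NA : A -> R)
                  (j : {lrmorphism model_alg M -> A}),
                cstar_completion st N stA NA j
            & forall (A : algType R[i]) (stA : A -> A) (NA : A -> R)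
                  (j : {lrmorphism model_alg M -> A}),
                cstar_completion st N stA NA j ->
                woronowicz_axioms stA NA (map_mx j (model_corep M))]
      & forall st' : model_alg M -> model_alg M,
          hopf_involution st' -> mxunitary st' (model_corep M) -> st' =1 st].
Proof.
have [P [uP Ph upi]] := twisted_biunitary_twist hu.
have lf := hM.1; have cv := model_corepP M.
have hall := left_faithful_coefficient lf; have hgen := left_faithful_ind lf.
have sep a : common_kernel (model_corep M) P a -> a = 0.
  move: a; apply: (minimal_model_hopf_ideal (I := common_kernel_ideal cv uP hall) hM).
  by move=> a; apply; apply: upi.
pose st := hopf_star hgen sep.
have hst : hopf_involution st by apply: hopf_star_hopf_involution.
have vU : mxunitary st (model_corep M) by apply: hopf_star_unitary.
have gen := generators_ind hgen sep.
pose ist := hopf_involution_alg hst.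
have nsep a : (forall p, cstar_seminorm (alg_star ist) p -> p a = 0) -> a = 0.
  move=> pa; apply: (sep a) => d rho hr; case: (hr) => rl r1 rM _ _.
  have [|p hp] := matrix_rep_seminorm ist rl r1 rM.
    by move=> b; apply: unirep_star.
  by apply; apply: pa.
exists st; split=> //.
- by split=> // a; apply: unirep_star.
- exists (hopf_norm hst); split.
  + exact: (hopf_norm_biggest cv vU gen nsep).
  + exact: (hopf_completion_exists cv vU gen nsep).
  + move=> A stA NA j [hA js hj].
    apply: (completion_woronowicz (hst := hst) cv vU gen hall _ _ hA js hj).
    * exact: (hopf_norm_eq0 cv vU gen nsep).
    * move=> p hp a.
      exact: (le_sup_seminorm (seminorms_bounded hst cv vU gen) a hp).
- by move=> st' [ist' _ _ _]; apply: hopf_star_uniq.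
Qed.
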